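(* Let $\mathfrak M=M(\mathfrak g,\sigma_1,\dots,\sigma_n,m_1,\dots,m_n)$ be a multiloop algebra, and let $V,V'$ be irreducible finite-dimensional representations of $\mathfrak M$. Write $V=\bigotimes_{x\in\mathbf x}V_x$ and $V'=\bigotimes_{x\in\mathbf x}V'_x$ for some $\mathbf x\in X_*$ and (possibly trivial) irreducible evaluation representations $V_x,V'_x$ at $x\in\mathbf x$. (a) If $V_x\not\cong V'_x$ for more than one $x\in\mathbf x$, then $\operatorname{Ext}^1_{\mathfrak M}(V,V')=0$. (b) If $V_{x_0}\not\cong V'_{x_0}$ for some $x_0\in\mathbf x$, and $V_x\cong V'_x$ for all $x\in\mathbf x\setminus\{x_0\}$, then $$\operatorname{Ext}^1_{\mathfrak M}(V,V')\cong\operatorname{Hom}_{\mathfrak g}(\mathfrak g,V_{x_0}^*\otimes V'_{x_0})\otimes k^n.$$ (c) If $V\cong V'$, then $$\operatorname{Ext}^1_{\mathfrak M}(V,V)\cong\bigoplus_{x\in\mathbf x}\operatorname{Hom}_{\mathfrak g}(\mathfrak g,V_x^*\otimes V_x)\otimes k^n.$$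
   Context: $k$ is an algebraically closed field of characteristic $0$. Multiloop algebra: fix positive integers $n,m_1,\dots,m_n$, a finite-dimensional semisimple Lie algebra $\mathfrak g$ over $k$, commuting automorphisms $\sigma_1,\dots,\sigma_n$ of $\mathfrak g$ with $\sigma_i^{m_i}=\mathrm{Id}$, and primitive $m_i$-th roots of unity $\xi_i\in k$. Let $\Gamma=\langle\gamma_1,\dots,\gamma_n\rangle\cong\mathbb Z/m_1\mathbb Z\times\cdots\times\mathbb Z/m_n\mathbb Z$ act on $\mathfrak g$ with $\gamma_i$ acting by $\sigma_i$, and on $X=(k^\times)^n$ by $\gamma_i\cdot(z_1,\dots,z_n)=(z_1,\dots,z_{i-1},\xi_iz_i,z_{i+1},\dots,z_n)$. Then $M(\mathfrak g,\sigma_1,\dots,\sigma_n,m_1,\dots,m_n)=M(X,\mathfrak g)^\Gamma$ is the Lie algebra of $\Gamma$-equivariant regular maps $X\to\mathfrak g$ (pointwise bracket). $X_*$ is the set of finite subsets of $X_{\rm rat}=(k^\times)^n$ whose distinct points lie in distinct $\Gamma$-orbits. Since $\Gamma$ acts freely on $X$, evaluation at any $x\in X_{\rm rat}$ gives a surjective Lie algebra homomorphism $\operatorname{ev}_x:\mathfrak M\to\mathfrak g$; an (irreducible) evaluation representation at $x$ is the pullback along $\operatorname{ev}_x$ of an (irreducible) finite-dimensional representation of $\mathfrak g$, and it is regarded both as an $\mathfrak M$-module and as a $\mathfrak g$-module. Every irreducible finite-dimensional representation of $\mathfrak M$ is a tensor product of irreducible evaluation representations at the points of some $\mathbf x\in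 X_*$. $\operatorname{Ext}^1_{\mathfrak M}(V,V')$ is the space of equivalence classes of extensions $0\to V'\to U\to V\to 0$ of $\mathfrak M$-modules; isomorphisms are $k$-linear; $\mathfrak g$ is considered as a module via the adjoint representation. *)

(* Defs.v *)
From HB Require Import structures.
From mathcomp Require Import all_boot all_order all_algebra finmap generic_quotient.
From mathcomp Require Import boolp functions.

Set Implicit Arguments.
Unset Strict Implicit.
Unset Printing Implicit Defensive.

Import GRing.Theory.
Import VectorInternalTheory.

Local Open Scope ring_scope.

HB.mixin Record Lmodule_isLieAlgebra (k : fieldType) (L : Type)
    of GRing.Lmodule k L := {
  lie : L -> L -> L;
  lie_linearl : forall y, linear (lie^~ y);
  lie_linearr : forall x, linear (lie x);
  lie_alt : forall x, lie x x = 0;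
  lie_jacobi : forall x y z,
    lie x (lie y z) + lie y (lie z x) + lie z (lie x y) = 0
}.

#[short(type="lieAlgType")]
HB.structure Definition LieAlgebra (k : fieldType) :=
  { L of GRing.Lmodule k L & Lmodule_isLieAlgebra k L }.

#[short(type="fdLieAlgType")]
HB.structure Definition FdLieAlgebra (k : fieldType) :=
  { L of Vector k L & Lmodule_isLieAlgebra k L }.

Arguments lie {k s} x y.

HB.instance Definition _ (k : fieldType) (L : lieAlgType k) (x : L) :=
  GRing.isLinear.Build k L L *:%R (lie x) (lie_linearr x).

Lemma lieDl (k : fieldType) (L : lieAlgType k) (x y z : L) :
  lie (x + y) z = lie x z + lie y z.
Proof. by have := lie_linearl z 1 x y; rewrite !scale1r. Qed.

Lemma lie0l (k : fieldType) (L : lieAlgType k) (z : L) : lie 0 z = 0.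
Proof.
by have := lie_linearl z (-1) 0 0; rewrite !scaleN1r addr0 oppr0 addNr.
Qed.

Lemma lieZl (k : fieldType) (L : lieAlgType k) a (x z : L) :
  lie (a *: x) z = a *: lie x z.
Proof. by have := lie_linearl z a x 0; rewrite !addr0 lie0l addr0. Qed.

Lemma lieC (k : fieldType) (L : lieAlgType k) (x y : L) : lie x y = - lie y x.
Proof.
have := lie_alt (x + y).
by rewrite lieDl !linearD /= !lie_alt add0r addr0 => /eqP; rewrite addr_eq0 => /eqP.
Qed.

(* The radical vanishes, i.e. 0 is the only solvable ideal.                    *)
Section Semisimple.
Variables (k : fieldType) (g : fdLieAlgType k).

Definition is_ideal (I : {vspace g}) := forall x y : g, y \in I -> lie x y \in I.

Definition derived (I : {vspace g}) : {vspace g} :=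
  <<[seq lie x y | x <- vbasis I, y <- vbasis I]>>%VS.

Definition solvable (I : {vspace g}) := exists r, iter r derived I = 0%VS.

Definition semisimple := forall I, is_ideal I -> solvable I -> I = 0%VS.

Record lie_aut := LieAut {
  lie_aut_fun :> 'End(g);
  lie_aut_bij : bijective lie_aut_fun;
  lie_aut_lie : forall x y : g,
    lie_aut_fun (lie x y) = lie (lie_aut_fun x) (lie_aut_fun y)
}.

End Semisimple.

Section Reps.
Variables (k : fieldType) (L : lieAlgType k).

Record fdrep := FdRep {
  rep_space :> vectType k;
  rep_act : {linear L -> 'End(rep_space)};
  rep_lie : forall (a b : L) (v : rep_space),
    rep_act (lie a b) v = rep_act a (rep_act b v) - rep_act b (rep_act a v)
}.

Definition is_rep_hom (V W : fdrep) (f : 'Hom(V, W)) :=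
  forall (a : L) (v : V), f (rep_act V a v) = rep_act W a (f v).

Definition rep_iso (V W : fdrep) :=
  exists f : 'Hom(V, W), bijective f /\ is_rep_hom f.

Definition irreducible (V : fdrep) :=
  {: V}%VS <> 0%VS /\
  forall U : {vspace V},
    (forall (a : L) (v : V), v \in U -> rep_act V a v \in U) ->
    U = 0%VS \/ U = {: V}%VS.

End Reps.

Arguments rep_act {k L} f0 : rename.

(* Tensor products, in coordinates: v (x) w is the rank-one matrix of products *)
(* of coordinates; tensorv_universal is the universal property.                *)
Section Tensor.
Variable k : fieldType.
Implicit Types U V W : vectType k.

Definition tensor V W : vectType k := 'M[k]_(dim V, dim W).

Definition tensorv V W (v : V) (w : W) : tensor V W := (v2r v)^T *m v2r w.

Definition tensor_fun V V' W W' (f : 'Hom(V, V')) (h : 'Hom(W, W')) :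
    tensor V W -> tensor V' W' :=
  fun t => (f2mx f)^T *m t *m f2mx h.

Fact tensor_fun_linear V V' W W' (f : 'Hom(V, V')) (h : 'Hom(W, W')) :
  linear (tensor_fun f h).
Proof.
by move=> a t u; rewrite /tensor_fun mulmxDr mulmxDl -scalemxAr -scalemxAl.
Qed.
HB.instance Definition _ V V' W W' (f : 'Hom(V, V')) (h : 'Hom(W, W')) :=
  GRing.isLinear.Build k (tensor V W) (tensor V' W') *:%R (tensor_fun f h)
    (tensor_fun_linear f h).

Definition tensor_lfun V V' W W' (f : 'Hom(V, V')) (h : 'Hom(W, W')) :
  'Hom(tensor V W, tensor V' W') := linfun (tensor_fun f h).

Lemma v2r_lfun V W (f : 'Hom(V, W)) v : v2r (f v) = v2r v *m f2mx f.
Proof. by rewrite unlock /= r2vK. Qed.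

Lemma tensor_lfunE V V' W W' (f : 'Hom(V, V')) (h : 'Hom(W, W')) v w :
  tensor_lfun f h (tensorv v w) = tensorv (f v) (h w).
Proof.
by rewrite lfunE /= /tensor_fun /tensorv !v2r_lfun trmx_mul !mulmxA.
Qed.

Lemma tensorvDl V W (v v' : V) (w : W) :
  tensorv (v + v') w = tensorv v w + tensorv v' w.
Proof. by rewrite /tensorv !linearD /= mulmxDl. Qed.

Lemma tensorvZl V W a (v : V) (w : W) : tensorv (a *: v) w = a *: tensorv v w.
Proof. by rewrite /tensorv !linearZ /= -scalemxAl. Qed.

Lemma tensorvDr V W (v : V) (w w' : W) :
  tensorv v (w + w') = tensorv v w + tensorv v w'.
Proof. by rewrite /tensorv !linearD /=. Qed.

Lemma tensorvZr V W a (v : V) (w : W) : tensorv v (a *: w) = a *: tensorv v w.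
Proof. by rewrite /tensorv !linearZ. Qed.

Lemma tensorv_sum V W (t : tensor V W) :
  t = \sum_i \sum_j t i j *:
        tensorv (r2v (delta_mx 0 i) : V) (r2v (delta_mx 0 j) : W).
Proof.
rewrite {1}(matrix_sum_delta t); apply: eq_bigr => i _; apply: eq_bigr => j _.
by congr (_ *: _); rewrite /tensorv !r2vK trmx_delta mul_delta_mx.
Qed.

Lemma tensorv_ext V W (Z : lmodType k) (f h : {linear tensor V W -> Z}) :
  (forall v w, f (tensorv v w) = h (tensorv v w)) -> f =1 h.
Proof.
move=> fh t; rewrite (tensorv_sum t) !linear_sum; apply: eq_bigr => i _ /=.
by rewrite !linear_sum; apply: eq_bigr => j _ /=; rewrite !linearZ /= fh.
Qed.

Lemma tensor_lfun_ext V W U (f h : 'Hom(tensor V W, U)) :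
  (forall v w, f (tensorv v w) = h (tensorv v w)) -> f = h.
Proof. by move=> fh; apply/lfunP; apply: tensorv_ext. Qed.

Lemma tensorv_universal V W (Z : lmodType k) (b : V -> W -> Z) :
  (forall w, linear (b^~ w)) -> (forall v, linear (b v)) ->
  exists2 f : {linear tensor V W -> Z},
    forall v w, f (tensorv v w) = b v w
    & forall h : {linear tensor V W -> Z},
        (forall v w, h (tensorv v w) = b v w) -> h =1 f.
Proof.
move=> bl br.
pose bL w : {linear V -> Z} :=
  HB.pack (b^~ w) (GRing.isLinear.Build k V Z *:%R (b^~ w) (bl w)).
pose bR v : {linear W -> Z} :=
  HB.pack (b v) (GRing.isLinear.Build k W Z *:%R (b v) (br v)).
pose f (t : tensor V W) := \sum_i \sum_j t i j *:
   b (r2v (delta_mx 0 i) : V) (r2v (delta_mx 0 j) : W).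
have f_lin : linear f.
  move=> a t u; rewrite /f scaler_sumr -big_split; apply: eq_bigr => i _ /=.
  rewrite scaler_sumr -big_split; apply: eq_bigr => j _ /=.
  by rewrite !mxE scalerDl scalerA.
pose F : {linear tensor V W -> Z} :=
  HB.pack f (GRing.isLinear.Build k (tensor V W) Z *:%R f f_lin).
have FE v w : F (tensorv v w) = b v w.
  have dec (U : vectType k) (u : U) : u = \sum_i v2r u 0 i *: r2v (delta_mx 0 i).
    rewrite -[LHS]v2rK {1}[v2r u]row_sum_delta linear_sum.
    by apply: eq_bigr => i _; rewrite linearZ.
  transitivity (bL w (\sum_i v2r v 0 i *: r2v (delta_mx 0 i))); last by rewrite -dec.
  rewrite linear_sum; apply: eq_bigr => i _; rewrite [RHS]linearZ /=.
  transitivity (v2r v 0 i *: bR (r2v (delta_mx 0 i))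
                  (\sum_j v2r w 0 j *: r2v (delta_mx 0 j))); last by rewrite -dec.
  rewrite linear_sum scaler_sumr; apply: eq_bigr => j _.
  by rewrite linearZ /= scalerA /tensorv !mxE big_ord1 !mxE.
exists F => // h hE; apply: tensorv_ext => v w; by rewrite hE FE.
Qed.

End Tensor.

Section MkRep.
Variables (k : fieldType) (L : lieAlgType k) (V : vectType k).
Variable act : L -> V -> V.
Hypothesis act_linr : forall a, linear (act a).
Hypothesis act_linl : forall v, linear (act^~ v).
Hypothesis act_lie : forall a b v,
  act (lie a b) v = act a (act b v) - act b (act a v).

Let act_lin a : {linear V -> V} :=
  HB.pack (act a) (GRing.isLinear.Build k V V *:%R (act a) (act_linr a)).

Definition mk_act (a : L) : 'End(V) := linfun (act a).

Fact mk_actE a v : mk_act a v = act a v.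
Proof. exact: (lfunE (act_lin a)). Qed.

Fact mk_act_linear : linear mk_act.
Proof.
move=> c a b; apply/lfunP => v.
by rewrite add_lfunE scale_lfunE !mk_actE act_linl.
Qed.

Definition mk_act_lin : {linear L -> 'End(V)} :=
  HB.pack mk_act (GRing.isLinear.Build k L 'End(V) *:%R mk_act mk_act_linear).

Fact mk_act_lie a b v : mk_act_lin (lie a b) v =
  mk_act_lin a (mk_act_lin b v) - mk_act_lin b (mk_act_lin a v).
Proof. by rewrite /= !mk_actE act_lie. Qed.

Definition mk_rep : fdrep L := FdRep mk_act_lie.

Lemma mk_repE a v : rep_act mk_rep a v = act a v.
Proof. exact: mk_actE. Qed.

End MkRep.

Section RepOps.
Variables (k : fieldType) (L : lieAlgType k).
Implicit Types V W : fdrep L.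

Lemma rep_actDl V (a b : L) v : rep_act V (a + b) v = rep_act V a v + rep_act V b v.
Proof. by rewrite linearD add_lfunE. Qed.

Lemma rep_actZl V c (a : L) v : rep_act V (c *: a) v = c *: rep_act V a v.
Proof. by rewrite linearZ scale_lfunE. Qed.

Section Triv.
Definition triv_act (a : L) (v : k^o) : k^o := 0.
Fact triv_linr a : linear (triv_act a).
Proof. by move=> c u v; rewrite /triv_act scaler0 addr0. Qed.
Fact triv_linl v : linear (triv_act^~ v).
Proof. by move=> c a b; rewrite /triv_act scaler0 addr0. Qed.
Fact triv_lie a b v :
  triv_act (lie a b) v = triv_act a (triv_act b v) - triv_act b (triv_act a v).
Proof. by rewrite /triv_act subrr. Qed.
Definition triv_rep : fdrep L := mk_rep triv_linr triv_linl triv_lie.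
End Triv.

Section Dual.
Variable V : fdrep L.
Definition dual_act (a : L) (phi : 'Hom(V, k^o)) : 'Hom(V, k^o) :=
  - (phi \o rep_act V a)%VF.
Fact dual_linr a : linear (dual_act a).
Proof.
move=> c u v; rewrite /dual_act; apply/lfunP => x.
by rewrite !(comp_lfunE, opp_lfunE, scale_lfunE, add_lfunE) opprD scalerN.
Qed.
Fact dual_linl v : linear (dual_act^~ v).
Proof.
move=> c a b; rewrite /dual_act; apply/lfunP => x.
rewrite !(comp_lfunE, opp_lfunE, scale_lfunE, add_lfunE) rep_actDl rep_actZl.
by rewrite linearD linearZ opprD scalerN.
Qed.
Fact dual_lie a b v :
  dual_act (lie a b) v = dual_act a (dual_act b v) - dual_act b (dual_act a v).
Proof.
rewrite /dual_act; apply/lfunP => x.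
rewrite !(comp_lfunE, opp_lfunE, scale_lfunE, add_lfunE) rep_lie.
by rewrite linearB !opprK opprB.
Qed.
Definition dual_rep : fdrep L := mk_rep dual_linr dual_linl dual_lie.
End Dual.

Section Tens.
Variables V W : fdrep L.
Definition tens_act (a : L) : tensor V W -> tensor V W :=
  tensor_lfun (rep_act V a) \1 + tensor_lfun \1 (rep_act W a).
Fact tens_actE a v w : tens_act a (tensorv v w) =
  tensorv (rep_act V a v) w + tensorv v (rep_act W a w).
Proof. by rewrite /tens_act add_lfunE !tensor_lfunE !id_lfunE. Qed.
Fact tens_linr a : linear (tens_act a).
Proof. by move=> c u v; rewrite /tens_act linearP. Qed.
Fact tens_linl v : linear (tens_act^~ v).
Proof.
move=> c a b; rewrite /tens_act /=.
rewrite -scale_lfunE -add_lfunE; congr (fun_of_lfun _ v); move: v => _.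
apply: tensor_lfun_ext => v w.
rewrite !(add_lfunE, scale_lfunE) !tensor_lfunE !id_lfunE !rep_actDl !rep_actZl.
rewrite tensorvDl tensorvZl tensorvDr tensorvZr scalerDr -!addrA.
by congr (_ + _); rewrite addrCA.
Qed.
Fact tens_lie a b v :
  tens_act (lie a b) v = tens_act a (tens_act b v) - tens_act b (tens_act a v).
Proof.
rewrite /tens_act -!comp_lfunE -opp_lfunE -add_lfunE.
congr (fun_of_lfun _ v); move: v => _; apply: tensor_lfun_ext => v w.
rewrite !(add_lfunE, opp_lfunE, comp_lfunE) !tensor_lfunE !id_lfunE.
rewrite !linearD /= !tensor_lfunE !id_lfunE !rep_lie.
have NL (x : V) (y : W) : - tensorv x y = tensorv (- x) y.
  by rewrite -!scaleN1r tensorvZl.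
have NR (x : V) (y : W) : - tensorv x y = tensorv x (- y).
  by rewrite -!scaleN1r tensorvZr.
rewrite tensorvDl tensorvDr -NL -NR.
have aux (Z : zmodType) (x1 x2 y1 y2 p q : Z) : x1 - x2 + (y1 - y2) =
    x1 + p + (q + y1) + (- x2 - q + (- p - y2)).
  rewrite [RHS]addrACA (addrACA x1 p) (addrACA q) -[RHS]addrA (addrA (p - q)).
  by rewrite -[q - p]opprB subrr add0r.
exact: aux.
Qed.
Definition tens_rep : fdrep L := mk_rep tens_linr tens_linl tens_lie.
Lemma tens_repE a v w : rep_act tens_rep a (tensorv v w) =
  tensorv (rep_act V a v) w + tensorv v (rep_act W a w).
Proof. by rewrite mk_repE tens_actE. Qed.
End Tens.

End RepOps.

Section FdReps.
Variables (k : fieldType) (g : fdLieAlgType k).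

Fact adj_linl (y : g) : linear (lie^~ y).
Proof. exact: lie_linearl. Qed.
Fact adj_lie (a b v : g) : lie (lie a b) v = lie a (lie b v) - lie b (lie a v).
Proof.
have /eqP := lie_jacobi a b v; rewrite -addrA addr_eq0 => /eqP ->.
rewrite [lie v (lie a b)]lieC [lie v a]lieC linearN /=.
by rewrite opprD !opprK [RHS]addrC addKr.
Qed.
Definition adj_rep : fdrep g := mk_rep (@lie_linearr k g) adj_linl adj_lie.

Definition hom_defect (V W : fdrep g) (a : g) (f : 'Hom(V, W)) : 'Hom(V, W) :=
  (f \o rep_act V a)%VF - (rep_act W a \o f)%VF.

(* The intertwining condition is only imposed on a basis of g; see rep_homsP. *)
Definition rep_homs (V W : fdrep g) : {vspace 'Hom(V, W)} :=
  (\bigcap_(i < \dim {: g})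
     lker (linfun (hom_defect (vbasis {: g})`_i)))%VS.

Lemma rep_homsP (V W : fdrep g) (f : 'Hom(V, W)) :
  reflect (is_rep_hom f) (f \in rep_homs V W).
Proof.
have lin a : linear (@hom_defect V W a).
  move=> c u v; apply/lfunP => x; rewrite /hom_defect.
  rewrite !(comp_lfunE, opp_lfunE, scale_lfunE, add_lfunE) linearP.
  by rewrite opprD scalerBr addrACA.
pose F a : {linear 'Hom(V, W) -> 'Hom(V, W)} := HB.pack (@hom_defect V W a)
  (GRing.isLinear.Build k 'Hom(V, W) 'Hom(V, W) *:%R (@hom_defect V W a) (lin a)).
have kerP a : (f \in lker (linfun (F a))) =
    (f \o rep_act V a == rep_act W a \o f)%VF.
  by rewrite memv_ker lfunE /= subr_eq0.
apply: (iffP idP) => [fH a v|fH].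
  have fE i : (f \o rep_act V (vbasis {: g})`_i =
               rep_act W (vbasis {: g})`_i \o f)%VF.
    case: (ltnP i (\dim {: g})) => [lti|gei].
      apply/eqP; rewrite -kerP.
      by move: fH; rewrite memvE => /subv_bigcapP/(_ (Ordinal lti) isT).
    by rewrite nth_default ?size_tuple // !linear0 comp_lfun0r comp_lfun0l.
  rewrite (coord_vbasis (memvf a)) !linear_sum !sum_lfunE linear_sum.
  apply: eq_bigr => i _; rewrite !linearZ !scale_lfunE linearZ /=; congr (_ *: _).
  by rewrite -!comp_lfunE fE.
rewrite memvE; apply/subv_bigcapP => i _; rewrite -memvE kerP.
by apply/eqP/lfunP => v; rewrite !comp_lfunE fH.
Qed.

End FdReps.

Section Extensions.
Variables (k : fieldType) (L : lieAlgType k) (V V' : fdrep L).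

(* 0 -> V' -> U -> V -> 0; such a U is automatically finite-dimensional.       *)
Record extension := Extension {
  ext_mid :> fdrep L;
  ext_in : 'Hom(V', ext_mid);
  ext_out : 'Hom(ext_mid, V);
  ext_in_hom : is_rep_hom ext_in;
  ext_out_hom : is_rep_hom ext_out;
  ext_in_inj : injective ext_in;
  ext_out_surj : forall v, exists u, ext_out u = v;
  ext_exact : forall u, ext_out u = 0 <-> exists x, ext_in x = u
}.

Definition ext_equiv (E E' : extension) :=
  exists f : 'Hom(E, E'),
    [/\ is_rep_hom f,
        forall x, f (ext_in E x) = ext_in E' x
      & forall u, ext_out E' (f u) = ext_out E u].

(* E is the pushout along the addition V' (+) V' -> V' of the fibre product of *)
(* E1 and E2 over V: there is a morphism of extensions from the fibre product  *)
(* to E inducing the addition on V' and the identity on V. (A linear map on    *)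
(* the fibre product is written as the restriction of one on E1 * E2.)         *)
Definition is_baer_sum (E1 E2 E : extension) :=
  exists f : 'Hom((E1 * E2)%type, E),
    [/\ forall a u1 u2, ext_out E1 u1 = ext_out E2 u2 ->
          f (rep_act E1 a u1, rep_act E2 a u2) = rep_act E a (f (u1, u2)),
        forall x y, f (ext_in E1 x, ext_in E2 y) = ext_in E (x + y)
      & forall u1 u2, ext_out E1 u1 = ext_out E2 u2 ->
          ext_out E (f (u1, u2)) = ext_out E1 u1].

(* E' is the pushout of E along multiplication by c on V'.                     *)
Definition is_ext_scale (c : k) (E E' : extension) :=
  exists f : 'Hom(E, E'),
    [/\ is_rep_hom f,
        forall x, f (ext_in E x) = ext_in E' (c *: x)
      & forall u, ext_out E' (f u) = ext_out E u].

Definition is_cocycle (c : L -> 'Hom(V, V')) :=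
  linear c /\ forall a b v, c (lie a b) v =
    (rep_act V' a (c b v) + c a (rep_act V b v))
    - (rep_act V' b (c a v) + c b (rep_act V a v)).

Definition has_cocycle (E : extension) (c : L -> 'Hom(V, V')) :=
  exists s : 'Hom(V, E), (forall v, ext_out E (s v) = v) /\
    forall a v, rep_act E a (s v) = s (rep_act V a v) + ext_in E (c a v).

Lemma mk_lfun (U W : vectType k) (f : U -> W) : linear f ->
  {h : 'Hom(U, W) | h =1 f}.
Proof.
move=> fl; pose F : {linear U -> W} :=
  HB.pack f (GRing.isLinear.Build k U W *:%R f fl).
by exists (linfun F) => u; rewrite lfunE.
Qed.

Lemma lfun_section (U W : vectType k) (p : 'Hom(U, W)) :
  (forall w, exists u, p u = w) -> exists s : 'Hom(W, U), forall w, p (s w) = w.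
Proof.
move=> p_surj; exists (p^-1)%VF => w; apply: limg_lfunVK.
by have [u <-] := p_surj w; apply: memv_img; apply: memvf.
Qed.

Lemma lfun_retract (U W : vectType k) (i : 'Hom(U, W)) :
  injective i -> exists r : 'Hom(W, U), forall u, r (i u) = u.
Proof.
move=> i_inj; exists (i^-1)%VF => u; apply: lker0_lfunK.
by apply/lker0P.
Qed.

Lemma has_cocycleP E : exists2 c, is_cocycle c & has_cocycle E c.
Proof.
have [s sK] := lfun_section (@ext_out_surj E).
have [r rK] := lfun_retract (@ext_in_inj E).
pose c a : 'Hom(V, V') := (r \o ((rep_act E a \o s) - (s \o rep_act V a)))%VF.
have cE a v : ext_in E (c a v) = rep_act E a (s v) - s (rep_act V a v).
  rewrite /c comp_lfunE add_lfunE opp_lfunE !comp_lfunE.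
  set u := _ - _; suff [x <-] : exists x, ext_in E x = u by rewrite rK.
  apply/ext_exact; by rewrite /u linearB /= ext_out_hom !sK subrr.
have hc a v : rep_act E a (s v) = s (rep_act V a v) + ext_in E (c a v).
  by rewrite cE addrCA subrr addr0.
exists c; last by exists s.
split=> [z a b|a b v].
  apply/lfunP => v; apply: (@ext_in_inj E); rewrite add_lfunE scale_lfunE.
  rewrite [RHS]linearP /= !cE !rep_actDl !rep_actZl.
  by rewrite [s (_ + _)]linearP opprD scalerBr addrACA.
apply: (@ext_in_inj E).
rewrite [RHS]linearB /= !linearD /= !ext_in_hom cE !rep_lie !hc linearB /=.
rewrite !linearD /= !hc.
have aux (Z : zmodType) (s1 s2 c1 c2 d1 d2 : Z) :
    s1 + c1 + d1 + (- (s2 + c2) - d2) + (- s1 - - s2) = d1 + c1 + (- d2 - c2).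
  rewrite opprK opprD !addrA [LHS](ACl (1*7*4*8*3*2*6*5)) /=.
  by rewrite subrr add0r addNr add0r.
exact: aux.
Qed.

Definition pair_rep_act (c : L -> 'Hom(V, V')) (a : L) (u : (V' * V)%type) :
    (V' * V)%type :=
  (rep_act V' a u.1 + c a u.2, rep_act V a u.2).

Lemma has_cocycle_exists c : is_cocycle c -> exists E, has_cocycle E c.
Proof.
move=> [c_lin c_lie].
have linr a : linear (pair_rep_act c a).
  move=> z [x v] [x' v'].
  have e1 : rep_act V' a (z *: x + x') + c a (z *: v + v') =
      z *: (rep_act V' a x + c a v) + (rep_act V' a x' + c a v').
    by rewrite !linearP /= scalerDr addrACA.
  have e2 : rep_act V a (z *: v + v') = z *: rep_act V a v + rep_act V a v'.
    by rewrite linearP.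
  by congr (_, _); [apply: e1 | apply: e2].
have linl u : linear ((pair_rep_act c)^~ u).
  case: u => x v z a b.
  have e1 : rep_act V' (z *: a + b) x + c (z *: a + b) v =
      z *: (rep_act V' a x + c a v) + (rep_act V' b x + c b v).
    rewrite rep_actDl rep_actZl c_lin add_lfunE scale_lfunE.
    by rewrite scalerDr addrACA.
  have e2 : rep_act V (z *: a + b) v = z *: rep_act V a v + rep_act V b v.
    by rewrite rep_actDl rep_actZl.
  by congr (_, _); [apply: e1 | apply: e2].
have plie a b u : pair_rep_act c (lie a b) u =
    pair_rep_act c a (pair_rep_act c b u) - pair_rep_act c b (pair_rep_act c a u).
  case: u => x v.
  have e1 : rep_act V' (lie a b) x + c (lie a b) v =
      rep_act V' a (rep_act V' b x + c b v) + c a (rep_act V b v)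
      - (rep_act V' b (rep_act V' a x + c a v) + c b (rep_act V a v)).
    rewrite rep_lie c_lie [rep_act V' a (_ + _)]linearD.
    rewrite [rep_act V' b (_ + _)]linearD /=.
    have aux (Z : zmodType) (p q r s t u : Z) :
        p - q + (r + s - (t + u)) = p + r + s - (q + t + u).
      by rewrite !opprD !addrA [LHS](ACl (1*3*4*2*5*6)).
    exact: aux.
  by congr (_, _); [apply: e1 | apply: rep_lie].
pose U := mk_rep linr linl plie.
have [i iE] := @mk_lfun V' (V' * V)%type (fun x => (x, 0))
  ltac:(by move=> z x y; congr (_, _); rewrite /= scaler0 addr0).
have [p pE] := @mk_lfun (V' * V)%type V (fun u => u.2) ltac:(by []).
have [s sE] := @mk_lfun V (V' * V)%type (fun v => (0, v))
  ltac:(by move=> z x y; congr (_, _); rewrite /= scaler0 addr0).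
have i_hom : @is_rep_hom k L V' U i.
  move=> a x; rewrite !iE mk_repE /pair_rep_act /=.
  by congr (_, _); rewrite /= !linear0 ?addr0.
have p_hom : @is_rep_hom k L U V p.
  by move=> a x; rewrite !pE mk_repE.
have i_inj : injective (i : V' -> U) by move=> x y; rewrite !iE => -[].
have p_surj v : exists u : U, p u = v by exists (0, v); rewrite pE.
have ip (u : U) : p u = 0 <-> exists x, i x = u.
  rewrite pE; split=> [u0|[x <-]]; last by rewrite iE.
  by exists u.1; rewrite iE -u0; case: (u).
exists (Extension i_hom p_hom i_inj p_surj ip), s; split=> [v|a v].
  by rewrite /= pE sE.
rewrite -[LHS]/(rep_act U a (s v)) -[RHS]/(s (rep_act V a v) + i (c a v)).
rewrite !sE iE mk_repE.
have e1 : rep_act V' a 0 + c a v = 0 + c a v by rewrite linear0.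
have e2 : rep_act V a v = rep_act V a v + 0 by rewrite addr0.
by congr (_, _); [apply: e1 | apply: e2].
Qed.

Lemma ext_decomp (E : extension) (s : 'Hom(V, E)) (u : E) :
  (forall v, ext_out E (s v) = v) ->
  exists x, u = s (ext_out E u) + ext_in E x.
Proof.
move=> sK; have [|x xE] := (ext_exact (u - s (ext_out E u))).1.
  by rewrite linearB /= sK subrr.
by exists x; rewrite xE addrCA subrr addr0.
Qed.

Lemma ext_splitting (E : extension) (s : 'Hom(V, E)) :
  (forall v, ext_out E (s v) = v) ->
  exists2 q : 'Hom(E, V'),
    forall v, q (s v) = 0 & forall x, q (ext_in E x) = x.
Proof.
move=> sK; have [r rK] := lfun_retract (@ext_in_inj E).
exists (r \o (\1 - (s \o ext_out E)))%VF => [v|x].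
  by rewrite !(comp_lfunE, add_lfunE, opp_lfunE, id_lfunE) sK subrr linear0.
rewrite !(comp_lfunE, add_lfunE, opp_lfunE, id_lfunE).
have -> : ext_out E (ext_in E x) = 0 by apply/ext_exact; exists x.
by rewrite linear0 subr0 rK.
Qed.

Lemma ext_out_in (E : extension) x : ext_out E (ext_in E x) = 0.
Proof. by apply/ext_exact; exists x. Qed.

Lemma cocycle_scale z E E' c :
  has_cocycle E c -> has_cocycle E' (fun a => z *: c a) -> is_ext_scale z E E'.
Proof.
move=> [s [sK sa]] [s' [sK' sa']]; have [q qs qi] := ext_splitting sK.
exists ((s' \o ext_out E) + (z *: (ext_in E' \o q)))%VF.
pose f := ((s' \o ext_out E) + (z *: (ext_in E' \o q)))%VF.
have fs v : f (s v) = s' v.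
  rewrite !(comp_lfunE, add_lfunE, scale_lfunE) sK qs.
  by rewrite linear0 scaler0 addr0.
have fi x : f (ext_in E x) = ext_in E' (z *: x).
  rewrite !(comp_lfunE, add_lfunE, scale_lfunE) qi ext_out_in.
  by rewrite linear0 add0r linearZ.
rewrite -/f; split=> // [a u|u]; have [x ->] := ext_decomp u sK.
  set v := ext_out E u.
  have fsi w y : f (s w + ext_in E y) = s' w + ext_in E' (z *: y).
    by rewrite linearD /= fs fi.
  rewrite fsi [rep_act E a (_ + _)]linearD [rep_act E' a (_ + _)]linearD /=.
  rewrite sa sa' -!ext_in_hom -!addrA -!linearD fsi /=.
  by rewrite scale_lfunE scalerDr [rep_act V' a (z *: x)]linearZ.
by rewrite !linearD /= fs fi !ext_out_in sK sK'.
Qed.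

Lemma scale_cocycle z E E' c :
  has_cocycle E c -> is_ext_scale z E E' -> has_cocycle E' (fun a => z *: c a).
Proof.
move=> [s [sK sa]] [f [fh fi fp]]; exists (f \o s)%VF; split=> [v|a v].
  by rewrite comp_lfunE fp sK.
by rewrite !comp_lfunE -fh sa linearD /= fi scale_lfunE.
Qed.

Lemma ext_scale1 E E' : is_ext_scale 1 E E' <-> ext_equiv E E'.
Proof. by split=> -[f [fh fi fp]]; exists f; split=> // x; rewrite fi scale1r. Qed.

Lemma cocycle_equiv E E' c : has_cocycle E c ->
  (has_cocycle E' c <-> ext_equiv E E').
Proof.
have c1 : (fun a => 1 *: c a) = c by apply/funext => a; rewrite scale1r.
move=> hE; split=> [hE'|/ext_scale1/(scale_cocycle hE)]; last by rewrite c1.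
by apply/ext_scale1; apply: (cocycle_scale hE); rewrite c1.
Qed.

Lemma cocycle_baer E1 E2 E c1 c2 : has_cocycle E1 c1 -> has_cocycle E2 c2 ->
  (has_cocycle E (fun a => c1 a + c2 a) <-> is_baer_sum E1 E2 E).
Proof.
move=> [s1 [sK1 sa1]] [s2 [sK2 sa2]]; split.
  move=> [s [sK sa]].
  have [q1 qs1 qi1] := ext_splitting sK1; have [q2 qs2 qi2] := ext_splitting sK2.
  have [f fE] := @mk_lfun (E1 * E2)%type E
    (fun u => s (ext_out E1 u.1) + ext_in E (q1 u.1 + q2 u.2))
    ltac:(move=> z u v; rewrite /= [ext_out E1 _]linearP [s _]linearP;
      rewrite [q1 _]linearP [q2 _]linearP addrACA -scalerDr [ext_in E _]linearP;
      by rewrite scalerDr addrACA).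
  have fsi v x1 x2 : f (s1 v + ext_in E1 x1, s2 v + ext_in E2 x2) =
      s v + ext_in E (x1 + x2).
    rewrite fE /= [ext_out _ (_ + _)]linearD [q1 (_ + _)]linearD.
    by rewrite [q2 (_ + _)]linearD /= sK1 ext_out_in addr0 qs1 qi1 qs2 qi2 !add0r.
  exists f; split=> [a u1 u2|x y|u1 u2].
  - have [x1 e1] := ext_decomp u1 sK1; have [x2 e2] := ext_decomp u2 sK2.
    move=> pE; rewrite -pE in e2; rewrite e1 e2; set v := ext_out E1 u1.
    rewrite fsi ![rep_act _ a (_ + _)]linearD /= sa1 sa2 sa -!ext_in_hom.
    rewrite -!addrA -!linearD fsi add_lfunE; congr (_ + ext_in E _).
    by rewrite linearD addrACA.
  - by have := fsi 0 x y; rewrite !linear0 !add0r.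
  have [x1 e1] := ext_decomp u1 sK1; have [x2 e2] := ext_decomp u2 sK2.
  move=> pE; rewrite -pE in e2; rewrite {1}e1 e2 fsi.
  by rewrite linearD /= sK ext_out_in addr0.
move=> [f [fa fi fp]].
have [s sE] := @mk_lfun V E (fun v => f (s1 v, s2 v))
  ltac:(by move=> z u v; rewrite !linearP -[RHS]linearP).
have fD u1 u2 v1 v2 : f (u1 + v1, u2 + v2) = f (u1, u2) + f (v1, v2).
  by rewrite -linearD.
exists s; split=> [v|a v]; first by rewrite sE fp ?sK1 ?sK2.
by rewrite !sE -fa ?sK1 ?sK2 // sa1 sa2 fD fi add_lfunE.
Qed.

Lemma is_cocycleD c1 c2 : is_cocycle c1 -> is_cocycle c2 ->
  is_cocycle (fun a => c1 a + c2 a).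
Proof.
move=> [l1 h1] [l2 h2]; split=> [z a b|a b v].
  by rewrite l1 l2 scalerDr addrACA.
rewrite !add_lfunE h1 h2.
rewrite [rep_act V' a (_ + _)]linearD [rep_act V' b (_ + _)]linearD /=.
have aux (Z : zmodType) (p q r s p' q' r' s' : Z) :
    p + q - (r + s) + (p' + q' - (r' + s')) =
    p + p' + (q + q') - (r + r' + (s + s')).
  by rewrite !opprD !addrA [LHS](ACl (1*5*2*6*3*7*4*8)).
exact: aux.
Qed.

Lemma is_cocycleZ z c : is_cocycle c -> is_cocycle (fun a => z *: c a).
Proof.
move=> [l h]; split=> [y a b|a b v].
  by rewrite l scalerDr !scalerA mulrC.
rewrite !scale_lfunE h scalerBr !scalerDr.
by rewrite [rep_act V' a (_ *: _)]linearZ [rep_act V' b (_ *: _)]linearZ.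
Qed.

Lemma is_cocycle0 : is_cocycle (fun=> 0).
Proof.
split=> [z a b|a b v]; first by rewrite scaler0 addr0.
by rewrite !zero_lfunE !linear0 addr0 subrr.
Qed.

Lemma baer_sum_exists E1 E2 : exists E, is_baer_sum E1 E2 E.
Proof.
have [c1 k1 h1] := has_cocycleP E1; have [c2 k2 h2] := has_cocycleP E2.
have [E hE] := has_cocycle_exists (is_cocycleD k1 k2).
by exists E; apply/(cocycle_baer _ h1 h2).
Qed.

Lemma ext_scale_exists z E : exists E', is_ext_scale z E E'.
Proof.
have [c kc h] := has_cocycleP E.
have [E' hE'] := has_cocycle_exists (is_cocycleZ z kc).
by exists E'; apply: cocycle_scale h hE'.
Qed.

Definition is_split (E : extension) :=
  exists s : 'Hom(V, E), is_rep_hom s /\ forall v, ext_out E (s v) = v.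

Lemma is_splitP E : is_split E <-> has_cocycle E (fun=> 0).
Proof.
split=> -[s [h1 h2]]; exists s; split=> // a v.
  by rewrite zero_lfunE linear0 addr0 h1.
by rewrite h2 zero_lfunE linear0 addr0.
Qed.

Lemma split_exists : exists E, is_split E.
Proof.
by have [E hE] := has_cocycle_exists is_cocycle0; exists E; apply/is_splitP.
Qed.

Lemma ext_equiv_refl E : ext_equiv E E.
Proof. by have [c _ h] := has_cocycleP E; apply/(cocycle_equiv _ h). Qed.

Lemma ext_equiv_sym E E' : ext_equiv E E' -> ext_equiv E' E.
Proof.
have [c _ h] := has_cocycleP E => /(cocycle_equiv _ h) h'.
exact/(cocycle_equiv _ h').
Qed.

Lemma ext_equiv_trans E1 E2 E3 :
  ext_equiv E1 E2 -> ext_equiv E2 E3 -> ext_equiv E1 E3.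
Proof.
have [c _ h] := has_cocycleP E1 => /(cocycle_equiv _ h) h' /(cocycle_equiv _ h').
by move=> /(cocycle_equiv _ h).
Qed.

(* Ext^1: equivalence classes of extensions, with the Baer sum. To form the    *)
(* quotient inside one universe, classes are represented by extensions whose   *)
(* middle term is a coordinate space k^d; ext1_class sends an arbitrary        *)
(* extension to its class (ext1_classP), and every class arises (ext1_classK). *)

Record coord_extension := CoordExtension {
  ce_dim : nat;
  ce_act : L -> 'rV[k]_ce_dim -> 'rV[k]_ce_dim;
  ce_linr : forall a, linear (ce_act a);
  ce_linl : forall v, linear (ce_act^~ v);
  ce_lie : forall a b v,
    ce_act (lie a b) v = ce_act a (ce_act b v) - ce_act b (ce_act a v);
  ce_in : 'Hom(V', 'rV[k]_ce_dim);
  ce_out : 'Hom('rV[k]_ce_dim, V);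
  ce_in_hom : @is_rep_hom k L V' (mk_rep ce_linr ce_linl ce_lie) ce_in;
  ce_out_hom : @is_rep_hom k L (mk_rep ce_linr ce_linl ce_lie) V ce_out;
  ce_in_inj : injective ce_in;
  ce_out_surj : forall v, exists u, ce_out u = v;
  ce_exact : forall u, ce_out u = 0 <-> exists x, ce_in x = u
}.

Coercion coord_ext (C : coord_extension) : extension :=
  Extension (@ce_in_hom C) (@ce_out_hom C) (@ce_in_inj C) (@ce_out_surj C)
    (@ce_exact C).

Lemma coord_ext_exists (E : extension) : exists C : coord_extension, ext_equiv C E.
Proof.
pose act a (w : 'rV[k]_(dim E)) : 'rV[k]_(dim E) := v2r (rep_act E a (r2v w)).
have linr a : linear (act a).
  by move=> z u v; rewrite /act !(linearD, linearZ).
have linl w : linear (act^~ w).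
  by move=> z a b; rewrite /act rep_actDl rep_actZl !(linearD, linearZ).
have alie a b w : act (lie a b) w = act a (act b w) - act b (act a w).
  by rewrite /act !v2rK rep_lie linearB.
have [f fE] := @mk_lfun E 'rV[k]_(dim E) v2r
  ltac:(by move=> z u v; rewrite linearD linearZ).
have [h hE] := @mk_lfun 'rV[k]_(dim E) E r2v
  ltac:(by move=> z u v; rewrite linearD linearZ).
pose U := mk_rep linr linl alie.
pose i : 'Hom(V', 'rV[k]_(dim E)) := (f \o ext_in E)%VF.
pose p : 'Hom('rV[k]_(dim E), V) := (ext_out E \o h)%VF.
have iE x : i x = v2r (ext_in E x) by rewrite comp_lfunE fE.
have pE w : p w = ext_out E (r2v w) by rewrite comp_lfunE hE.
have i_hom : @is_rep_hom k L V' U i.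
  by move=> a x; rewrite !iE mk_repE /act v2rK ext_in_hom.
have p_hom : @is_rep_hom k L U V p.
  by move=> a w; rewrite !pE mk_repE /act v2rK ext_out_hom.
have i_inj : injective i.
  by move=> x y; rewrite !iE => /v2r_inj/ext_in_inj.
have p_surj v : exists w, p w = v.
  by have [u <-] := @ext_out_surj E v; exists (v2r u); rewrite pE v2rK.
have ip w : p w = 0 <-> exists x, i x = w.
  rewrite pE ext_exact; split=> -[x xE]; exists x; first by rewrite iE xE r2vK.
  by rewrite -xE iE v2rK.
exists (CoordExtension i_hom p_hom i_inj p_surj ip).
apply: ext_equiv_sym; exists f; split=> [a u|x|u].
- have e : f (rep_act E a u) = rep_act U a (f u).
    by rewrite !fE mk_repE /act v2rK.
  exact: e.
- by rewrite -[RHS]/(i x) iE; apply: fE.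
by rewrite -[LHS]/(p (f u)) pE fE v2rK.
Qed.

HB.instance Definition _ := gen_eqMixin coord_extension.
HB.instance Definition _ := gen_choiceMixin coord_extension.

Definition coord_ext_equiv : rel coord_extension :=
  fun C C' => `[< ext_equiv C C' >].

Fact coord_ext_equiv_refl : reflexive coord_ext_equiv.
Proof. by move=> E; apply/asboolP; apply: ext_equiv_refl. Qed.
Fact coord_ext_equiv_sym : symmetric coord_ext_equiv.
Proof. by move=> E E'; apply/asboolP/asboolP; apply: ext_equiv_sym. Qed.
Fact coord_ext_equiv_trans : transitive coord_ext_equiv.
Proof.
by move=> E2 E1 E3 /asboolP h /asboolP h'; apply/asboolP/(ext_equiv_trans h h').
Qed.

Canonical coord_ext_equiv_rel := EquivRel coord_ext_equiv
  coord_ext_equiv_refl coord_ext_equiv_sym coord_ext_equiv_trans.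

Definition Ext1 := {eq_quot coord_ext_equiv}%qT.

HB.instance Definition _ := Choice.on Ext1.

Definition ext1_class (E : extension) : Ext1 :=
  (\pi_Ext1 (sval (cid (coord_ext_exists E))))%qT.

Lemma ext1_classP E E' : ext1_class E = ext1_class E' <-> ext_equiv E E'.
Proof.
rewrite /ext1_class; case: cid => C /= hC; case: cid => C' /= hC'.
split=> [/eqP|h].
  rewrite eqmodE /= => /asboolP h.
  exact: ext_equiv_trans (ext_equiv_sym hC) (ext_equiv_trans h hC').
apply/eqP; rewrite eqmodE; apply/asboolP.
exact: ext_equiv_trans hC (ext_equiv_trans h (ext_equiv_sym hC')).
Qed.

Lemma ext1_classK (e : Ext1) : ext1_class (repr e) = e.
Proof.
rewrite -[RHS]reprK /ext1_class; case: cid => C /= hC.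
by apply/eqP; rewrite eqmodE; apply/asboolP.
Qed.

Definition ext1_add (e1 e2 : Ext1) : Ext1 :=
  ext1_class (sval (cid (baer_sum_exists (repr e1) (repr e2)))).

Definition ext1_scale (z : k) (e : Ext1) : Ext1 :=
  ext1_class (sval (cid (ext_scale_exists z (repr e)))).

Definition ext1_zero : Ext1 := ext1_class (sval (cid split_exists)).

Definition ext1_cocycle (e : Ext1) c := has_cocycle (repr e) c.

Lemma ext1_class_cocycle E c : ext1_cocycle (ext1_class E) c <-> has_cocycle E c.
Proof.
have eqv : ext_equiv (repr (ext1_class E)) E by apply/ext1_classP/ext1_classK.
split=> h; first exact/(cocycle_equiv _ h).
exact/(cocycle_equiv _ h)/ext_equiv_sym.
Qed.

Lemma ext1_cocycleP e : exists2 c, is_cocycle c & ext1_cocycle e c.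
Proof. exact: has_cocycleP. Qed.

Lemma ext1_cocycle_eq e e' c : ext1_cocycle e c -> ext1_cocycle e' c -> e = e'.
Proof.
move=> h h'; rewrite -[e]ext1_classK -[e']ext1_classK.
by apply/ext1_classP/(cocycle_equiv _ h).
Qed.

Lemma ext1_cocycleD e1 e2 c1 c2 : ext1_cocycle e1 c1 -> ext1_cocycle e2 c2 ->
  ext1_cocycle (ext1_add e1 e2) (fun a => c1 a + c2 a).
Proof.
move=> h1 h2; rewrite /ext1_add; case: cid => E /= hE.
by apply/ext1_class_cocycle/(cocycle_baer _ h1 h2).
Qed.

Lemma ext1_cocycleZ z e c : ext1_cocycle e c ->
  ext1_cocycle (ext1_scale z e) (fun a => z *: c a).
Proof.
move=> h; rewrite /ext1_scale; case: cid => E /= hE.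
by apply/ext1_class_cocycle/(scale_cocycle h).
Qed.

Lemma ext1_cocycle0 : ext1_cocycle ext1_zero (fun=> 0).
Proof.
by rewrite /ext1_zero; case: cid => E /= hE; apply/ext1_class_cocycle/is_splitP.
Qed.

Let eq_coc e c c' : ext1_cocycle e c -> (forall a, c a = c' a) ->
  ext1_cocycle e c'.
Proof. by move=> h /funext <-. Qed.

Fact ext1_addA : associative ext1_add.
Proof.
move=> e1 e2 e3; have [c1 _ h1] := ext1_cocycleP e1.
have [c2 _ h2] := ext1_cocycleP e2; have [c3 _ h3] := ext1_cocycleP e3.
apply: (ext1_cocycle_eq (ext1_cocycleD h1 (ext1_cocycleD h2 h3))).
apply: (eq_coc (ext1_cocycleD (ext1_cocycleD h1 h2) h3)) => a.
by rewrite addrA.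
Qed.

Fact ext1_addC : commutative ext1_add.
Proof.
move=> e1 e2; have [c1 _ h1] := ext1_cocycleP e1.
have [c2 _ h2] := ext1_cocycleP e2.
apply: (ext1_cocycle_eq (ext1_cocycleD h1 h2)).
by apply: (eq_coc (ext1_cocycleD h2 h1)) => a; rewrite addrC.
Qed.

Fact ext1_add0 : left_id ext1_zero ext1_add.
Proof.
move=> e; have [c _ h] := ext1_cocycleP e; apply: (ext1_cocycle_eq _ h).
by apply: (eq_coc (ext1_cocycleD ext1_cocycle0 h)) => a; rewrite add0r.
Qed.

Fact ext1_addN : left_inverse ext1_zero (ext1_scale (-1)) ext1_add.
Proof.
move=> e; have [c _ h] := ext1_cocycleP e.
apply: (ext1_cocycle_eq _ ext1_cocycle0).
apply: (eq_coc (ext1_cocycleD (ext1_cocycleZ (-1) h) h)) => a.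
by rewrite scaleN1r addNr.
Qed.

HB.instance Definition _ :=
  GRing.isZmodule.Build Ext1 ext1_addA ext1_addC ext1_add0 ext1_addN.

Fact ext1_scaleA a b e : ext1_scale a (ext1_scale b e) = ext1_scale (a * b) e.
Proof.
have [c _ h] := ext1_cocycleP e.
apply: (ext1_cocycle_eq (ext1_cocycleZ a (ext1_cocycleZ b h))).
by apply: (eq_coc (ext1_cocycleZ (a * b) h)) => x; rewrite scalerA.
Qed.

Fact ext1_scale1 : left_id 1 ext1_scale.
Proof.
move=> e; have [c _ h] := ext1_cocycleP e; apply: (ext1_cocycle_eq _ h).
by apply: (eq_coc (ext1_cocycleZ 1 h)) => a; rewrite scale1r.
Qed.

Fact ext1_scaleDr : right_distributive ext1_scale +%R.
Proof.
move=> z e1 e2; have [c1 _ h1] := ext1_cocycleP e1.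
have [c2 _ h2] := ext1_cocycleP e2.
apply: (ext1_cocycle_eq (ext1_cocycleZ z (ext1_cocycleD h1 h2))).
apply: (eq_coc (ext1_cocycleD (ext1_cocycleZ z h1) (ext1_cocycleZ z h2))) => a.
by rewrite scalerDr.
Qed.

Fact ext1_scaleDl e : {morph ext1_scale^~ e : a b / a + b}.
Proof.
move=> y z; have [c _ h] := ext1_cocycleP e.
apply: (ext1_cocycle_eq (ext1_cocycleZ (y + z) h)).
apply: (eq_coc (ext1_cocycleD (ext1_cocycleZ y h) (ext1_cocycleZ z h))) => a.
by rewrite scalerDl.
Qed.

HB.instance Definition _ := GRing.Zmodule_isLmodule.Build k Ext1
  ext1_scaleA ext1_scale1 ext1_scaleDr ext1_scaleDl.

Lemma ext1_addP E1 E2 E :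
  ext1_class E1 + ext1_class E2 = ext1_class E <-> is_baer_sum E1 E2 E.
Proof.
have [c1 _ h1] := has_cocycleP E1; have [c2 _ h2] := has_cocycleP E2.
rewrite -(cocycle_baer _ h1 h2).
move: h1 h2 => /ext1_class_cocycle h1 /ext1_class_cocycle h2.
have h := ext1_cocycleD h1 h2.
split=> [e|/ext1_class_cocycle h']; last exact: ext1_cocycle_eq h h'.
by apply/ext1_class_cocycle; rewrite -e.
Qed.

Lemma ext1_scaleP z E E' :
  z *: ext1_class E = ext1_class E' <-> is_ext_scale z E E'.
Proof.
have [c _ hE] := has_cocycleP E.
have h : ext1_cocycle (ext1_class E) c by apply/ext1_class_cocycle.
move: (ext1_cocycleZ z h) => hz; split=> [e|hs].
  by apply: (cocycle_scale hE); apply/ext1_class_cocycle; rewrite -e.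
by apply: (ext1_cocycle_eq hz); apply/ext1_class_cocycle/(scale_cocycle hE).
Qed.

Lemma ext1_class0 E : ext1_class E = 0 <-> is_split E.
Proof.
rewrite is_splitP -ext1_class_cocycle; split=> [->|h]; first exact: ext1_cocycle0.
exact: ext1_cocycle_eq h ext1_cocycle0.
Qed.

End Extensions.

Definition lin_iso (k : fieldType) (A B : lmodType k) :=
  exists f : {linear A -> B}, bijective f.

Definition big_tens_rep (k : fieldType) (L : lieAlgType k) (I : Type)
    (s : seq I) (W : I -> fdrep L) : fdrep L :=
  foldr (fun i T => tens_rep (W i) T) (triv_rep L) s.

Definition big_dsum (k : fieldType) (I : Type) (s : seq I)
    (W : I -> vectType k) : vectType k :=
  foldr (fun i (T : vectType k) => (W i * T)%type : vectType k) 'rV[k]_0 s.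

Section Torus.
Variables (k : fieldType) (n : nat).

(* The rational points of X = (k^* )^n. *)
Record torus := Torus {
  torus_coord :> {ffun 'I_n -> k};
  torus_coordP : [forall i, torus_coord i != 0]
}.

HB.instance Definition _ := [isSub for torus_coord].
HB.instance Definition _ := [Choice of torus by <:].

(* Regular maps from X to W: the Laurent polynomials with coefficients in W.   *)
Definition regular_map (W : lmodType k) (f : torus -> W) :=
  exists s : seq ({ffun 'I_n -> int} * W), forall z : torus,
    f z = \sum_(p <- s) (\prod_(i < n) z i ^ p.1 i) *: p.2.

End Torus.

Section Multiloop.
Variables (k : fieldType) (n : nat) (m : 'I_n -> nat).

(* The group Z/m_1 x ... x Z/m_n; e stands for the product of the gamma_i^(e i). *)
Definition Gamma := {dffun forall i : 'I_n, 'I_(m i)}.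

Section Actions.
Variables (g : fdLieAlgType k) (sigma : 'I_n -> lie_aut g) (xi : torus k n).

Definition gamma_alg (e : Gamma) : g -> g :=
  \big[(fun f h : g -> g => f \o h)/id]_(i < n) iter (e i) (sigma i).

Fact gamma_torus_subproof (e : Gamma) (z : torus k n) :
  [forall i, [ffun i => xi i ^+ e i * z i] i != 0].
Proof.
apply/forallP => i; rewrite ffunE mulf_neq0 ?expf_neq0 //.
  exact: (forallP (torus_coordP xi)).
exact: (forallP (torus_coordP z)).
Qed.

Definition gamma_torus (e : Gamma) (z : torus k n) : torus k n :=
  Torus (gamma_torus_subproof e z).

Definition equivariant (f : torus k n -> g) :=
  forall (e : Gamma) (z : torus k n), f (gamma_torus e z) = gamma_alg e (f z).

Definition multiloop_pred : {pred torus k n -> g} :=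
  fun f => `[< regular_map f /\ equivariant f >].

Record multiloop := Multiloop {
  multiloop_fun :> torus k n -> g;
  multiloopP : multiloop_fun \in multiloop_pred
}.

HB.instance Definition _ := [isSub for multiloop_fun].
HB.instance Definition _ := [Choice of multiloop by <:].

Lemma gamma_alg_linear e : linear (gamma_alg e).
Proof.
rewrite /gamma_alg; apply: big_ind => // [f h fl hl a u v|i _].
  by rewrite /= hl fl.
elim: (nat_of_ord (e i)) => [|j IH] a u v //=.
by rewrite -linearP; congr (sigma i _); apply: IH.
Qed.

Lemma gamma_alg_lie e x y :
  gamma_alg e (lie x y) = lie (gamma_alg e x) (gamma_alg e y).
Proof.
rewrite /gamma_alg; elim/big_ind: _ x y => // [f h fl hl x y|i _ x y].
  by rewrite /= hl fl.
by elim: (nat_of_ord (e i)) => //= j ->; rewrite lie_aut_lie.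
Qed.

Fact multiloop_submod_closed : submod_closed multiloop_pred.
Proof.
split=> [|a f h].
  apply/asboolP; split; first by exists [::] => z; rewrite big_nil.
  move=> e z /=.
  have := gamma_alg_linear e (-1) 0 0.
  by rewrite !scaleN1r oppr0 addr0 addNr => ->.
move=> /asboolP[[s sE] fe] /asboolP[[t tE] he]; apply/asboolP; split.
  exists ([seq (p.1, a *: p.2) | p <- s] ++ t) => z.
  rewrite big_cat big_map /= -tE; congr (_ + _).
  rewrite -[LHS]/(a *: f z) sE scaler_sumr; apply: eq_bigr => p _ /=.
  by rewrite !scalerA mulrC.
move=> e z; rewrite -[LHS]/(a *: f (gamma_torus e z) + h (gamma_torus e z)).
by rewrite fe he -gamma_alg_linear.
Qed.

HB.instance Definition _ := GRing.isSubmodClosed.Build k (torus k n -> g)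
  multiloop_pred multiloop_submod_closed.
HB.instance Definition _ := [SubChoice_isSubLmodule of multiloop by <:].

Fact multiloop_lie_subproof (f h : multiloop) :
  (fun z => lie (f z) (h z)) \in multiloop_pred.
Proof.
have /asboolP[[s sE] fe] := multiloopP f.
have /asboolP[[t tE] he] := multiloopP h.
apply/asboolP; split=> [|e z]; last by rewrite fe he gamma_alg_lie.
pose mul (p q : {ffun 'I_n -> int} * g) : {ffun 'I_n -> int} * g :=
  ([ffun i => p.1 i + q.1 i], lie p.2 q.2).
exists [seq mul p q | p <- s, q <- t] => z.
have lie_suml (I : Type) (r : seq I) (F : I -> g) y :
    lie (\sum_(i <- r) F i) y = \sum_(i <- r) lie (F i) y.
  by elim/big_rec2: _ => [|i x x' _ <-]; rewrite ?lie0l ?lieDl.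
rewrite sE tE lie_suml big_allpairs_dep; apply: eq_bigr => p _.
rewrite linear_sum; apply: eq_bigr => q _ /=.
rewrite linearZ /= lieZl scalerA; congr (_ *: _).
rewrite mulrC -big_split; apply: eq_bigr => i _ /=; rewrite ffunE.
by rewrite expfzDr // (forallP (torus_coordP z)).
Qed.

Definition multiloop_lie (f h : multiloop) : multiloop :=
  Multiloop (multiloop_lie_subproof f h).

Let mlP (f h : multiloop) : f =1 h -> f = h.
Proof. by move=> fh; apply/val_inj/funext. Qed.

Fact multiloop_lie_linearl h : linear (multiloop_lie^~ h).
Proof. by move=> a f f'; apply: mlP => z; apply: lie_linearl. Qed.
Fact multiloop_lie_linearr f : linear (multiloop_lie f).
Proof. by move=> a h h'; apply: mlP => z; apply: lie_linearr. Qed.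
Fact multiloop_lie_alt f : multiloop_lie f f = 0.
Proof. by apply: mlP => z; apply: lie_alt. Qed.
Fact multiloop_lie_jacobi f h l :
  multiloop_lie f (multiloop_lie h l) + multiloop_lie h (multiloop_lie l f)
  + multiloop_lie l (multiloop_lie f h) = 0.
Proof. by apply: mlP => z; apply: lie_jacobi. Qed.

HB.instance Definition _ := Lmodule_isLieAlgebra.Build k multiloop
  multiloop_lie_linearl multiloop_lie_linearr multiloop_lie_alt
  multiloop_lie_jacobi.

Section EvalRep.
Variables (x : torus k n) (U : fdrep g).

Definition ev_act (f : multiloop) (u : U) : U := rep_act U (f x) u.
Fact ev_linr f : linear (ev_act f).
Proof. by move=> a u v; rewrite /ev_act linearP. Qed.
Fact ev_linl u : linear (ev_act^~ u).
Proof.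
move=> a f h; rewrite /ev_act -rep_actZl -rep_actDl.
by congr (rep_act U _ u).
Qed.
Fact ev_lie f h u :
  ev_act (lie f h) u = ev_act f (ev_act h u) - ev_act h (ev_act f u).
Proof. exact: rep_lie. Qed.

(* The evaluation representation at x attached to the g-module U: the pullback *)
(* of U along ev_x : f |-> f x.                                                *)
Definition ev_rep : fdrep multiloop := mk_rep ev_linr ev_linl ev_lie.

End EvalRep.

(* X_*: distinct points lie in distinct Gamma-orbits. *)
Definition distinct_orbits (s : {fset torus k n}) :=
  forall x y, x \in s -> y \in s -> x != y ->
    forall e : Gamma, gamma_torus e x <> y.

End Actions.
End Multiloop.

(* Main.v *)
From HB Require Import structures.
Require Import Defs.
From mathcomp Require Import all_boot all_order all_algebra finmap.
From mathcomp Require Import boolp ring.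

Set Implicit Arguments.
Unset Strict Implicit.
Unset Printing Implicit Defensive.

Import Order.TTheory GRing.Theory Num.Theory VectorInternalTheory.
Local Open Scope ring_scope.

(** Extensions of V by V' are classified by the first cohomology of the multiloop
    algebra M with values in Hom(V, V'). Let s be the set of points carrying V and
    V', and K the ideal of the maps vanishing on s; it acts trivially on
    Hom(V, V'). So the restriction of a cocycle to K is an M-equivariant map
    killing [K, K], and the main point is that [K, K] contains every map
    vanishing to second order on s (second_order_killed). Indeed M is free over
    the invariant functions on the torus, with basis z^(d_j) b_j for a common
    eigenbasis b_j of the sigma_i. The coefficients of a map vanishing to second
    order on s lie in the square of the ideal of s: this is a Taylor expansion on
    the quotient of the torus by the group, at the images of the points of s
    (second_order_at, second_order_on). As g is perfect, the b_j are brackets, and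
    the two factors of a product of functions vanishing on s can be shared between
    the two entries of a bracket.

    A cocycle on K therefore only sees the n logarithmic derivatives of a map at
    each point x of s: it is the sum of the phi_(x,i)(D_i f (x)) for linear maps
    phi_(x,i) from g to Hom(V, V') that intertwine the adjoint action, through
    evaluation at x, with the action of M. Conversely, by the Leibniz rule, this
    formula defines a cocycle on all of M for any such phi_(x,i). What remains is
    a cocycle that vanishes on K, that is, a cocycle of M / K, a product of copies
    of g indexed by s; it is a coboundary by Whitehead's first lemma, applied to
    one copy at a time. Whitehead's lemma is proved from its classical
    ingredients: Engel's theorem, Cartan's criterion, the Casimir operator. The
    result is ext1_multiloop: Ext^1(V, V') is the direct sum over x in s of n
    copies of the space H_x of the intertwining maps.

    It remains to compute H_x. For y <> x, the copy of g at y acts trivially on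
    the source of phi in H_x, so phi takes its values in the maps from V to V'
    that are equivariant for all these copies. By Schur's lemma at each y, such
    maps are 0 if some W_y is not isomorphic to W'_y, and otherwise form a copy of
    Hom(W_x, W'_x); so H_x is 0 (point_hom_eq0), or has the dimension of
    Hom_g(g, W_x^dual (x) W'_x) (dim_point_hom). Two non-isomorphic points make all
    H_x vanish, one leaves its own only, none leaves them all. *)

(** * Linear algebra over an algebraically closed field *)

Section PolyCRT.
Variable F : fieldType.
Implicit Types (s : seq F) (p q : {poly F}).

Lemma coprimep_XsubC_exp s a M N : a \notin s ->
  coprimep (('X - a%:P) ^+ M) ((\prod_(b <- s) ('X - b%:P)) ^+ N).
Proof.
move=> as_; apply/coprimep_expl/coprimep_expr.
elim: s as_ => [|b s IH]; first by rewrite big_nil coprimep1.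
rewrite inE negb_or big_cons => /andP[ab as_].
by rewrite coprimepMr IH // andbT coprimep_XsubC2 // subr_eq0 eq_sym.
Qed.

Lemma dvdp_prod_XsubC s M p : uniq s ->
  (forall a, a \in s -> ('X - a%:P) ^+ M %| p) ->
  (\prod_(a <- s) ('X - a%:P)) ^+ M %| p.
Proof.
elim: s => [|a s IH] /=; first by rewrite big_nil expr1n dvd1p.
move=> /andP[as_ us] sp; rewrite big_cons exprMn Gauss_dvdp ?coprimep_XsubC_exp //.
rewrite sp ?mem_head //=; apply: IH => // b bs; apply: sp.
by rewrite inE bs orbT.
Qed.

Lemma poly_crt s M (c : F -> F) : uniq s ->
  exists q, forall a, a \in s -> ('X - a%:P) ^+ M %| q - (c a)%:P.
Proof.
elim: s => [|a s IH] /=; first by exists 0.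
move=> /andP[as_ /IH[q qP]].
have /Bezout_eq1_coprimepP[[u v] /= uv] := coprimep_XsubC_exp M M as_.
set P := _ ^+ M in uv; set Q := _ ^+ M in uv.
exists (q + ((c a)%:P - q) * (v * Q)) => b; rewrite inE => /orP[/eqP->|bs].
  have -> : q + ((c a)%:P - q) * (v * Q) - (c a)%:P = (q - (c a)%:P) * (u * P).
    by rewrite -[u * P](addrK (v * Q)) uv; ring.
  by rewrite mulrA dvdp_mulIr.
rewrite addrAC dvdp_add ?qP // mulrA dvdp_mull //.
by rewrite /Q dvdp_exp2r // (big_rem b) //= dvdp_mulIl.
Qed.

End PolyCRT.

Section Char0.
Variable k : fieldType.
Hypothesis k0 : [pchar k] =i pred0.

Lemma natr0 n : (n%:R == 0 :> k) = (n == 0)%N.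
Proof. exact: (iffLR (pcharf0P k) k0). Qed.

Lemma intr0 z : (z%:~R == 0 :> k) = (z == 0).
Proof.
by case: z => n; rewrite ?NegzE ?mulrNz ?oppr_eq0 -pmulrn natr0.
Qed.

End Char0.

Section Matrices.
Variable k : closedFieldType.

Lemma char_poly_split n (X : 'M[k]_n) :
  exists rs : seq k, char_poly X = \prod_(a <- rs) ('X - a%:P).
Proof.
have [rs rsE] := closed_field_poly_normal (char_poly X); exists rs.
by rewrite {1}rsE (monicP (char_poly_monic X)) scale1r.
Qed.

(** The multiplicity of an eigenvalue is at most the size of X, so such a p is a
    multiple of the characteristic polynomial. *)
Lemma spectral_annihilator n (X : 'M[k]_n.+1) : exists2 s : seq k, uniq s &
  forall p, (forall a, a \in s -> ('X - a%:P) ^+ n.+1 %| p) -> horner_mx X p = 0.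
Proof.
have [rs rsE] := char_poly_split X.
exists (undup rs) => [|p sp]; first exact: undup_uniq.
suff /dvdpP[q ->] : char_poly X %| p.
  by rewrite rmorphM /= Cayley_Hamilton mulr0.
apply: dvdp_trans (dvdp_prod_XsubC (undup_uniq rs) sp); rewrite rsE.
have -> : n.+1 = size rs.
  by apply: succn_inj; rewrite -(size_char_poly X) rsE size_prod_XsubC.
have {sp}: {subset rs <= undup rs} by move=> a; rewrite mem_undup.
move: (undup rs) => t; elim: rs {rsE} => [|a rs IH] rst.
  by rewrite big_nil dvd1p.
rewrite big_cons exprS dvdp_mul //; last by apply: IH => b bs; rewrite rst // inE bs orbT.
by rewrite (big_rem a) ?rst ?mem_head //= dvdp_mulIl.
Qed.

Lemma mxtrace_nilpotent n (X : 'M[k]_n.+1) m : X ^+ m = 0 -> \tr X = 0.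
Proof.
move=> X0; have [rs rsE] := char_poly_split X.
have rs0 a : a \in rs -> a = 0.
  move=> ars; have : root (char_poly X) a by rewrite rsE root_prod_XsubC.
  rewrite -eigenvalue_root_char => /eigenvalueP[v vX v0].
  have : v *m (X ^+ m) = a ^+ m *: v.
    elim: m {X0} => [|m IH]; first by rewrite expr0 mulmx1 scale1r.
    by rewrite exprSr mulmxA IH -scalemxAl vX scalerA exprSr.
  rewrite X0 mulmx0 => /esym/eqP; rewrite scaler_eq0 (negPf v0) orbF.
  by rewrite expf_eq0 => /andP[_ /eqP].
have sz : size rs = n.+1.
  by apply: succn_inj; rewrite -(size_char_poly X) rsE size_prod_XsubC.
have XE : char_poly X = 'X^(n.+1).
  rewrite rsE (eq_big_seq (fun=> 'X)) ?big_const_seq ?count_predT ?sz.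
    by elim: (n.+1) => [|i IH]; rewrite ?expr0 //= IH exprS.
  by move=> a /rs0 ->; rewrite subr0.
apply/eqP; rewrite -oppr_eq0 -[- _]char_poly_trace //.
by rewrite XE coefXn /= ltn_eqF.
Qed.

Lemma mxtrace_idempotent n (X : 'M[k]_n) : X *m X = X -> \tr X = (\rank X)%:R.
Proof.
move=> XX; have cr : row_base X *m col_base X = 1%:M.
  apply: (row_full_inj (col_base_full X)).
  apply: (row_free_inj (row_base_free X)).
  by rewrite mulmx1 mulmxA mulmx_base -mulmxA mulmx_base.
by rewrite -{1}(mulmx_base X) mxtrace_mulC cr mxtrace1.
Qed.

(** Coordinates of finitely many elements of k with respect to a family that is
    free over the integers, after multiplication by a common denominator D. In
    the proof of Cartan's criterion they stand for the linear functionals over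
    the rationals on the span of the eigenvalues. *)
Lemma integral_coordinates (s : seq k) :
  exists d (e : 'I_d -> k) (D : int) (A : k -> 'I_d -> int),
  [/\ D != 0,
      forall r : 'I_d -> int, \sum_j (r j)%:~R * e j = 0 -> forall j, r j = 0
    & forall a, a \in s -> D%:~R * a = \sum_j (A a j)%:~R * e j].
Proof.
elim: s => [|x s [d [e [D [A [D0 eI AE]]]]]].
  by exists 0, (fun=> 0), 1, (fun _ _ => 0); split=> // r _ [].
have [[c [r [c0 rE]]]|nrel] := pselect (exists c (r : 'I_d -> int), c != 0 /\
    c%:~R * x = \sum_j (r j)%:~R * e j).
  exists d, e, (D * c), (fun a j => if a == x then D * r j else c * A a j).
  split=> // [|a]; first by rewrite mulf_neq0.
  rewrite inE; have [-> _|ax /= /AE aE] := eqVneq a x.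
    rewrite intrM -mulrA rE mulr_sumr; apply: eq_bigr => j _.
    by rewrite intrM mulrA.
  rewrite intrM [D%:~R * _]mulrC -mulrA aE mulr_sumr; apply: eq_bigr => j _.
  by rewrite intrM mulrA.
exists d.+1, (fun i => if unlift ord0 i is Some j then e j else x), D.
exists (fun a i => if unlift ord0 i is Some j then (if a == x then 0 else A a j)
                   else if a == x then D else 0); split=> // [r|a].
  rewrite big_ord_recl unlift_none; under eq_bigr do rewrite liftK.
  move=> rE; have r0 : r ord0 = 0.
    apply/eqP/negPn/negP => r0; apply: nrel.
    exists (r ord0), (fun j => - r (lift ord0 j)); split=> //.
    apply/eqP; rewrite -subr_eq0 -sumrN -[X in _ == X]rE; apply/eqP.
    by congr (_ + _); apply: eq_bigr => j _; rewrite rmorphN /= mulNr opprK.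
  move: rE; rewrite r0 mul0r add0r => /eI rE i.
  by case: (unliftP ord0 i) => [j|] ->.
rewrite inE big_ord_recl unlift_none; under eq_bigr do rewrite liftK.
have [-> _|ax /= /AE ->] := eqVneq a x; last by rewrite mul0r add0r.
by rewrite [X in _ + X]big1 ?addr0 // => j _; rewrite mul0r.
Qed.

End Matrices.

Section PolyAction.
Variables (k : fieldType) (Z : lmodType k) (T : {linear Z -> Z}).
Implicit Types p q : {poly k}.

Definition poly_act p z := \sum_(i < size p) p`_i *: iter i T z.

Lemma poly_actE n p z : (size p <= n)%N ->
  poly_act p z = \sum_(i < n) p`_i *: iter i T z.
Proof.
move=> pn; rewrite /poly_act (big_ord_widen _ (fun i => p`_i *: iter i T z) pn).
rewrite big_mkcond; apply: eq_bigr => i _; case: ltnP => // h.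
by rewrite nth_default // scale0r.
Qed.

Lemma poly_actD p q z : poly_act (p + q) z = poly_act p z + poly_act q z.
Proof.
pose n := maxn (size p) (size q).
rewrite !(@poly_actE n) ?leq_maxl ?leq_maxr ?size_polyD // -big_split.
by apply: eq_bigr => i _; rewrite coefD scalerDl.
Qed.

Lemma poly_actCM c p z : poly_act (c%:P * p) z = c *: poly_act p z.
Proof.
rewrite mul_polyC (@poly_actE (size p)) ?size_scale_leq // scaler_sumr.
by apply: eq_bigr => i _; rewrite coefZ scalerA.
Qed.

Lemma poly_actXM p z : poly_act ('X * p) z = T (poly_act p z).
Proof.
rewrite mulrC (@poly_actE (size p).+1) ?(leq_trans (size_polyMleq _ _)) //; last first.
  by rewrite size_polyX addn2.
rewrite big_ord_recl coefMX eqxx scale0r add0r linear_sum; apply: eq_bigr => i _.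
by rewrite coefMX /= linearZ.
Qed.

Lemma poly_act0 z : poly_act 0 z = 0.
Proof. by rewrite /poly_act size_poly0 big_ord0. Qed.

Lemma poly_actC c z : poly_act c%:P z = c *: z.
Proof.
by rewrite (@poly_actE 1) ?size_polyC_leq1 // big_ord1 coefC.
Qed.

Lemma poly_actM p q z : poly_act (p * q) z = poly_act p (poly_act q z).
Proof.
elim/poly_ind: p => [|p c IH]; first by rewrite mul0r !poly_act0.
have -> : (p * 'X + c%:P) * q = 'X * (p * q) + c%:P * q by ring.
by rewrite [p * 'X]mulrC !poly_actD !poly_actXM IH poly_actCM poly_actC.
Qed.

Lemma poly_act_linear p : linear (poly_act p).
Proof.
move=> a u v; rewrite /poly_act scaler_sumr -big_split; apply: eq_bigr => i _ /=.
have -> : iter i T (a *: u + v) = a *: iter i T u + iter i T v.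
  by elim: (nat_of_ord i) => //= j ->; rewrite linearP.
by rewrite scalerDr !scalerA mulrC.
Qed.

HB.instance Definition _ p :=
  GRing.isLinear.Build k Z Z *:%R (poly_act p) (poly_act_linear p).

Lemma poly_act_mem (P : Z -> Prop) p z :
  (forall a u v, P u -> P v -> P (a *: u + v)) -> (forall u, P u -> P (T u)) ->
  P z -> P 0 -> P (poly_act p z).
Proof.
move=> Pl PT Pz P0; rewrite /poly_act; apply: (big_ind P) => // [u v Pu Pv|i _].
  by rewrite -[u]scale1r; apply: Pl.
rewrite -[_ *: _]addr0; apply: Pl => //.
by elim: (nat_of_ord i) => //= j; apply: PT.
Qed.

Lemma poly_act_XsubC_exp a m z :
  poly_act (('X - a%:P) ^+ m) z = iter m (fun u => T u - a *: u) z.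
Proof.
elim: m => [|m IH]; first by rewrite expr0 poly_actC scale1r.
rewrite exprS; move: (_ ^+ m) IH => p /= <-.
by rewrite mulrBl -mulNr poly_actD poly_actXM -polyCN poly_actCM scaleNr.
Qed.

End PolyAction.

(** The binomial theorem for the difference of two commuting operators, nilpotent
    at z. The operators of interest are the left and right multiplications by a
    matrix, whose difference is its adjoint action. *)
Lemma iter_sub_eq0 (Z : zmodType) (S T : {additive Z -> Z}) p q z :
  (forall u, S (T u) = T (S u)) -> iter p S z = 0 -> iter q T z = 0 ->
  iter (p + q) (fun u => S u - T u) z = 0.
Proof.
move=> ST; pose R u := S u - T u.
have R0 m : iter m R 0 = 0 by elim: m => //= m ->; rewrite /R !raddf0 addr0.
have RB m u v : iter m R (u - v) = iter m R u - iter m R v.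
  elim: m => //= m ->; rewrite /R (raddfB S) (raddfB T).
  by rewrite !opprB !addrA [LHS](ACl (1*4*3*2)).
have iterC (f h : Z -> Z) : (forall u, f (h u) = h (f u)) ->
    forall m u, iter m f (h u) = h (iter m f u).
  by move=> fh; elim=> //= m IH u; rewrite IH fh.
rewrite -/R; move mE : (p + q)%N => m.
elim: m p q z mE => [|m IH] [|p] [|q] z // mE Sz Tz.
- by rewrite (Sz : z = 0) R0.
- by rewrite (Tz : z = 0) R0.
have -> : iter m.+1 R z = iter m R (S z) - iter m R (T z) by rewrite iterSr -RB.
rewrite (IH p q.+1 (S z)); first rewrite (IH p.+1 q (T z)) ?subr0 //.
- by apply: succn_inj; rewrite -mE addnS.
- by rewrite iterC // Sz raddf0.
- by rewrite -iterSr.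
- by apply: succn_inj; rewrite -mE addSn.
- by rewrite -iterSr.
by rewrite iterC ?Tz ?raddf0.
Qed.

Definition lin_closed (k : fieldType) (Z : lmodType k) (P : Z -> Prop) :=
  P 0 /\ forall a u v, P u -> P v -> P (a *: u + v).

Section MatrixAdjoint.
Variables (k : fieldType) (n : nat).

Definition mxad (X b : 'M[k]_n) := X *m b - b *m X.

Fact mxad_linear X : linear (mxad X).
Proof.
move=> a u v; rewrite /mxad mulmxDr mulmxDl -scalemxAl -scalemxAr.
by rewrite scalerBr opprD addrACA.
Qed.
HB.instance Definition _ X :=
  GRing.isLinear.Build k 'M[k]_n 'M[k]_n *:%R (mxad X) (mxad_linear X).

End MatrixAdjoint.

Section Spectral.
Variable k : closedFieldType.
Hypothesis k0 : [pchar k] =i pred0.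
Variable n : nat.
Implicit Types X Y : 'M[k]_n.+1.

(** The projections onto the generalized eigenspaces are the e_a(X), for e_a
    congruent to 1 modulo a high power of 'X - a and to 0 modulo those of the
    other 'X - b. That they are polynomials in X makes them commute with every
    matrix that X commutes with. *)
Lemma spectral_projections X : exists (s : seq k) (e : k -> {poly k}),
  [/\ uniq s, \sum_(a <- s) horner_mx X (e a) = 1,
      forall a, a \in s -> (X - a%:M) ^+ n.+1 *m horner_mx X (e a) = 0
    & forall a, a \in s ->
        horner_mx X (e a) *m horner_mx X (e a) = horner_mx X (e a)].
Proof.
have [s us sX] := spectral_annihilator X.
have /choice[e eP] a := poly_crt n.+1 (fun b => (b == a)%:R : k) us.
exists s, e; split=> // [|a as_|a as_].
- apply/eqP; rewrite -subr_eq0 -rmorph_sum -(rmorph1 (horner_mx X)) -rmorphB /=.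
  apply/eqP/sX => b bs.
  have -> : 1 = \sum_(a <- s) ((b == a)%:R : k)%:P.
    rewrite (bigD1_seq b) //= eqxx big1 ?addr0 // => a.
    by rewrite eq_sym => /negPf ->.
  by rewrite -sumrB big_seq; apply: (big_ind (fun p => _ %| p)) => [|p q|a as_];
    [exact: dvdp0 | exact: dvdp_add | exact: eP].
- have -> : X - a%:M = horner_mx X ('X - a%:P).
    by rewrite rmorphB /= horner_mx_X horner_mx_C.
  rewrite -rmorphXn -[_ *m _]rmorphM; apply: sX => b bs.
  have [->|ba] := eqVneq b a; first exact: dvdp_mulIl.
  by apply: dvdp_mull; have := eP a b bs; rewrite (negPf ba) subr0.
apply/eqP; rewrite -subr_eq0 -[_ *m _]rmorphM -rmorphB; apply/eqP/sX => b bs /=.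
have -> : e a * e a - e a = e a * (e a - 1) by ring.
have := eP a b bs; case: eqP => _; first by move=> h; apply: dvdp_mull.
by rewrite subr0 => h; apply: dvdp_mulr.
Qed.

Lemma iter_mxad_eq0 X a b p q (c : 'M[k]_n.+1) :
  (X - a%:M) ^+ p *m c = 0 -> c *m (X - b%:M) ^+ q = 0 ->
  iter (p + q) (fun u => mxad X u - (a - b) *: u) c = 0.
Proof.
move=> pc cq; have -> : (fun u => mxad X u - (a - b) *: u) =
    (fun u => mulmx (X - a%:M) u - mulmxr (X - b%:M) u).
  apply/funext => u; rewrite /= mulmxBl mulmxBr mul_scalar_mx mul_mx_scalar scalerBl.
  by rewrite /mxad !opprB !addrA [LHS](ACl (1*4*3*2)).
apply: iter_sub_eq0 => [u /=||]; first by rewrite mulmxA.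
  rewrite -[RHS]pc; elim: p {pc} => [|p IH]; first by rewrite expr0 mul1mx.
  by rewrite /= IH exprS mulmxA.
rewrite -[RHS]cq; elim: q {cq} => [|q IH]; first by rewrite expr0 mulmx1.
by rewrite /= IH exprSr mulmxA.
Qed.

(** The linear algebra in Cartan's criterion. Let pi_a be the projections onto the
    generalized eigenspaces of X, f an integral coordinate of the eigenvalues, and
    Y = sum_a f(a) pi_a. As f is additive on differences of eigenvalues, ad Y is
    q(ad X) for any q congruent to f(a - b) modulo a high power of 'X - (a - b);
    as f(0) = 0, such a q has no constant term, so ad Y maps B into A. Hence
    0 = tr (X Y) = sum_a a rank(pi_a) f(a), and the f-coordinate of this relation
    is sum_a rank(pi_a) f(a)^2 = 0. So all coordinates of all eigenvalues vanish. *)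
Lemma nilpotent_of_trace_pos X (A B : 'M[k]_n.+1 -> Prop) :
  lin_closed A -> lin_closed B -> (forall b, A b -> B b) ->
  (forall b, B b -> A (mxad X b)) ->
  (forall Y, (forall b, B b -> A (mxad Y b)) -> \tr (X *m Y) = 0) ->
  X ^+ n.+1 = 0.
Proof.
move=> [A0 Al] Bl AB XBA trX.
have [s [e [us s1 sN sI]]] := spectral_projections X.
pose pi a := horner_mx X (e a); rewrite -/pi in s1 sN sI.
have XE a : X - a%:M = horner_mx X ('X - a%:P).
  by rewrite rmorphB /= horner_mx_X horner_mx_C.
have diffs a b : a \in s -> b \in s -> a - b \in [seq a - b | a <- s, b <- s].
  by move=> as_ bs; apply/allpairsP; exists (a, b).
have [d [u [D [c [D0 uI cE]]]]] :=
  integral_coordinates (0 :: s ++ [seq a - b | a <- s, b <- s]).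
have cs a : a \in s -> D%:~R * a = \sum_j (c a j)%:~R * u j.
  by move=> as_; apply: cE; rewrite inE mem_cat as_ orbT.
have c0 j : c 0 j = 0.
  by apply: uI; rewrite -cE ?mem_head // mulr0.
have cB a b j : a \in s -> b \in s -> c (a - b) j = c a j - c b j.
  move=> as_ bs; apply/eqP; rewrite -subr_eq0; apply/eqP.
  apply: (uI (fun j => c (a - b) j - (c a j - c b j))).
  under eq_bigr do rewrite !rmorphB /= mulrBl mulrBl.
  rewrite !sumrB -(cs a) // -(cs b) // -cE; first by ring.
  by rewrite inE mem_cat diffs ?orbT.
pose Y j := \sum_(a <- s) (c a j)%:~R *: pi a.
(* ad X acts on pi_a b pi_a' with the single generalized eigenvalue a - a'. *)
have YBA j b : B b -> A (mxad (Y j) b).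
  move=> Bb; pose ds := 0 :: [seq a - b | a <- s, b <- s].
  have [q qP] := poly_crt (n.+1 + n.+1) (fun a => (c a j)%:~R : k) (undup_uniq ds).
  have qpi a a' : a \in s -> a' \in s ->
      poly_act (mxad X) q (pi a *m b *m pi a') = (c (a - a') j)%:~R *: (pi a *m b *m pi a').
    move=> as_ as'.
    have /qP/dvdpP[r rE] : a - a' \in undup ds.
      by rewrite mem_undup inE diffs ?orbT.
    rewrite -[q](subrK (c (a - a') j)%:~R%:P) rE poly_actD poly_actM poly_actC.
    rewrite poly_act_XsubC_exp iter_mxad_eq0.
    - by rewrite linear0 add0r.
    - by rewrite !mulmxA sN ?mul0mx.
    rewrite -[LHS]mulmxA; have -> : pi a' *m (X - a'%:M) ^+ n.+1 = 0.
      rewrite -[RHS](sN a') // /pi !XE -!rmorphXn /=.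
      by rewrite -[LHS]rmorphM -[RHS]rmorphM mulrC.
    by rewrite mulmx0.
  have qb : poly_act (mxad X) q b = mxad (Y j) b.
    have be : b = \sum_(a <- s) \sum_(a' <- s) pi a *m b *m pi a'.
      under eq_bigr do rewrite -mulmx_sumr s1 mulmx1.
      by rewrite -mulmx_suml s1 mul1mx.
    rewrite {1}be linear_sum.
    transitivity (\sum_(a <- s) \sum_(a' <- s)
       ((c a j)%:~R *: (pi a *m b *m pi a') - (c a' j)%:~R *: (pi a *m b *m pi a'))).
      rewrite !big_seq; apply: eq_bigr => a as_ /=.
      rewrite linear_sum !big_seq; apply: eq_bigr => a' as' /=.
      by rewrite qpi // cB // rmorphB scalerBl.
    under eq_bigr do rewrite sumrB; rewrite sumrB /mxad; congr (_ - _).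
      rewrite /Y mulmx_suml; apply: eq_bigr => a _.
      by rewrite -scaler_sumr -mulmx_sumr s1 mulmx1 scalemxAl.
    rewrite exchange_big /Y mulmx_sumr; apply: eq_bigr => a _ /=.
    by rewrite -scaler_sumr -!mulmx_suml s1 mul1mx scalemxAr.
  rewrite -qb; have /qP : 0 \in undup ds by rewrite mem_undup mem_head.
  rewrite c0 subr0 addSn exprS subr0 => /dvdpP[r ->].
  rewrite mulrCA poly_actXM; apply/XBA; apply: poly_act_mem => //.
  - by move=> *; apply: Bl.2.
  - by move=> *; apply/AB/XBA.
  by case: Bl.
have trpi a : a \in s -> \tr (X *m pi a) = a * (\rank (pi a))%:R.
  move=> as_; rewrite -(mxtrace_idempotent (sI a as_)) -mxtraceZ.
  apply/eqP; rewrite -subr_eq0 -raddfB /= -mul_scalar_mx -mulmxBl.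
  apply/eqP; apply: (@mxtrace_nilpotent _ _ _ n.+1).
  have -> : (X - a%:M) *m pi a = horner_mx X (('X - a%:P) * e a).
    by rewrite XE; exact/esym/rmorphM.
  rewrite -rmorphXn exprMn [e a ^+ _]exprSr mulrCA rmorphM /=.
  suff -> : horner_mx X (('X - a%:P) ^+ n.+1 * e a) = 0 by rewrite mulr0.
  by rewrite rmorphM rmorphXn -(sN a as_) XE.
have sum0 j : \sum_(a <- s) a * (\rank (pi a))%:R * (c a j)%:~R = 0.
  rewrite -[RHS](trX (Y j) (YBA j)) /Y mulmx_sumr raddf_sum /= !big_seq.
  by apply: eq_bigr => a as_; rewrite -scalemxAr mxtraceZ trpi // mulrC.
have c_eq0 a j : a \in s -> pi a != 0 -> c a j = 0.
  move=> as_ pa; have /eqP : \sum_(b <- s) (\rank (pi b))%:Z * c b j ^+ 2 = 0.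
    apply: (uI (fun i => \sum_(b <- s) (\rank (pi b))%:Z * (c b j * c b i))).
    transitivity (D%:~R * \sum_(b <- s) b * (\rank (pi b))%:R * (c b j)%:~R : k).
      2: by rewrite sum0 mulr0.
    rewrite mulr_sumr.
    under eq_bigr do rewrite rmorph_sum mulr_suml.
    rewrite exchange_big !big_seq; apply: eq_bigr => b bs /=.
    rewrite !mulrA cs // !mulr_suml; apply: eq_bigr => i _.
    by rewrite /= !rmorphM /= -pmulrn; ring.
  rewrite psumr_eq0 => [|b _]; last by rewrite mulr_ge0 ?sqr_ge0.
  move=> /allP/(_ a as_) /=; rewrite mulf_eq0 sqrf_eq0 => /orP[|/eqP //].
  by rewrite eqz_nat mxrank_eq0 (negPf pa).
rewrite -[LHS]mulr1 -s1 mulr_sumr big_seq big1 // => a as_; rewrite -/(pi a).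
have [->|pa] := eqVneq (pi a) 0; first by rewrite mulr0.
suff a0 : a = 0 by
  have := sN a as_; rewrite a0 raddf0 subr0.
apply/eqP; have /eqP : D%:~R * a = 0.
  by rewrite cs // big1 // => j _; rewrite c_eq0 // mul0r.
by rewrite mulf_eq0 intr0 // (negPf D0).
Qed.

End Spectral.

Lemma nilpotent_of_trace (k : closedFieldType) (k0 : [pchar k] =i pred0) n
    (X : 'M[k]_n) (A B : 'M[k]_n -> Prop) :
  lin_closed A -> lin_closed B -> (forall b, A b -> B b) ->
  (forall b, B b -> A (mxad X b)) ->
  (forall Y, (forall b, B b -> A (mxad Y b)) -> \tr (X *m Y) = 0) ->
  X ^+ n = 0.
Proof.
case: n X A B => [|n] X A B; first by move=> *; apply: flatmx0.
exact: nilpotent_of_trace_pos.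
Qed.

(** A subspace of maximal dimension among those contained in P. *)
Lemma vspace_of (k : fieldType) (U : vectType k) (P : U -> Prop) :
  lin_closed P -> exists A : {vspace U}, forall u, u \in A <-> P u.
Proof.
move=> [P0 Pl].
pose Q d := `[< exists A : {vspace U}, (forall u, u \in A -> P u) /\ \dim A = d >].
have [|d Qd|d /asboolP[A [AP dA]] dmax] := @ex_maxnP Q (dim U).
- exists 0%N; apply/asboolP; exists 0%VS; rewrite dimv0; split=> // u.
  by rewrite memv0 => /eqP ->.
- by case/asboolP: Qd => A [_ <-]; rewrite -dimvf dimvS ?subvf.
exists A => u; split=> [/AP //|Pu]; apply: contrapT => /negP uA.
have : Q (\dim (A + <[u]>)%VS).
  apply/asboolP; exists (A + <[u]>)%VS; split=> // v.
  move=> /memv_addP[a aA [_ /vlineP[c ->] ->]].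
  by rewrite addrC; apply: Pl => //; apply: AP.
move=> /dmax; rewrite -dA => dle.
have /eqP AE : A == (A + <[u]>)%VS by rewrite eqEdim addvSl.
by move: uA; rewrite AE (subvP (addvSr _ _)) ?memv_line.
Qed.

Lemma lin_closed_span (k : fieldType) (U : vectType k) (P : U -> Prop) (X : seq U) :
  lin_closed P -> (forall u, u \in X -> P u) -> forall u, u \in <<X>>%VS -> P u.
Proof.
move=> [P0 Pl] XP u; elim: X XP u => [|x X IH] XP u.
  by rewrite span_nil memv0 => /eqP ->.
rewrite span_cons => /memv_addP[_ /vlineP[c ->] [v vX ->]].
apply: Pl; first by apply: XP; rewrite mem_head.
by apply: IH vX => w wX; apply: XP; rewrite inE wX orbT.
Qed.

(** * Semisimple Lie algebras *)

Section LieBasics.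
Variables (k : fieldType) (g : fdLieAlgType k).
Implicit Types (x y z : g) (I A B D : {vspace g}).

Definition is_subalgebra D := forall x y, x \in D -> y \in D -> lie x y \in D.

Lemma lie_jacobil x y z : lie x (lie y z) = lie (lie x y) z + lie y (lie x z).
Proof. by rewrite adj_lie subrK. Qed.

Lemma ideal_lier I x y : is_ideal I -> x \in I -> lie x y \in I.
Proof. by move=> Ii xI; rewrite lieC memvN Ii. Qed.

Lemma derived_lie I x y : x \in I -> y \in I -> lie x y \in derived I.
Proof.
rewrite -{1 2}(span_basis (vbasisP I)) => xI yI; move: x xI.
apply: lin_closed_span => [|x xb].
  split=> [|a u v uP vP]; first by rewrite lie0l mem0v.
  by rewrite lieDl lieZl memvD ?memvZ.
move: y yI; apply: lin_closed_span => [|y yb].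
  split=> [|a u v uP vP]; first by rewrite linear0 mem0v.
  by rewrite linearP memvD ?memvZ.
by apply: memv_span; apply/allpairsP; exists (x, y).
Qed.

Lemma derived_ind I (P : g -> Prop) : lin_closed P ->
  (forall x y, x \in I -> y \in I -> P (lie x y)) ->
  forall x, x \in derived I -> P x.
Proof.
move=> Pl PI; apply: lin_closed_span => // u /allpairsP[[x y] /= [xb yb ->]].
by apply: PI; apply: vbasis_mem.
Qed.

Lemma derived_ideal I : is_ideal I -> is_ideal (derived I).
Proof.
move=> Ii x y; move: y; apply: derived_ind => [|y z yI zI].
  split=> [|a u v uP vP]; first by rewrite linear0 mem0v.
  by rewrite linearP memvD ?memvZ.
by rewrite lie_jacobil memvD ?derived_lie ?Ii.
Qed.

Lemma abelian_solvable I :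
  (forall x y, x \in I -> y \in I -> lie x y = 0) -> solvable I.
Proof.
move=> Iab; exists 1%N; apply/eqP; rewrite -subv0; apply/span_subvP.
move=> _ /allpairsP[[x y] /= [xb yb ->]].
by rewrite Iab ?mem0v ?vbasis_mem.
Qed.

(** Engel's theorem for the adjoint representation, relative to two stable
    subspaces so that the induction needs no quotient. A subalgebra H of D of
    maximal dimension among the proper ones has codimension one: the induction
    hypothesis for H acting on D modulo H gives x normalizing H. Then x acts
    nilpotently on the vectors of B that H kills modulo A. *)
Lemma engel D A B : is_subalgebra D ->
  (forall x, x \in D -> exists N, forall y, iter N (lie x) y = 0) ->
  (A <= B)%VS -> A <> B ->
  (forall x y, x \in D -> y \in A -> lie x y \in A) ->
  (forall x y, x \in D -> y \in B -> lie x y \in B) ->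
  exists v, [/\ v \in B, v \notin A & forall x, x \in D -> lie x v \in A].
Proof.
have [N] := ubnP (\dim D); elim: N => // N IH in D A B *.
rewrite ltnS => dD Dsub Dnil AB ABn DA DB.
have outA : exists2 v, v \in B & v \notin A.
  apply/subvPn/negP => BA; apply: ABn; apply/eqP.
  by rewrite eqEsubv AB.
have [D0|Dn0] := eqVneq D 0%VS.
  have [v vB vA] := outA; exists v; split=> // x.
  by rewrite D0 memv0 => /eqP ->; rewrite lie0l mem0v.
pose Q d := `[< exists H : {vspace g},
  [/\ is_subalgebra H, (H <= D)%VS, H <> D & \dim H = d] >].
have [|d Qd|d /asboolP[H [Hsub HD HDn dH]] dmax] := @ex_maxnP Q (\dim D).
- exists 0%N; apply/asboolP; exists 0%VS; rewrite dimv0 sub0v; split=> //.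
    by move=> x y; rewrite !memv0 => /eqP -> _; rewrite lie0l.
  by move/esym/eqP; rewrite (negPf Dn0).
- by case/asboolP: Qd => H [_ HD _ <-]; rewrite dimvS.
have HDm := subvP HD.
have dHD : (\dim H < \dim D)%N.
  by rewrite (ltn_leqif (dimv_leqif_eq HD)); apply/eqP.
have Hnil x : x \in H -> exists N, forall y, iter N (lie x) y = 0 by move=> /HDm/Dnil.
have [||x [xD xH Hx]] := IH H H D (leq_trans dHD dD) Hsub Hnil HD HDn => //.
  by move=> x y /HDm xD yD; apply: Dsub.
have DE : D = (H + <[x]>)%VS.
  have sub : (H + <[x]> <= D)%VS by rewrite subv_add HD -memvE.
  apply/esym/eqP/negPn/negP => /eqP ne.
  suff /dmax : Q (\dim (H + <[x]>)%VS).
    rewrite -dH leqNgt => /negP; apply.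
    rewrite (ltn_leqif (dimv_leqif_sup (addvSl _ _))) subv_add subvv -memvE.
    exact: xH.
  apply/asboolP; exists (H + <[x]>)%VS; split=> // u v.
  move=> /memv_addP[h hH [_ /vlineP[a ->] ->]] /memv_addP[h' hH' [_ /vlineP[b ->] ->]].
  apply: (subvP (addvSl _ _)); rewrite lieDl lieZl memvD //.
    by rewrite linearD linearZ /= memvD ?memvZ ?Hx //; apply: Hsub.
  rewrite linearD linearZ /= memvZ // memvD ?lie_alt ?scaler0 ?mem0v //.
  by rewrite lieC memvN Hx.
have [B' B'P] : exists B' : {vspace g}, forall v, v \in B' <->
    v \in B /\ forall h, h \in H -> lie h v \in A.
  apply: vspace_of; split=> [|a u v [uB uP] [vB vP]].
    by split=> [|h _]; rewrite ?linear0 mem0v.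
  by split=> [|h hH]; rewrite ?linearP memvD ?memvZ ?uP ?vP.
have [y z yH zA|y z yH zB|v [vB vA vH]] :=
    IH H A B (leq_trans dHD dD) Hsub Hnil AB ABn.
- by apply: DA => //; apply: HDm.
- by apply: DB => //; apply: HDm.
have B'x w : w \in B' -> lie x w \in B'.
  move=> /B'P[wB wP]; apply/B'P; split=> [|h hH]; first exact: DB.
  rewrite lie_jacobil memvD //; last by apply: DA => //; apply: wP.
  by rewrite wP // Hx.
have vB' : v \in B' by apply/B'P.
have itB' i : iter i (lie x) v \in B' by elim: i => //= i; apply: B'x.
have [M xM] := Dnil x xD.
have [|[|i] iA imin] := @ex_minnP (fun i => iter i (lie x) v \in A).
- by exists M; rewrite xM mem0v.
- by rewrite (negPf vA) in iA.
exists (iter i (lie x) v); have /B'P[wB wH] := itB' i; split=> //.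
  by apply/negP => /imin; rewrite ltnn.
move=> y; rewrite DE => /memv_addP[h hH [_ /vlineP[a ->] ->]].
by rewrite lieDl lieZl memvD ?(wH h) // memvZ.
Qed.

End LieBasics.

Section Semisimple.
Variables (k : closedFieldType) (g : fdLieAlgType k).
Hypothesis k0 : [pchar k] =i pred0.
Hypothesis gss : semisimple g.
Implicit Types (x y z : g) (I A B D : {vspace g}).

Lemma abelian_ideal_eq0 I : is_ideal I ->
  (forall x y, x \in I -> y \in I -> lie x y = 0) -> I = 0%VS.
Proof. by move=> Ii /abelian_solvable; apply: gss. Qed.

Lemma center_eq0 x : (forall y, lie x y = 0) -> x = 0.
Proof.
move=> xc; have [Z ZP] : exists Z : {vspace g}, forall u, u \in Z <-> forall y, lie u y = 0.
  apply: vspace_of; split=> [y|a u v uP vP y]; first by rewrite lie0l.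
  by rewrite lieDl lieZl uP vP scaler0 addr0.
have Z0 : Z = 0%VS.
  apply: abelian_ideal_eq0 => [u v /ZP vP|u v /ZP uP _ //].
  by apply/ZP => w; rewrite [lie u v]lieC vP oppr0 lie0l.
by apply/eqP; rewrite -memv0 -Z0; apply/ZP.
Qed.

(** By Engel's theorem a nonzero ideal of ad-nilpotent elements would have a
    nonzero center, which is an abelian ideal of g. *)
Lemma nil_ideal_eq0 I : is_ideal I ->
  (forall x, x \in I -> exists N, forall y, iter N (lie x) y = 0) -> I = 0%VS.
Proof.
move=> Ii Inil; apply: contrapT => I0.
have [||||v [vI v0 Iv]] := @engel _ g I 0%VS I _ Inil (sub0v _).
- by move=> x y _; apply: Ii.
- by move=> /esym.
- by move=> x y _; rewrite !memv0 => /eqP ->; rewrite linear0.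
- by move=> x y _; apply: Ii.
have [Z ZP] : exists Z : {vspace g}, forall u, u \in Z <->
    u \in I /\ forall y, y \in I -> lie y u = 0.
  apply: vspace_of; split=> [|a u w [uI uP] [wI wP]].
    by split=> [|y _]; rewrite ?mem0v ?linear0.
  split=> [|y yI]; first by rewrite memvD ?memvZ.
  by rewrite linearP /= (uP y yI) (wP y yI) addr0 scaler0.
suff Z0 : Z = 0%VS.
  move: v0; rewrite -Z0 => /negP; apply; apply/ZP; split=> // y yI.
  by apply/eqP; rewrite -memv0 Iv.
apply: abelian_ideal_eq0 => [u w /ZP[wI wP]|u w /ZP[uI _] /ZP[_ wP]]; last exact: wP.
apply/ZP; split=> [|y yI]; first exact: Ii.
by rewrite lie_jacobil (wP y) // linear0 addr0 wP // ideal_lier.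
Qed.

End Semisimple.

(** * Trace forms and Whitehead's first lemma *)

(** Unless X has a single eigenvalue, a spectral projection, being a polynomial
    in X, is a suitable E; a single eigenvalue is nonzero, as the trace is. *)
Lemma invertible_or_split (k : closedFieldType) n (X : 'M[k]_n) : \tr X != 0 ->
  X \in unitmx \/ exists E : 'M[k]_n,
    [/\ E *m E = E, E <> 0, E <> 1%:M & forall Y, X *m Y = Y *m X -> E *m Y = Y *m E].
Proof.
case: n X => [|n] X trX; first by move: trX; rewrite /mxtrace big_ord0 eqxx.
have [s [e [us s1 sN sI]]] := spectral_projections X.
have [[a [as_ a0 a1]]|nE] := pselect (exists a, [/\ a \in s,
    horner_mx X (e a) <> 0 & horner_mx X (e a) <> 1%:M]).
  right; exists (horner_mx X (e a)); split=> // [|Y XY]; first exact: sI.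
  exact/comm_mx_sym/comm_mx_horner.
left; have [a as_ aE] : exists2 a, a \in s & horner_mx X (e a) <> 0.
  apply: contrapT => nex; have /eqP := oner_neq0 'M[k]_n.+1; apply.
  by rewrite -s1 big_seq big1 // => a as_; apply: contrapT => ne; apply: nex; exists a.
have {aE} aE : horner_mx X (e a) = 1%:M.
  by apply: contrapT => ne; apply: nE; exists a.
have Xa := sN a as_; rewrite aE mulmx1 in Xa.
rewrite -row_free_unit -kermx_eq0; apply/eqP/row_matrixP => i.
have : row i (kermx X) *m X = 0 by rewrite -row_mul mulmx_ker row0.
move: (row i _) => v vX; rewrite row0.
have /(_ n.+1) : forall m, v *m (X - a%:M) ^+ m = (- a) ^+ m *: v.
  elim=> [|m IH]; first by rewrite expr0 mulmx1 scale1r.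
  rewrite exprSr mulmxA IH mulmxBr -scalemxAl vX mul_mx_scalar scaler0 sub0r.
  by rewrite scalerA -scaleNr -mulNr -exprS.
rewrite Xa mulmx0 => /esym/eqP; rewrite scaler_eq0 expf_eq0 /= oppr_eq0.
case/orP => [/eqP a0|/eqP //]; case/eqP: trX.
by move: Xa; rewrite a0 raddf0 subr0 => /mxtrace_nilpotent ->.
Qed.

Lemma dim_mx (k : fieldType) m n : dim 'M[k]_(m, n) = (m * n)%N.
Proof. exact: dim_matrix. Qed.

Lemma mxtraceB (k : pzRingType) n (X Y : 'M[k]_n) : \tr (X - Y) = \tr X - \tr Y.
Proof. exact: raddfB. Qed.

Lemma v2r_mx_inj (k : fieldType) (U : vectType k) m (M N : 'M[k]_(dim U, m)) :
  (forall v : U, v2r v *m M = v2r v *m N) -> M = N.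
Proof.
move=> MN; apply/row_matrixP => i.
by have := MN (r2v (delta_mx 0 i)); rewrite r2vK -!rowE.
Qed.

Section RepMatrix.
Variables (k : fieldType) (g : fdLieAlgType k) (U : fdrep g).
Implicit Types (x y z a : g).

Definition rep_mx x : 'M[k]_(dim U) := f2mx (rep_act U x).

Lemma v2r_rep x (u : U) : v2r (rep_act U x u) = v2r u *m rep_mx x.
Proof. exact: v2r_lfun. Qed.

Fact rep_mx_linear : linear rep_mx.
Proof.
move=> c x y; apply: v2r_mx_inj => u.
rewrite -v2r_rep rep_actDl rep_actZl linearP /= mulmxDr -scalemxAr.
by rewrite -!v2r_rep.
Qed.
HB.instance Definition _ :=
  GRing.isLinear.Build k g 'M[k]_(dim U) *:%R rep_mx rep_mx_linear.

Lemma rep_mx_lie x y :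
  rep_mx (lie x y) = rep_mx y *m rep_mx x - rep_mx x *m rep_mx y.
Proof.
apply: v2r_mx_inj => u; rewrite -v2r_rep rep_lie mulmxBr !mulmxA -!v2r_rep.
by rewrite linearB.
Qed.

Lemma rep_mx_eq0 x : rep_mx x = 0 -> rep_act U x = 0.
Proof.
move=> x0; apply/lfunP => u; apply: v2r_inj.
by rewrite v2r_rep x0 mulmx0 zero_lfunE linear0.
Qed.

Definition trace_form x y := \tr (rep_mx x *m rep_mx y).

Lemma trace_formC x y : trace_form x y = trace_form y x.
Proof. exact: mxtrace_mulC. Qed.

Fact trace_form_linear x : scalar (trace_form x).
Proof.
by move=> c y z; rewrite /trace_form linearP /= mulmxDr -scalemxAr linearP.
Qed.
HB.instance Definition _ x :=
  GRing.isLinear.Build k g k *%R (trace_form x) (trace_form_linear x).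

Lemma trace_formDl x y z : trace_form (x + y) z = trace_form x z + trace_form y z.
Proof. by rewrite trace_formC linearD /= !(trace_formC z). Qed.

Lemma trace_formZl c x z : trace_form (c *: x) z = c * trace_form x z.
Proof. by rewrite trace_formC linearZ /= (trace_formC z). Qed.

Lemma trace_form_lie a x y : trace_form (lie a x) y = - trace_form x (lie a y).
Proof.
rewrite /trace_form !rep_mx_lie mulmxBl mulmxBr 2!mxtraceB opprB !mulmxA.
by congr (_ - _); rewrite -[X in \tr X = _]mulmxA; apply: mxtrace_mulC.
Qed.

End RepMatrix.

Section Cartan.
Variables (k : closedFieldType) (g : fdLieAlgType k).
Hypothesis k0 : [pchar k] =i pred0.
Implicit Types (x y z a : g) (I D : {vspace g}) (U : fdrep g).

Lemma derived_sub I x : is_ideal I -> x \in derived I -> x \in I.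
Proof.
move=> Ii; apply: (derived_ind (P := fun x => x \in I)) => [|y z _ zI]; last exact: Ii.
by split=> [|c u v uI vI]; rewrite ?mem0v ?memvD ?memvZ.
Qed.

(** For x = [y, z] and Y such that ad Y maps I into its derived ideal, the
    invariance of the trace turns tr (x Y) into a trace form of z and [Y, y],
    both in I. *)
Lemma cartan_nilpotent U I x : is_ideal I ->
  (forall y z, y \in I -> z \in I -> trace_form U y z = 0) ->
  x \in derived I -> rep_mx U x ^+ dim U = 0.
Proof.
move=> Ii I0 xI; have dI := derived_ideal Ii.
have im_closed (J : {vspace g}) : lin_closed (fun b => exists2 z, z \in J & b = rep_mx U z).
  split=> [|c u v [y yJ ->] [z zJ ->]].
    by exists 0; rewrite ?mem0v ?linear0.
  by exists (c *: y + z); rewrite ?memvD ?memvZ // linearP.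
apply: (nilpotent_of_trace k0 (im_closed (derived I)) (im_closed I)).
- by move=> _ [z zI ->]; exists z => //; apply: derived_sub.
- move=> _ [z zI ->]; exists (lie z x); last by rewrite rep_mx_lie.
  by apply: derived_lie => //; apply: derived_sub.
move=> Y YP; move: x xI; apply: derived_ind => [|y z yI zI].
  split=> [|c u v uP vP]; first by rewrite linear0 mul0mx linear0.
  by rewrite linearP /= mulmxDl -scalemxAl linearP /= uP vP mulr0 addr0.
have [|c cI cE] := YP (rep_mx U y); first by exists y.
have := I0 z c zI (derived_sub Ii cI); rewrite /trace_form -cE /mxad mulmxBr.
rewrite rep_mx_lie mulmxBl !mxtraceB => /eqP; rewrite subr_eq0 => /eqP h.
by rewrite -!mulmxA [X in _ - X]mxtrace_mulC -!mulmxA h subrr.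
Qed.

Hypothesis gss : semisimple g.

(** Cartan's criterion: the brackets of elements of I act nilpotently on U, hence
    on g, as I acts faithfully; being a nil ideal, the derived ideal vanishes, so
    I is abelian. *)
Lemma ideal_trace_form_eq0 U I : is_ideal I ->
  (forall x, x \in I -> rep_act U x = 0 -> x = 0) ->
  (forall y z, y \in I -> z \in I -> trace_form U y z = 0) -> I = 0%VS.
Proof.
move=> Ii Uf I0.
have dI0 : derived I = 0%VS.
  apply: (nil_ideal_eq0 gss (derived_ideal Ii)) => x xI.
  exists (dim U + dim U).+1 => y; have xI' := derived_sub Ii xI.
  rewrite iterSr; apply: Uf.
    by elim: (_ + _)%N => [|i IH] /=; [apply: ideal_lier | apply: Ii].
  apply: rep_mx_eq0; move: (lie x y) => z.
  have -> : rep_mx U (iter (dim U + dim U) (lie x) z) =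
    iter (dim U + dim U) (fun u => mulmxr (rep_mx U x) u - mulmx (rep_mx U x) u) (rep_mx U z).
    by elim: (_ + _)%N => [|i IH] //=; rewrite rep_mx_lie IH.
  have x0 := cartan_nilpotent Ii I0 xI.
  have powl i b : iter i (mulmx (rep_mx U x)) b = rep_mx U x ^+ i *m b.
    by elim: i => [|i IH]; rewrite ?expr0 ?mul1mx //= IH exprS mulmxA.
  have powr i b : iter i (mulmxr (rep_mx U x)) b = b *m rep_mx U x ^+ i.
    by elim: i => [|i IH]; rewrite ?expr0 ?mulmx1 //= IH exprSr mulmxA.
  apply: iter_sub_eq0 => [u /=||]; first by rewrite mulmxA.
    by rewrite powr x0 mulmx0.
  by rewrite powl x0 mul0mx.
apply: abelian_ideal_eq0 => // x y xI yI.
by apply/eqP; rewrite -memv0 -dI0 derived_lie.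
Qed.

Lemma adj_faithful x : rep_act (adj_rep g) x = 0 -> x = 0.
Proof.
move=> x0; apply: (center_eq0 gss) => y.
by rewrite -[lie x y](@mk_repE _ _ _ _ (@lie_linearr k g) (@adj_linl _ g) (@adj_lie _ g) x y) -/(adj_rep g) x0 zero_lfunE.
Qed.

(** Pairing with a basis of D embeds g into a space of dimension dim D. *)
Lemma killing_perp_full D :
  (forall x, (forall y, y \in D -> trace_form (adj_rep g) x y = 0) -> x = 0) ->
  D = fullv.
Proof.
move=> DP; pose K := trace_form (adj_rep g).
pose phi x : 'rV[k]_(\dim D) := \row_i K (vbasis D)`_i x.
have phi_lin : linear phi.
  by move=> c x y; apply/rowP => i; rewrite !mxE /K linearP.
pose F : {linear g -> 'rV[k]_(\dim D)} :=
  HB.pack phi (GRing.isLinear.Build k _ _ *:%R phi phi_lin).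
have ker0 : lker (linfun F) = 0%VS.
  apply/eqP; rewrite -subv0; apply/subvP => x; rewrite memv_ker lfunE => /eqP x0.
  rewrite memv0; apply/eqP/DP => y yD; rewrite (coord_vbasis yD) linear_sum big1 // => i _.
  have /rowP/(_ i) := x0; rewrite !mxE linearZ /= trace_formC /K => ->.
  by rewrite mulr0.
apply/eqP; rewrite eqEdim subvf -(limg_dim_eq (f := linfun F)) ?ker0 ?capv0 //.
apply: leq_trans (dimvS (subvf _)) _.
by rewrite dimvf dim_mx mul1n.
Qed.

Lemma killing_nondegenerate x :
  (forall y, trace_form (adj_rep g) x y = 0) -> x = 0.
Proof.
move=> x0; have [R RP] : exists R : {vspace g}, forall z, z \in R <->
    forall y, trace_form (adj_rep g) z y = 0.
  apply: vspace_of; split=> [y|c u v uP vP y].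
    by rewrite trace_formC linear0.
  by rewrite trace_formDl trace_formZl uP vP mulr0 addr0.
suff R0 : R = 0%VS by apply/eqP; rewrite -memv0 -R0; apply/RP.
apply: (@ideal_trace_form_eq0 (adj_rep g)) => [y z /RP zR|y _|y z /RP yR _ //].
  by apply/RP => w; rewrite trace_form_lie zR oppr0.
exact: adj_faithful.
Qed.

(** An element orthogonal to all brackets for the Killing form is central. *)
Lemma semisimple_perfect (P : g -> Prop) : lin_closed P ->
  (forall x y, P (lie x y)) -> forall x, P x.
Proof.
move=> Pl Plie x; apply: (@derived_ind _ _ fullv) => //.
suff -> : derived {:g} = fullv by apply: memvf.
apply: killing_perp_full => y yP; apply: (center_eq0 gss) => z.
apply: killing_nondegenerate => w; rewrite lieC -scaleN1r trace_formZl.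
by rewrite trace_form_lie yP ?derived_lie ?memvf // oppr0 mulr0.
Qed.

(** Q is the Killing-orthogonal of the kernel of U: it meets the kernel in an ideal
    on which the Killing form vanishes, so in 0 by Cartan's criterion. *)
Lemma faithful_ideal U : exists Q : {vspace g}, [/\ is_ideal Q,
    forall x, x \in Q -> rep_act U x = 0 -> x = 0
  & Q = 0%VS -> forall x, rep_act U x = 0].
Proof.
have [Q QP] : exists Q : {vspace g}, forall x, x \in Q <->
    forall y, rep_act U y = 0 -> trace_form (adj_rep g) x y = 0.
  apply: vspace_of; split=> [y _|c u v uP vP y y0].
    by rewrite trace_formC linear0.
  by rewrite trace_formDl trace_formZl uP // vP // mulr0 addr0.
have [J JP] : exists J : {vspace g}, forall x, x \in J <-> rep_act U x = 0.
  apply: vspace_of; split=> [|c u v u0 v0]; first exact: linear0.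
  by rewrite linearP /= u0 v0 scaler0 addr0.
have Ji : is_ideal J.
  move=> x y /JP y0; apply/JP/lfunP => u.
  by rewrite rep_lie y0 !zero_lfunE linear0 subr0.
have Qi : is_ideal Q.
  move=> x y /QP yQ; apply/QP => z /JP zJ.
  by rewrite trace_form_lie (yQ (lie x z)) ?oppr0 //; apply/JP/Ji.
exists Q; split=> // [x xQ x0|Q0 x].
  suff QJ0 : (Q :&: J)%VS = 0%VS.
    by apply/eqP; rewrite -memv0 -QJ0 memv_cap xQ; apply/JP.
  apply: (@ideal_trace_form_eq0 (adj_rep g)) => [y z|y _|y z].
  - by rewrite !memv_cap => /andP[/(Qi y) -> /(Ji y) ->].
  - exact: adj_faithful.
  by rewrite !memv_cap => /andP[/QP yQ _] /andP[_ /JP /yQ].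
suff /vspaceP JE : J = fullv by apply/JP; rewrite JE memvf.
apply: killing_perp_full => y yP; apply/eqP; rewrite -memv0 -Q0.
by apply/QP => z /JP; apply: yP.
Qed.

(** Dual bases for the trace form on a complement of the kernel of U, where it is
    nondegenerate because its radical is an ideal on which it vanishes. The last
    clause is the invariance of the tensor sum_i e_i (x) e'_i. *)
Lemma casimir_elements U : (exists x, rep_act U x <> 0) ->
  exists d (e e' : 'I_d -> g),
  [/\ (0 < d)%N, \sum_i trace_form U (e i) (e' i) = d%:R
    & forall (Z : lmodType k) (b : g -> g -> Z),
        (forall y, linear (b^~ y)) -> (forall x, linear (b x)) ->
        forall a, \sum_i (b (lie a (e i)) (e' i) + b (e i) (lie a (e' i))) = 0].
Proof.
move=> [x0 Ux0]; have [Q [Qi Qf Q0]] := faithful_ideal U.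
have nondeg x : x \in Q -> (forall y, y \in Q -> trace_form U x y = 0) -> x = 0.
  move=> xQ xB; have [R RP] : exists R : {vspace g}, forall z, z \in R <->
      z \in Q /\ forall y, y \in Q -> trace_form U z y = 0.
    apply: vspace_of; split=> [|c u v [uQ uP] [vQ vP]].
      by split=> [|y _]; rewrite ?mem0v // trace_formC linear0.
    split=> [|y yQ]; first by rewrite memvD ?memvZ.
    by rewrite trace_formDl trace_formZl uP ?vP // mulr0 addr0.
  suff R0 : R = 0%VS by apply/eqP; rewrite -memv0 -R0; apply/RP.
  apply: (@ideal_trace_form_eq0 U) => [y z /RP[zQ zR]|y /RP[yQ _]|y z /RP[_ yR] /RP[zQ _]].
  - apply/RP; split=> [|w wQ]; first exact: Qi.
    by rewrite trace_form_lie zR ?oppr0 ?Qi.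
  - exact: Qf.
  exact: yR.
pose d := \dim Q; pose e (i : 'I_d) := (vbasis Q)`_i.
have eQ i : e i \in Q by apply/vbasis_mem/mem_nth; rewrite size_tuple.
pose G : 'M[k]_d := \matrix_(i, j) trace_form U (e i) (e j).
have BE x y : x \in Q -> trace_form U y x = \sum_i coord (vbasis Q) i x * trace_form U y (e i).
  move=> xQ; rewrite {1}(coord_vbasis xQ) linear_sum; apply: eq_bigr => i _.
  by rewrite linearZ.
have Gu : G \in unitmx.
  rewrite -row_free_unit -kermx_eq0; apply/eqP/row_matrixP => i0.
  have : row i0 (kermx G) *m G = 0 by rewrite -row_mul mulmx_ker row0.
  move: (row i0 _) => v vG; rewrite row0.
  have v0 : \sum_i v 0 i *: e i = 0.
    apply: nondeg => [|y yQ]; first by rewrite memv_suml // => i _; rewrite memvZ.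
    rewrite BE // big1 // => j _; rewrite trace_formC linear_sum.
    have /rowP/(_ j) := vG; rewrite !mxE => vj.
    rewrite (eq_bigr (fun i => v 0 i * G i j)) ?vj ?mulr0 // => i _.
    by rewrite linearZ mxE trace_formC.
  apply/rowP => i; rewrite mxE -[LHS](coord_sum_free (v 0) i (basis_free (vbasisP Q))).
  by rewrite v0 linear0.
pose e' j := \sum_l invmx G l j *: e l.
have e'Q j : e' j \in Q by rewrite memv_suml // => l _; rewrite memvZ.
have ee' i j : trace_form U (e i) (e' j) = (i == j)%:R.
  rewrite linear_sum; have /matrixP/(_ i j) := mulmxV Gu.
  rewrite mxE [in RHS]mxE => <-.
  by apply: eq_bigr => l _; rewrite linearZ mxE mulrC.
have exp1 y : y \in Q -> y = \sum_j trace_form U y (e' j) *: e j.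
  move=> yQ; rewrite {1}(coord_vbasis yQ); apply: eq_bigr => j _; congr (_ *: _).
  rewrite trace_formC BE // (bigD1 j) //= trace_formC ee' eqxx mulr1.
  rewrite big1 ?addr0 // => i ij; rewrite trace_formC ee' (negPf ij).
  by rewrite mulr0.
have exp2 y : y \in Q -> y = \sum_j trace_form U y (e j) *: e' j.
  move=> yQ; apply/eqP; rewrite -subr_eq0; apply/eqP; apply: nondeg => [|z zQ].
    by rewrite memvB // memv_suml // => i _; rewrite memvZ.
  rewrite BE // big1 // => i _; rewrite trace_formC linearB linear_sum.
  rewrite (bigD1 i) //= linearZ /= ee' eqxx mulr1 big1 => [|j ji].
    by rewrite trace_formC addr0 subrr mulr0.
  by rewrite linearZ /= ee' eq_sym (negPf ji) mulr0.
exists d, e, e'; split.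
- rewrite lt0n dimv_eq0; apply/eqP => /Q0 U0; exact: Ux0 (U0 x0).
- by rewrite (eq_bigr (fun=> 1)) ?sumr_const ?card_ord // => i _; rewrite [LHS]ee' eqxx.
move=> Z b bl br a; rewrite big_split /=.
pose bL y : {linear g -> Z} := HB.pack (b^~ y) (GRing.isLinear.Build k _ _ *:%R _ (bl y)).
pose bR x : {linear g -> Z} := HB.pack (b x) (GRing.isLinear.Build k _ _ *:%R _ (br x)).
have -> : \sum_i b (lie a (e i)) (e' i) =
    \sum_i \sum_j trace_form U (lie a (e i)) (e' j) *: b (e j) (e' i).
  apply: eq_bigr => i _; rewrite {1}(exp1 (lie a (e i))) ?Qi //.
  rewrite -[LHS]/(bL (e' i) _) linear_sum; apply: eq_bigr => j _.
  by rewrite linearZ.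
have -> : \sum_i b (e i) (lie a (e' i)) =
    \sum_i \sum_j trace_form U (lie a (e' i)) (e j) *: b (e i) (e' j).
  apply: eq_bigr => i _; rewrite {1}(exp2 (lie a (e' i))) ?Qi //.
  rewrite -[LHS]/(bR (e i) _) linear_sum; apply: eq_bigr => j _.
  by rewrite linearZ.
rewrite exchange_big -big_split big1 //= => i _; rewrite -big_split big1 //= => j _.
by rewrite -scalerDl trace_form_lie trace_formC addNr scale0r.
Qed.

End Cartan.

Section SubRep.
Variables (k : fieldType) (L : lieAlgType k) (U : fdrep L) (A : {vspace U}).
Hypothesis A_stable : forall a u, u \in A -> rep_act U a u \in A.

Definition sub_act (a : L) (u : subvs_of A) : subvs_of A :=
  vsproj A (rep_act U a (vsval u)).

Fact sub_actE a u : vsval (sub_act a u) = rep_act U a (vsval u).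
Proof. by rewrite vsprojK // A_stable // subvsP. Qed.

Fact sub_linr a : linear (sub_act a).
Proof. by move=> c u v; apply: subvs_inj; rewrite linearP /= !sub_actE !linearP. Qed.
Fact sub_linl u : linear (sub_act^~ u).
Proof.
move=> c a b; apply: subvs_inj; rewrite linearP /= !sub_actE.
by rewrite rep_actDl rep_actZl.
Qed.
Fact sub_lie a b u :
  sub_act (lie a b) u = sub_act a (sub_act b u) - sub_act b (sub_act a u).
Proof. by apply: subvs_inj; rewrite linearB /= !sub_actE rep_lie. Qed.
Definition sub_rep : fdrep L := mk_rep sub_linr sub_linl sub_lie.

Lemma sub_repE a (u : sub_rep) : vsval (rep_act sub_rep a u) = rep_act U a (vsval u).
Proof. by rewrite mk_repE sub_actE. Qed.

End SubRep.

Section Whitehead.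
Variables (k : closedFieldType) (g : fdLieAlgType k).
Hypothesis k0 : [pchar k] =i pred0.
Hypothesis gss : semisimple g.

Definition cocycle1 (U : fdrep g) (c : g -> U) := linear c /\
  forall a b, c (lie a b) = rep_act U a (c b) - rep_act U b (c a).

Lemma cocycle1_sub (U : fdrep g) (A : {vspace U})
    (stA : forall a u, u \in A -> rep_act U a u \in A) (c : g -> U) :
  cocycle1 c -> (forall a, c a \in A) ->
  cocycle1 (U := sub_rep stA) (fun a => vsproj A (c a)).
Proof.
move=> [c_lin c_lie] cA; split=> [z a b|a b].
  by rewrite c_lin linearP.
by apply: subvs_inj; rewrite [RHS]linearB /= !sub_repE 3?vsprojK //.
Qed.

(** By induction on the dimension of U, c vanishing by perfectness if g acts
    trivially. Otherwise let C be the Casimir operator of U and u the sum of the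
    e_i c(e'_i); the invariance of the Casimir tensor gives a u = C c(a). If C is
    invertible, c is the coboundary of the preimage of u; if not, the trace of C
    being nonzero, a spectral projection of C splits U into two proper
    submodules. *)
Theorem whitehead (U : fdrep g) (c : g -> U) :
  cocycle1 c -> exists u, forall a, c a = rep_act U a u.
Proof.
have [N] := ubnP (dim U); elim: N => // N IH in U c *; rewrite ltnS => dU cc.
have [c_lin c_lie] := cc.
pose cL : {linear g -> U} := HB.pack c (GRing.isLinear.Build k _ _ *:%R _ c_lin).
have step (A : {vspace U}) (stA : forall a u, u \in A -> rep_act U a u \in A) c' :
    A <> fullv -> cocycle1 c' -> (forall a, c' a \in A) ->
    exists u, forall a, c' a = rep_act U a u.
  move=> An cc' cA; have [|u uE] := IH (sub_rep stA) _ _ (cocycle1_sub stA cc' cA).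
    rewrite -[dim _]/(\dim A); apply: leq_trans dU.
    rewrite -dimvf (ltn_leqif (dimv_leqif_eq (subvf A))); exact/eqP.
  exists (vsval u) => a; rewrite -sub_repE -uE vsprojK //.
have [U0|/existsNP nU0] := pselect (forall x, rep_act U x = 0).
  suff c0 a : c a = 0 by exists 0 => a; rewrite linear0.
  move: a; apply: (semisimple_perfect k0 gss) => [|a b].
    split=> [|z a b ca cb]; first exact: (linear0 cL).
    by rewrite c_lin ca cb scaler0 addr0.
  by rewrite c_lie !U0 !zero_lfunE subrr.
have [d [e [e' [d0 trd inv]]]] := casimir_elements k0 gss nU0.
pose X := \sum_i rep_mx U (e' i) *m rep_mx U (e i).
pose C v := \sum_i rep_act U (e i) (rep_act U (e' i) v).
have CX v : v2r (C v) = v2r v *m X.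
  rewrite linear_sum mulmx_sumr; apply: eq_bigr => i _.
  by rewrite /= !v2r_rep mulmxA.
have trX : \tr X != 0.
  rewrite raddf_sum (eq_bigr _ (fun i _ => trace_formC U (e' i) (e i))) trd.
  by rewrite natr0 // -lt0n.
have Cc a : rep_act U a (\sum_i rep_act U (e i) (c (e' i))) = C (c a).
  apply/eqP; rewrite -subr_eq0 linear_sum -sumrB; apply/eqP.
  rewrite -[RHS](inv U (fun x y => rep_act U x (c y)) _ _ a).
  - by apply: eq_bigr => i _ /=; rewrite rep_lie c_lie linearB /= addrA subrK.
  - by move=> y z x x'; rewrite rep_actDl rep_actZl.
  by move=> x z y y'; rewrite c_lin linearP.
have XC a : X *m rep_mx U a = rep_mx U a *m X.
  apply: v2r_mx_inj => v; rewrite !mulmxA -CX -!v2r_rep -CX; congr v2r.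
  apply/eqP; rewrite -subr_eq0 linear_sum -sumrB; apply/eqP.
  rewrite -[RHS](inv U (fun x y => rep_act U x (rep_act U y v)) _ _ a).
  - by apply: eq_bigr => i _ /=; rewrite !rep_lie [rep_act U (e i) (_ - _)]linearB /= addrA subrK.
  - by move=> y z x x'; rewrite rep_actDl rep_actZl.
  by move=> x z y y'; rewrite rep_actDl rep_actZl linearP.
have [Xu|[E [EE E0 E1 EC]]] := invertible_or_split trX.
  set u := \sum_i _ in Cc; exists (r2v (v2r u *m invmx X)) => a.
  apply: v2r_inj; rewrite v2r_rep r2vK; apply: (can_inj (mulmxK Xu)).
  by rewrite -[RHS]mulmxA -XC mulmxA mulmxKV // -v2r_rep Cc CX.
pose f : 'End(U) := Hom E.
have fE v : v2r (f v) = v2r v *m E by rewrite v2r_lfun.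
have ff v : f (f v) = f v by apply: v2r_inj; rewrite !fE -mulmxA EE.
have fa a v : f (rep_act U a v) = rep_act U a (f v).
  by apply: v2r_inj; rewrite fE !v2r_rep fE -!mulmxA EC.
have [||||u1 u1E] := @step (limg f) _ (fun a => f (c a)).
- by move=> a _ /memv_imgP[v _ ->]; rewrite -fa memv_img ?memvf.
- move=> fl; apply: E1; apply: v2r_mx_inj => v; rewrite mulmx1 -fE; congr v2r.
  by have /memv_imgP[w _ ->] : v \in limg f by rewrite fl memvf.
- by split=> [z a b|a b]; [rewrite c_lin linearP | rewrite c_lie linearB /= !fa].
- by move=> a; rewrite memv_img ?memvf.
have [||||u2 u2E] := @step (lker f) _ (fun a => c a - f (c a)).
- by move=> a v; rewrite !memv_ker fa => /eqP ->; rewrite linear0.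
- move=> fl; apply: E0; apply: v2r_mx_inj => v; rewrite mulmx0 -fE.
  have : v \in lker f by rewrite fl memvf.
  by rewrite memv_ker => /eqP ->; rewrite linear0.
- split=> [z a b|a b]; first by rewrite c_lin linearP scalerBr opprD addrACA.
  rewrite c_lie (linearB f) /= !fa ![rep_act U _ (_ - _)]linearB /=.
  by rewrite !opprB !addrA [LHS](ACl (1*4*3*2)).
- by move=> a; rewrite memv_ker linearB /= ff subrr.
exists (u1 + u2) => a; rewrite linearD /= -u1E -u2E.
by rewrite addrC subrK.
Qed.

Corollary whitehead_sub (U : fdrep g) (A : {vspace U}) (c : g -> U) :
  (forall a u, u \in A -> rep_act U a u \in A) -> cocycle1 c ->
  (forall a, c a \in A) -> exists2 u, u \in A & forall a, c a = rep_act U a u.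
Proof.
move=> stA cc cA; have [u uE] := whitehead (cocycle1_sub stA cc cA).
by exists (vsval u) => [|a]; rewrite ?subvsP // -sub_repE -uE vsprojK.
Qed.

End Whitehead.

(** * Schur's lemma *)

Section Schur.
Variables (k : closedFieldType) (L : lieAlgType k).

Lemma eigenvector_exists (U : vectType k) (f : 'End(U)) :
  {: U}%VS <> 0%VS -> exists a v, v <> 0 /\ f v = a *: v.
Proof.
move=> U0; have [rs rsE] := char_poly_split (f2mx f).
have : (0 < size rs)%N.
  have := size_char_poly (f2mx f); rewrite rsE size_prod_XsubC => -[->].
  by rewrite -dimvf lt0n dimv_eq0; apply/eqP.
case: rs rsE => // a rs rsE _.
have : root (char_poly (f2mx f)) a by rewrite rsE root_prod_XsubC mem_head.
rewrite -eigenvalue_root_char => /eigenvalueP[v vf v0].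
exists a, (r2v v); split.
  by move=> v0'; case/eqP: v0; rewrite -[v]r2vK v0' linear0.
by apply: v2r_inj; rewrite v2r_lfun linearZ /= r2vK vf.
Qed.

Variables W W' : fdrep L.
Hypotheses (W_irr : irreducible W) (W'_irr : irreducible W').

Lemma schur_zero (h : 'Hom(W, W')) : ~ rep_iso W W' -> is_rep_hom h -> h = 0.
Proof.
move=> nW hh; apply: contrapT => h0; apply: nW; exists h; split=> //.
have ker0 : lker h = 0%VS.
  have [|//|kf] := W_irr.2 (lker h).
    by move=> a v; rewrite !memv_ker hh => /eqP ->; rewrite linear0.
  case: h0; apply/lfunP => v; have : v \in lker h by rewrite kf memvf.
  by rewrite memv_ker zero_lfunE => /eqP.
have im1 : limg h = fullv.
  have [|im0|//] := W'_irr.2 (limg h).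
    by move=> a _ /memv_imgP[v _ ->]; rewrite -hh memv_img ?memvf.
  case: h0; apply/lfunP => v; apply/eqP; rewrite zero_lfunE -memv0 -im0.
  by rewrite memv_img ?memvf.
exists (h^-1)%VF => [|w]; first by apply: lker0_lfunK; rewrite ker0.
by apply: limg_lfunVK; rewrite im1 memvf.
Qed.

Lemma schur_scalar (t h : 'Hom(W, W')) : bijective t -> is_rep_hom t ->
  is_rep_hom h -> exists a, h = a *: t.
Proof.
move=> [t' tK t'K] th hh.
have t'E w : (t^-1)%VF w = t' w.
  by apply: (can_inj tK); rewrite t'K limg_lfunVK // -[w]t'K memv_img ?memvf.
have [a [v [v0 vE]]] := eigenvector_exists (t^-1 \o h)%VF W_irr.1.
exists a; have hv : h v = a *: t v.
  by move: vE; rewrite comp_lfunE t'E => /(congr1 t); rewrite t'K linearZ.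
have [|k0|kf] := W_irr.2 (lker (h - a *: t)).
- move=> b u; rewrite !memv_ker !(add_lfunE, opp_lfunE, scale_lfunE) !subr_eq0.
  by rewrite hh th => /eqP ->; rewrite linearZ.
- case: v0; apply/eqP; rewrite -memv0 -k0 memv_ker.
  by rewrite !(add_lfunE, opp_lfunE, scale_lfunE) hv subrr.
apply/lfunP => u; apply/eqP; rewrite -subr_eq0 -opp_lfunE -add_lfunE -memv_ker.
by rewrite kf memvf.
Qed.

End Schur.

(** * Logarithmic derivatives of regular maps on the torus *)

Section Torus.
Variables (k : fieldType) (n : nat).
Hypothesis k0 : [pchar k] =i pred0.
Implicit Types (z x : torus k n).
Local Notation degree := {ffun 'I_n -> int}.

Lemma torus_neq0 z i : z i != 0.
Proof. exact: (forallP (torus_coordP z) i). Qed.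

Lemma torusP z x : (forall i, z i = x i) -> z = x.
Proof. by move=> zx; apply/val_inj/ffunP. Qed.

Definition mono (p : degree) z := \prod_(i < n) z i ^ p i.

Lemma monoD p q z : mono (p + q) z = mono p z * mono q z.
Proof.
rewrite -big_split; apply: eq_bigr => i _ /=.
by rewrite ffunE expfzDr // torus_neq0.
Qed.

Lemma mono0 z : mono 0 z = 1.
Proof. by rewrite /mono big1 // => i _; rewrite ffunE. Qed.

Lemma monoNK p z : mono p z * mono (- p) z = 1.
Proof. by rewrite -monoD subrr mono0. Qed.

Lemma mono_neq0 p z : mono p z != 0.
Proof. by apply/prodf_neq0 => i _; rewrite expfz_neq0 // torus_neq0. Qed.

Section Dsum.
Variable W : lmodType k.
Implicit Types (s : seq (degree * W)).

Definition laurent s z : W := \sum_(p <- s) mono p.1 z *: p.2.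
Definition dsum i s z : W := \sum_(p <- s) ((p.1 i)%:~R * mono p.1 z) *: p.2.

Lemma laurent_cat s t z : laurent (s ++ t) z = laurent s z + laurent t z.
Proof. exact: big_cat. Qed.
Lemma dsum_cat i s t z : dsum i (s ++ t) z = dsum i s z + dsum i t z.
Proof. exact: big_cat. Qed.

Definition scale_terms a s := [seq (p.1, a *: p.2) | p <- s].

Lemma laurent_scale a s z : laurent (scale_terms a s) z = a *: laurent s z.
Proof.
rewrite /laurent big_map scaler_sumr; apply: eq_bigr => p _ /=.
by rewrite !scalerA mulrC.
Qed.
Lemma dsum_scale i a s z : dsum i (scale_terms a s) z = a *: dsum i s z.
Proof.
rewrite /dsum big_map scaler_sumr; apply: eq_bigr => p _ /=.
by rewrite !scalerA mulrC.
Qed.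
End Dsum.

Lemma poly_eq0_torus (P : {poly k}) : (forall t, t != 0 -> P.[t] = 0) -> P = 0.
Proof.
move=> P0; apply/eqP/negPn/negP => Pn0.
have := @max_poly_roots _ P [seq j.+1%:R | j <- iota 0 (size P)] Pn0.
rewrite size_map size_iota ltnn => h; suff : false by [].
apply: h; first by apply/allP => _ /mapP[j _ ->]; rewrite /root P0 ?natr0.
rewrite map_inj_uniq ?iota_uniq // => i j ij; apply/eqP.
have [lij|/ltnW lji] := leqP i j.
  by rewrite eqn_leq lij -subn_eq0 -(natr0 k0) -subSS natrB ?ltnS // ij subrr eqxx.
by rewrite eqn_leq lji andbT -subn_eq0 -(natr0 k0) -subSS natrB ?ltnS // ij subrr eqxx.
Qed.

(** The derivative at t = 1 of the Laurent polynomial obtained by moving the i-th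
    coordinate to t z_i depends only on the values of the function. *)
Lemma dsum_scalar_eq0 i (s : seq (degree * k^o)) :
  (forall z, laurent s z = 0) -> forall z, dsum i s z = 0.
Proof.
move=> s0 z.
pose N : nat := \sum_(p <- s) `|p.1 i|%N.
have eN p : p \in s -> (0 <= p.1 i + N%:Z)%R.
  move=> ps; rewrite -lerBlDr sub0r; apply: le_trans (_ : - `|p.1 i|%N%:Z <= _).
    by rewrite lerN2 lez_nat /N (big_rem p) //= leq_addr.
  by rewrite abszE lerNl -normrN ler_norm.
(* The factor t^N clears the negative powers of t; it adds N times the value to
   the derivative at 1. *)
pose P : {poly k} := \sum_(p <- s) (mono p.1 z * p.2) *: 'X^(absz (p.1 i + N%:Z)).
have P0 : P = 0.
  apply: poly_eq0_torus => t t0.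
  have yP : [forall j, [ffun j => if j == i then t * z j else z j] j != 0].
    by apply/forallP => j; rewrite ffunE; case: (eqVneq j i) => _; [apply: mulf_neq0 => //|]; apply: torus_neq0.
  transitivity (t ^+ N * laurent s (Torus yP) : k); last by rewrite s0 mulr0.
  rewrite horner_sum mulr_sumr !big_seq; apply: eq_bigr => p ps.
  rewrite hornerZ hornerXn.
  have -> : mono p.1 (Torus yP) = t ^ p.1 i * mono p.1 z.
    rewrite /mono (bigD1 i) //= [in RHS](bigD1 i) //= ffunE eqxx expfzMl -!mulrA.
    by congr (_ * (_ * _)); apply: eq_bigr => j ji; rewrite ffunE (negPf ji).
  have -> : t ^+ absz (p.1 i + N%:Z) = t ^ p.1 i * t ^+ N.
    by rewrite -[RHS]/(t ^ p.1 i * t ^ N%:Z) -expfzDr // -[in RHS](gez0_abs (eN _ ps)).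
  by rewrite -[_ *: _]/(_ * _); ring.
have := congr1 (fun Q => Q^`().[1]) P0; rewrite raddf_sum horner_sum deriv0 horner0.
have := congr1 (horner^~ 1) P0; rewrite horner_sum horner0 => e0 e1.
set S1 := \sum_(p <- s) _ in e1; set S0 := \sum_(p <- s) _ in e0.
transitivity (S1 - N%:R * S0 : k); last by rewrite e0 e1 mulr0 subrr.
rewrite /S0 /S1 mulr_sumr -sumrB /dsum !big_seq; apply: eq_bigr => p ps.
rewrite /= derivZ derivXn !hornerZ hornerMn !hornerXn !expr1n mulr1.
have -> : (1 *+ absz (p.1 i + N%:Z) : k) = (p.1 i)%:~R + N%:R.
  by rewrite pmulrn (gez0_abs (eN _ ps)) intrD -pmulrn.
by rewrite -[_ *: _]/(_ * _); ring.
Qed.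

Section Dlog.
Variable W : vectType k.
Implicit Types (s : seq (degree * W)) (f h : torus k n -> W).

Lemma dsum_eq0 i s : (forall z, laurent s z = 0) -> forall z, dsum i s z = 0.
Proof.
move=> s0 z; apply: v2r_inj; apply/rowP => j; rewrite linear0 mxE.
pose t : seq (degree * k^o) := [seq (p.1, v2r p.2 0 j) | p <- s].
have <- : dsum i t z = 0.
  apply: dsum_scalar_eq0 => y; rewrite /laurent big_map.
  have : v2r (laurent s y) 0 j = 0 by rewrite s0 linear0 mxE.
  rewrite /laurent linear_sum summxE => e; rewrite -[RHS]e.
  by apply: eq_bigr => p _; rewrite linearZ mxE.
rewrite linear_sum summxE /dsum big_map.
by apply: eq_bigr => p _; rewrite linearZ mxE.
Qed.

(** z_i d/dz_i, computed on an arbitrary Laurent expansion; by dsum_eq0 the choice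
    does not matter. Unlike d/dz_i it is invariant under translations of the
    torus, and it preserves the degrees of monomials. *)
Definition dlog i f z : W :=
  if pselect (regular_map f) is left h then dsum i (sval (cid h)) z else 0.

Lemma dlogE i f s z : (forall z, f z = laurent s z) -> dlog i f z = dsum i s z.
Proof.
move=> fs; rewrite /dlog; case: pselect => [h|[]]; last by exists s.
case: cid => t /= ft; have {}ft y : f y = laurent t y := ft y; apply/eqP; rewrite -subr_eq0 -[- dsum i s z]scaleN1r.
rewrite -dsum_scale -dsum_cat; apply/eqP/dsum_eq0 => y.
by rewrite laurent_cat laurent_scale -fs -ft scaleN1r subrr.
Qed.

Lemma regularP f : regular_map f -> exists s, forall z, f z = laurent s z.
Proof. by []. Qed.

Lemma regular_lin a f h : regular_map f -> regular_map h ->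
  regular_map (fun z => a *: f z + h z).
Proof.
move=> /regularP[s fs] /regularP[t ht]; exists (scale_terms a s ++ t) => z.
by rewrite fs ht -[RHS]/(laurent _ _) laurent_cat laurent_scale.
Qed.

Lemma dlog_lin i a f h z : regular_map f -> regular_map h ->
  dlog i (fun z => a *: f z + h z) z = a *: dlog i f z + dlog i h z.
Proof.
move=> /regularP[s fs] /regularP[t ht].
rewrite (dlogE i z fs) (dlogE i z ht) -dsum_scale -dsum_cat; apply: dlogE => y.
by rewrite fs ht laurent_cat laurent_scale.
Qed.

End Dlog.

Lemma laurent_lfun (W W' : vectType k) (u : 'Hom(W, W')) s z :
  u (laurent s z) = laurent [seq (p.1, u p.2) | p <- s] z.
Proof. by rewrite linear_sum /laurent big_map; apply: eq_bigr => p _; rewrite linearZ. Qed.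

Lemma regular_lfun (W W' : vectType k) (u : 'Hom(W, W')) f :
  regular_map f -> regular_map (fun z => u (f z)).
Proof.
move=> /regularP[s fs]; exists [seq (p.1, u p.2) | p <- s] => z.
by rewrite fs laurent_lfun.
Qed.

Lemma dlog_lfun (W W' : vectType k) (u : 'Hom(W, W')) i f z : regular_map f ->
  dlog i (fun y => u (f y)) z = u (dlog i f z).
Proof.
move=> /regularP[s fs]; rewrite (dlogE i z fs).
rewrite (@dlogE _ _ _ [seq (p.1, u p.2) | p <- s]) => [|y]; last first.
  by rewrite fs laurent_lfun.
by rewrite linear_sum /dsum big_map; apply: eq_bigr => p _; rewrite linearZ.
Qed.

Section Leibniz.
Variables (W1 W2 W : vectType k) (b : W1 -> W2 -> W).
Hypotheses (bl : forall w, linear (b^~ w)) (br : forall w, linear (b w)).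
Variables (f : torus k n -> W1) (h : torus k n -> W2).
Hypotheses (f_reg : regular_map f) (h_reg : regular_map h).

Let bL w : {linear W1 -> W} := HB.pack (b^~ w) (GRing.isLinear.Build k _ _ *:%R _ (bl w)).
Let bR w : {linear W2 -> W} := HB.pack (b w) (GRing.isLinear.Build k _ _ *:%R _ (br w)).

Let mul (p : degree * W1) (q : degree * W2) :=
  (p.1 + q.1, b p.2 q.2).

Let bE (s : seq (degree * W1)) (t : seq (degree * W2)) c e :
  b (\sum_(p <- s) c p *: p.2) (\sum_(q <- t) e q *: q.2) =
  \sum_(p <- s) \sum_(q <- t) (c p * e q) *: b p.2 q.2.
Proof.
rewrite -[LHS]/(bL _ _) linear_sum; apply: eq_bigr => p _; rewrite linearZ /=.
rewrite -[b _ _]/(bR _ _) linear_sum scaler_sumr; apply: eq_bigr => q _.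
by rewrite linearZ /= scalerA.
Qed.

Lemma bilinear_laurent s t z :
  b (laurent s z) (laurent t z) = laurent [seq mul p q | p <- s, q <- t] z.
Proof.
rewrite bE /laurent big_allpairs_dep; apply: eq_bigr => p _.
by apply: eq_bigr => q _; rewrite monoD.
Qed.

Lemma regular_bilinear : regular_map (fun z => b (f z) (h z)).
Proof.
have [s fs] := regularP f_reg; have [t ht] := regularP h_reg.
exists [seq mul p q | p <- s, q <- t] => z.
by rewrite fs ht; apply: bilinear_laurent.
Qed.

Lemma dlog_bilinear i z : dlog i (fun z => b (f z) (h z)) z =
  b (dlog i f z) (h z) + b (f z) (dlog i h z).
Proof.
have [s fs] := regularP f_reg; have [t ht] := regularP h_reg.
rewrite (dlogE i z fs) (dlogE i z ht) fs ht !bE -big_split.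
rewrite (@dlogE _ _ _ [seq mul p q | p <- s, q <- t]) => [|y]; last first.
  by rewrite fs ht; apply: bilinear_laurent.
rewrite /dsum big_allpairs_dep; apply: eq_bigr => p _ /=; rewrite -big_split.
apply: eq_bigr => q _ /=; rewrite -scalerDl monoD ffunE intrD; congr (_ *: _).
ring.
Qed.

End Leibniz.

End Torus.

(** * Invariant functions vanishing to second order *)

Section Invariants.
Variables (k : fieldType) (n : nat) (m : 'I_n -> nat) (xi : torus k n).
Hypothesis k0 : [pchar k] =i pred0.
Hypothesis m_gt0 : forall i, (0 < m i)%N.
Hypothesis xi_prim : forall i, (m i).-primitive_root (xi i).
Implicit Types (z x : torus k n) (P Q R : torus k n -> k^o) (e : Gamma m).
Local Notation degree := {ffun 'I_n -> int}.

Definition gamma_char e (d : degree) : k := \prod_(i < n) (xi i ^+ e i) ^ d i.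

Lemma mono_gamma d e z : mono d (gamma_torus xi e z) = gamma_char e d * mono d z.
Proof.
rewrite -big_split; apply: eq_bigr => i _ /=.
by rewrite ffunE expfzMl.
Qed.

Lemma gamma_char_eq1 e (d : degree) : (forall i, xi i ^ d i = 1) -> gamma_char e d = 1.
Proof.
by move=> d1; apply: big1 => i _; rewrite exprnP exprz_exp mulrC -exprz_exp d1 exp1rz.
Qed.

Definition gamma_one i (t : 'I_(m i)) : Gamma m :=
  [ffun j => Ordinal (ltn_pmod (if j == i then t : nat else 0%N) (m_gt0 j))].

Lemma gamma_char_one i t d : gamma_char (@gamma_one i t) d = (xi i ^ d i) ^+ t.
Proof.
rewrite /gamma_char (bigD1 i) //= big1 => [|j ji]; last first.
  by rewrite ffunE /= (negPf ji) mod0n expr0 exp1rz.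
by rewrite mulr1 ffunE /= eqxx modn_small // !exprnP !exprz_exp mulrC.
Qed.

(** If all z_i / x_i are m_i-th roots of unity, they are powers of the xi_i. *)
Lemma separating_coordinate x z : (forall e, gamma_torus xi e x <> z) ->
  exists i, x i ^+ m i <> z i ^+ m i.
Proof.
move=> xz; apply: contrapT => nex.
have r i : (z i / x i) ^+ m i = 1.
  rewrite expr_div_n; have -> : z i ^+ m i = x i ^+ m i.
    by apply: contrapT => ne; apply: nex; exists i => h; apply: ne.
  by rewrite divff // expf_neq0 // torus_neq0.
pose e : Gamma m := [ffun i => sval (prim_rootP (xi_prim i) (r i))].
apply: (xz e); apply: torusP => i; rewrite /= !ffunE.
by case: prim_rootP => t /= <-; rewrite divfK // torus_neq0.
Qed.

Definition inv_fun P := regular_map P /\ forall e z, P (gamma_torus xi e z) = P z.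

Lemma inv_const c : inv_fun (fun=> c).
Proof.
split=> //; exists [:: (0, c)] => z.
by rewrite big_seq1 -[X in X *: _]/(mono 0 z) mono0 scale1r.
Qed.

Lemma inv_mul P Q : inv_fun P -> inv_fun Q -> inv_fun (fun z => P z * Q z).
Proof.
move=> [Pr Pi] [Qr Qi]; split=> [|e z]; last by rewrite Pi Qi.
apply: (@regular_bilinear _ _ k^o k^o k^o (fun u v => u * v)) => // [w a u v|w a u v].
  by rewrite mulrDl -scalerAl.
by rewrite mulrDr -scalerAr.
Qed.

Lemma inv_lin a P Q : inv_fun P -> inv_fun Q -> inv_fun (fun z => a * P z + Q z).
Proof.
move=> [Pr Pi] [Qr Qi]; split=> [|e z]; last by rewrite Pi Qi.
exact: (@regular_lin k n k^o a P Q Pr Qr).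
Qed.

Lemma inv_add P Q : inv_fun P -> inv_fun Q -> inv_fun (fun z => P z + Q z).
Proof.
by move=> Pi /(inv_lin 1 Pi); congr inv_fun; apply/funext => z; rewrite mul1r.
Qed.

Lemma inv_sub P Q : inv_fun P -> inv_fun Q -> inv_fun (fun z => P z - Q z).
Proof.
move=> Pi Qi; have := inv_lin (-1) Qi Pi; congr inv_fun; apply/funext => z.
by rewrite mulN1r addrC.
Qed.

Lemma inv_sum I (r : seq I) (F : I -> torus k n -> k^o) :
  (forall i, inv_fun (F i)) -> inv_fun (fun z => \sum_(i <- r) F i z).
Proof.
move=> Fi; elim: r => [|i r IH].
  by under eq_fun do rewrite big_nil; apply: inv_const.
by under eq_fun do rewrite big_cons; apply: inv_add.
Qed.

Lemma inv_prod I (r : seq I) (F : I -> torus k n -> k^o) :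
  (forall i, inv_fun (F i)) -> inv_fun (fun z => \prod_(i <- r) F i z).
Proof.
move=> Fi; elim: r => [|i r IH].
  by under eq_fun do rewrite big_nil; apply: inv_const.
by under eq_fun do rewrite big_cons; apply: inv_mul.
Qed.

Lemma inv_mono (d : degree) : (forall i, xi i ^ d i = 1) -> inv_fun (mono d).
Proof.
move=> d1; split=> [|e z]; last by rewrite mono_gamma gamma_char_eq1 ?mul1r.
by exists [:: (d, 1)] => z; rewrite big_seq1 -[_ *: _]/(_ * 1) mulr1.
Qed.

Lemma dlog_mul i P Q z : inv_fun P -> inv_fun Q ->
  dlog i (fun z => P z * Q z) z = dlog i P z * Q z + P z * dlog i Q z.
Proof.
move=> [Pr _] [Qr _].
apply: (@dlog_bilinear _ _ k0 k^o k^o k^o (fun u v => u * v)) => // [w a u v|w a u v].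
  by rewrite mulrDl -scalerAl.
by rewrite mulrDr -scalerAr.
Qed.

Lemma dlog_inv_lin i a P Q z : inv_fun P -> inv_fun Q ->
  dlog i (fun z => a * P z + Q z) z = a * dlog i P z + dlog i Q z.
Proof. by move=> [Pr _] [Qr _]; apply: (dlog_lin k0 i a z Pr Qr). Qed.

Lemma dlog_const i c z : dlog i (fun=> c : k^o) z = 0.
Proof.
rewrite (@dlogE k n k0 k^o i _ [:: (0, c)]) => [|y].
  by rewrite /dsum big_seq1 ffunE mul0r scale0r.
by rewrite /laurent big_seq1 mono0 scale1r.
Qed.

Lemma dlog_sum i I (r : seq I) (F : I -> torus k n -> k^o) z :
  (forall j, inv_fun (F j)) ->
  dlog i (fun z => \sum_(j <- r) F j z) z = \sum_(j <- r) dlog i (F j) z.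
Proof.
move=> Fi; elim: r => [|j r IH].
  by under eq_fun do rewrite big_nil; rewrite big_nil dlog_const.
have -> : (fun z => \sum_(l <- j :: r) F l z) =
    fun z => 1 * F j z + \sum_(l <- r) F l z.
  by apply/funext => y; rewrite big_cons mul1r.
by rewrite dlog_inv_lin ?IH ?big_cons ?mul1r //; apply: inv_sum.
Qed.

Lemma dlog_mono i (d : degree) z : dlog i (mono d : torus k n -> k^o) z = (d i)%:~R * mono d z.
Proof.
rewrite (@dlogE k n k0 k^o i _ [:: (d, 1)]) => [|y].
  by rewrite /dsum big_seq1 -[_ *: _]/(_ * _) mulr1.
by rewrite /laurent big_seq1 -[_ *: _]/(_ * _) mulr1.
Qed.

(** Averaging over the i-th factor of the group kills the monomials that it does
    not fix. *)
Lemma inv_laurent P : inv_fun P -> exists s : seq (degree * k^o),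
  (forall z, P z = laurent s z) /\
  forall p, p \in s -> forall i, xi i ^ p.1 i = 1.
Proof.
move=> [/regularP[s0 s0E] Pi].
suff /(_ (enum 'I_n)) [s [sE s1]] : forall r : seq 'I_n, exists s : seq (degree * k^o),
    (forall z, P z = laurent s z) /\
    forall p, p \in s -> forall i, i \in r -> xi i ^ p.1 i = 1.
  by exists s; split=> // p ps i; apply: s1; rewrite ?mem_enum.
elim=> [|i r [s [sE s1]]]; first by exists s0.
exists [seq p : degree * k^o <- s | xi i ^ p.1 i == 1]; split=> [z|p]; last first.
  rewrite mem_filter => /andP[/eqP pi ps] j; rewrite inE => /orP[/eqP -> //|].
  exact: s1.
have mn0 : (m i)%:R != 0 :> k by rewrite natr0 // -lt0n.
apply: (mulfI mn0).
transitivity (\sum_(t < m i) P (gamma_torus xi (gamma_one t) z)).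
  under eq_bigr do rewrite Pi.
  by rewrite sumr_const card_ord mulr_natl.
under eq_bigr do rewrite sE.
rewrite exchange_big /= /laurent big_filter mulr_sumr [in RHS]big_mkcond.
apply: eq_bigr => p _.
transitivity ((\sum_(t < m i) (xi i ^ p.1 i) ^+ t) * (mono p.1 z * p.2)).
  rewrite mulr_suml; apply: eq_bigr => t _.
  by rewrite mono_gamma gamma_char_one -[_ *: _]/(_ * _) mulrA.
case: eqP => [->|ne].
  under eq_bigr do rewrite expr1n.
  by rewrite sumr_const card_ord.
apply/eqP; rewrite mulf_eq0; apply/orP; left.
have : (xi i ^ p.1 i - 1) * (\sum_(t < m i) (xi i ^ p.1 i) ^+ t) = 0.
  rewrite -subrX1 exprnP exprz_exp mulrC -exprz_exp -exprnP.
  by rewrite (prim_expr_order (xi_prim i)) exp1rz subrr.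
by move/eqP; rewrite mulf_eq0 subr_eq0 => /orP[/eqP|].
Qed.

(** The square of the ideal of the invariant functions vanishing on Z. *)
Inductive second_order (Z : torus k n -> Prop) : (torus k n -> k^o) -> Prop :=
| SecondOrderM P Q of inv_fun P & inv_fun Q & (forall z, Z z -> P z = 0) &
    (forall z, Z z -> Q z = 0) : second_order Z (fun z => P z * Q z)
| SecondOrderD P Q of second_order Z P & second_order Z Q :
    second_order Z (fun z => P z + Q z).

Section SecondOrder.
Variable Z : torus k n -> Prop.
Implicit Types (i j : 'I_n).

Lemma second_order_ext P Q : (forall z, P z = Q z) -> second_order Z P -> second_order Z Q.
Proof. by move=> /funext ->. Qed.

Lemma second_order0 : second_order Z (fun=> 0).
Proof.
apply: (second_order_ext (P := fun=> 0 * 0)) => [z|]; first by rewrite mul0r.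
by apply: SecondOrderM => //; apply: inv_const.
Qed.

Lemma second_order_inv P : second_order Z P -> inv_fun P.
Proof. by elim=> [*|*]; [apply: inv_mul | apply: inv_add]. Qed.

Lemma second_order_mul R P : inv_fun R -> second_order Z P ->
  second_order Z (fun z => R z * P z).
Proof.
move=> Ri; elim=> [{}P Q Pi Qi P0 Q0|{}P Q _ IP _ IQ].
  apply: (second_order_ext (P := fun z => (R z * P z) * Q z)) => [z|]; first by rewrite mulrA.
  apply: SecondOrderM => //; first exact: inv_mul.
  by move=> z /P0 ->; rewrite mulr0.
apply: (second_order_ext (P := fun z => R z * P z + R z * Q z)) => [z|].
  by rewrite mulrDr.
exact: SecondOrderD.
Qed.

Lemma second_order_vanish P : second_order Z P ->
  forall z, Z z -> P z = 0 /\ forall i, dlog i P z = 0.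
Proof.
move=> + z Zz; elim=> [{}P Q Pi Qi P0 Q0|{}P Q Pi [P0 dP] Qi [Q0 dQ]].
  split=> [|i]; first by rewrite P0 // mul0r.
  by rewrite dlog_mul // P0 // Q0 // mulr0 mul0r addr0.
split=> [|i]; first by rewrite P0 Q0 addr0.
have -> : (fun z => P z + Q z) = (fun z => 1 * P z + Q z).
  by apply/funext => y; rewrite mul1r.
by rewrite dlog_inv_lin ?dP ?dQ ?mulr0 ?addr0 //; apply: second_order_inv.
Qed.

End SecondOrder.

Section Taylor.
Variable x : torus k n.
Implicit Types (i j : 'I_n) (c : k).

(** The degrees of the powers of z_i^(m_i), a coordinate of the quotient torus. *)
Definition wdeg i (q : int) : degree := [ffun j => if j == i then (m i)%:Z * q else 0].

Lemma mono_wdeg i q z : mono (wdeg i q) z = (z i ^+ m i) ^ q.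
Proof.
rewrite /mono (bigD1 i) //= big1 => [|j ji]; last by rewrite ffunE (negPf ji).
by rewrite mulr1 ffunE eqxx -exprz_exp.
Qed.

Lemma inv_wdeg i q : inv_fun (mono (wdeg i q)).
Proof.
apply: inv_mono => j; rewrite ffunE; case: eqP => [->|_]; last by rewrite expr0z.
by rewrite -exprz_exp -exprnP (prim_expr_order (xi_prim i)) exp1rz.
Qed.

(** Local coordinates at the image of x in the quotient torus. *)
Definition uniformizer i z : k^o := mono (wdeg i 1) z / mono (wdeg i 1) x - 1.

Lemma uniformizerE i : uniformizer i =
  (fun z => (mono (wdeg i 1) x)^-1 * mono (wdeg i 1) z + -1).
Proof. by apply/funext => z; rewrite /uniformizer mulrC. Qed.

Lemma inv_uniformizer i : inv_fun (uniformizer i).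
Proof. rewrite uniformizerE; apply: inv_lin (inv_wdeg _ _) (inv_const _). Qed.

Lemma uniformizer_x i : uniformizer i x = 0.
Proof. by rewrite /uniformizer divff ?mono_neq0 // subrr. Qed.

Lemma dlog_uniformizer i j : dlog j (uniformizer i) x = (j == i)%:R * (m i)%:R.
Proof.
rewrite uniformizerE dlog_inv_lin; [|exact: inv_wdeg|exact: inv_const].
rewrite dlog_const addr0 dlog_mono mulrC mulfK ?mono_neq0 // ffunE.
by case: eqP => _; rewrite ?mulr1 ?mul1r ?mul0r // -pmulrn.
Qed.

Definition linear_part c (a : 'I_n -> k) z : k^o := c + \sum_i a i * uniformizer i z.

Lemma inv_linear_part c a : inv_fun (linear_part c a).
Proof.
apply: inv_add; first exact: inv_const.
by apply: inv_sum => i; apply: inv_mul; [apply: inv_const | apply: inv_uniformizer].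
Qed.

Definition has_taylor P := inv_fun P /\ exists c a,
  second_order (eq x) (fun z => P z - linear_part c a z).

Lemma linear_partD c a c' a' z : linear_part (c + c') (fun i => a i + a' i) z =
  linear_part c a z + linear_part c' a' z.
Proof.
rewrite /linear_part addrACA -big_split; congr (_ + _).
by apply: eq_bigr => i _; rewrite mulrDl.
Qed.

Lemma linear_part0 c z : linear_part c (fun=> 0) z = c.
Proof. by rewrite /linear_part big1 ?addr0 // => i _; rewrite mul0r. Qed.

Lemma taylor_const c : has_taylor (fun=> c).
Proof.
split; first exact: inv_const.
exists c, (fun=> 0); apply: second_order_ext (second_order0 _) => z.
by rewrite linear_part0 subrr.
Qed.

Lemma taylor_add P Q : has_taylor P -> has_taylor Q -> has_taylor (fun z => P z + Q z).
Proof.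
move=> [Pi [c [a Pa]]] [Qi [c' [a' Qa]]]; split; first exact: inv_add.
exists (c + c'), (fun i => a i + a' i); apply: second_order_ext (SecondOrderD Pa Qa) => z.
by rewrite linear_partD; ring.
Qed.

Lemma taylor_mul P Q : has_taylor P -> has_taylor Q -> has_taylor (fun z => P z * Q z).
Proof.
move=> [Pi [c [a Pa]]] [Qi [c' [a' Qa]]]; split; first exact: inv_mul.
exists (c * c'), (fun i => c * a' i + c' * a i).
pose u b z : k^o := \sum_i b i * uniformizer i z.
have ui b : inv_fun (u b).
  by apply: inv_sum => i; apply: inv_mul; [apply: inv_const | apply: inv_uniformizer].
have ux b z : x = z -> u b z = 0.
  by move=> <-; rewrite /u big1 // => i _; rewrite uniformizer_x mulr0.
have Li := inv_linear_part c a.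
(* P Q - L L' = Q (P - L) + L (Q - L'), and the quadratic part of L L' is the
   product of the linear forms u a and u a'. *)
have so1 := second_order_mul Qi Pa; have so2 := second_order_mul Li Qa.
apply: second_order_ext (SecondOrderD (SecondOrderD so1 so2)
  (SecondOrderM (ui a) (ui a') (@ux a) (@ux a'))) => z.
have -> : linear_part (c * c') (fun i => c * a' i + c' * a i) z =
    c * c' + c * u a' z + c' * u a z.
  rewrite /linear_part -addrA; congr (_ + _); rewrite /u !mulr_sumr -big_split.
  by apply: eq_bigr => i _ /=; rewrite mulrDl !mulrA.
by rewrite /linear_part -!/(u _ z); ring.
Qed.

Lemma taylor_prod I (r : seq I) (F : I -> torus k n -> k^o) :
  (forall l, has_taylor (F l)) -> has_taylor (fun z => \prod_(l <- r) F l z).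
Proof.
move=> Fi; elim: r => [|i r IH].
  by under eq_fun do rewrite big_nil; apply: taylor_const.
by under eq_fun do rewrite big_cons; apply: taylor_mul.
Qed.

(** With u the uniformizer and w = 1 + u the normalized coordinate, w^-1 is
    1 - u + w^-1 u^2; the other powers of w are products of these. *)
Lemma taylor_wdeg i q : has_taylor (mono (wdeg i q)).
Proof.
have lin1 b z : linear_part 1 (fun j => if j == i then b else 0) z = 1 + b * uniformizer i z.
  rewrite /linear_part (bigD1 i) //= eqxx big1 ?addr0 // => j ji.
  by rewrite (negPf ji) mul0r.
have wx0 := mono_neq0 (wdeg i 1) x.
have pos : has_taylor (fun z => (mono (wdeg i 1) x)^-1 * mono (wdeg i 1) z).
  split; first by apply: inv_mul; [apply: inv_const | apply: inv_wdeg].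
  exists 1, (fun j => if j == i then 1 else 0).
  apply: second_order_ext (second_order0 _) => z.
  by rewrite lin1 /uniformizer mulrC; ring.
have neg : has_taylor (fun z => mono (wdeg i 1) x * mono (wdeg i (-1)) z).
  have iW : inv_fun (fun z => mono (wdeg i 1) x * mono (wdeg i (-1)) z).
    by apply: inv_mul; [apply: inv_const | apply: inv_wdeg].
  split=> //; exists 1, (fun j => if j == i then -1 else 0).
  have u0 z : x = z -> uniformizer i z = 0 by move=> <-; apply: uniformizer_x.
  have iu := inv_uniformizer i.
  apply: second_order_ext (second_order_mul iW (SecondOrderM iu iu u0 u0)) => z.
  rewrite lin1 /uniformizer; have wz0 := mono_neq0 (wdeg i 1) z.
  have -> : mono (wdeg i (-1)) z = (mono (wdeg i 1) z)^-1 by rewrite !mono_wdeg exprN1.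
  by field; rewrite wx0 wz0.
have gen (b : k) (s : int) q' : b != 0 -> has_taylor (fun z => b * mono (wdeg i s) z) ->
    has_taylor (fun z => b ^+ q' * mono (wdeg i (s * q'%:Z)) z).
  move=> b0 bs; elim: q' => [|q' IH].
    have -> : (fun z => b ^+ 0 * mono (wdeg i (s * 0%:Z)) z) = fun=> 1; last exact: taylor_const.
    by apply/funext => z; rewrite mulr0 mono_wdeg !expr0z mulr1.
  have := taylor_mul bs IH; congr has_taylor; apply/funext => z.
  by rewrite !mono_wdeg exprS intS mulrDr mulr1 expfzDr ?expf_neq0 ?torus_neq0 //; ring.
have sc b P : b != 0 -> has_taylor (fun z => b * P z) -> has_taylor P.
  move=> b0 /(taylor_mul (taylor_const b^-1)); congr has_taylor.
  by apply/funext => z; rewrite mulKf.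
case: q => q.
  have := gen _ _ q _ pos; rewrite mul1r => h.
  by apply: sc (h _); rewrite ?expf_neq0 ?invr_neq0.
have := gen _ _ q.+1 _ neg; rewrite mulN1r -NegzE => h.
by apply: sc (h _); rewrite ?expf_neq0 ?invr_neq0.
Qed.

Lemma taylor_mono (d : degree) : (forall i, xi i ^ d i = 1) -> has_taylor (mono d).
Proof.
move=> d1; have dE i : exists q : int, d i = (m i)%:Z * q.
  have nat_case (t : nat) : xi i ^+ t = 1 -> exists q : nat, t = (m i * q)%N.
    by move=> /eqP; rewrite -(prim_order_dvd (xi_prim i)) => /dvdnP[q ->]; exists q; rewrite mulnC.
  have := d1 i; case: (d i) => t.
    by move=> /nat_case[q ->]; exists q%:Z; rewrite PoszM.
  rewrite NegzE -exprnN => /(congr1 GRing.inv); rewrite invrK invr1 => /nat_case[q ->].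
  by exists (- q%:Z); rewrite PoszM mulrN.
have /choice[q qE] := dE.
have := taylor_prod (index_enum 'I_n) (fun i => taylor_wdeg i (q i)).
congr has_taylor; apply/funext => z; apply: eq_bigr => i _.
by rewrite mono_wdeg exprnP exprz_exp -qE.
Qed.

(** Invariant functions are Laurent polynomials in the coordinates z_i^(m_i) of the
    quotient torus, so have a Taylor expansion to first order there; the value
    and the derivatives at x determine its linear part, the m_i being nonzero
    in k. *)
Lemma second_order_at P : inv_fun P -> P x = 0 -> (forall i, dlog i P x = 0) ->
  second_order (eq x) P.
Proof.
move=> Pi P0 dP; have [s [sE s1]] := inv_laurent Pi.
have [_ [c [a so]]] : has_taylor P.
  have -> : P = laurent s by apply/funext.
  elim: s s1 {sE} => [|p s IH] s1.
    have -> : laurent [::] = (fun=> 0) :> (torus k n -> k^o); last exact: taylor_const.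
    by apply/funext => z; apply: big_nil.
  have -> : laurent (p :: s) = (fun z => p.2 * mono p.1 z + laurent s z).
    by apply/funext => z; rewrite /laurent big_cons -[_ *: _]/(_ * _) mulrC.
  apply: taylor_add; last by apply: IH => q qs; apply: s1; rewrite inE qs orbT.
  apply: taylor_mul (taylor_const _) (taylor_mono _).
  by apply: s1; rewrite mem_head.
have [v0 dv0] := second_order_vanish so (erefl x).
have c0 : c = 0.
  move: v0; rewrite P0 sub0r /linear_part big1 ?addr0 => [/eqP|i _].
    by rewrite oppr_eq0 => /eqP.
  by rewrite uniformizer_x mulr0.
have a0 i : a i = 0.
  have := dv0 i; have -> : (fun z => P z - linear_part c a z) =
      fun z => -1 * linear_part c a z + P z.
    by apply/funext => z; rewrite mulN1r addrC.
  rewrite dlog_inv_lin ?dP //; last exact: inv_linear_part.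
  rewrite addr0 mulN1r => /eqP; rewrite oppr_eq0.
  have -> : linear_part c a = fun z => 1 * c + \sum_j a j * uniformizer j z.
    by apply/funext => z; rewrite mul1r.
  rewrite (dlog_inv_lin i 1 x (inv_const c)); last first.
    by apply: inv_sum => j; apply: inv_mul; [apply: inv_const | apply: inv_uniformizer].
  rewrite dlog_const mulr0 add0r dlog_sum; last first.
    by move=> j; apply: inv_mul; [apply: inv_const | apply: inv_uniformizer].
  rewrite (bigD1 i) //= big1 => [|j ji]; rewrite dlog_mul ?dlog_const ?mul0r ?add0r ?dlog_uniformizer;
    try exact: inv_const; try exact: inv_uniformizer.
    by rewrite addr0 eqxx mul1r mulf_eq0 natr0 // eqn0Ngt m_gt0 orbF => /eqP.
  by rewrite eq_sym (negPf ji) mul0r mulr0.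
apply: second_order_ext so => z; rewrite c0 /linear_part big1 ?addr0 ?subr0 // => i _.
by rewrite a0 mul0r.
Qed.

End Taylor.

(** Interpolation by products of invariant functions z_i^(m_i) - y_i^(m_i), one for
    each other point y. *)
Lemma bump_functions (s : seq (torus k n)) :
  (forall x y, x \in s -> y \in s -> x != y -> forall e, gamma_torus xi e x <> y) ->
  exists b : torus k n -> torus k n -> k^o, forall x, x \in s ->
    [/\ inv_fun (b x), b x x = 1 & forall y, y \in s -> y != x -> b x y = 0].
Proof.
move=> sep; suff /choice[b bP] x : exists P, x \in s ->
    [/\ inv_fun P, P x = 1 & forall y, y \in s -> y != x -> P y = 0].
  by exists b => x; apply: bP.
have [xs|_] := boolP (x \in s); last by exists (fun=> 0).
have /choice[F FP] y : exists P, [/\ inv_fun P, P x = 1 &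
    y \in s -> y != x -> P y = 0].
  have [/andP[ys yx]|] := boolP ((y \in s) && (y != x)); last first.
    rewrite negb_and => h; exists (fun=> 1); split=> // [|ys yx].
      exact: inv_const.
    by move: h; rewrite ys yx.
  have [|i xy] := @separating_coordinate x y; first by apply: sep; rewrite // eq_sym.
  have d0 : x i ^+ m i - y i ^+ m i != 0 by rewrite subr_eq0; apply/eqP.
  exists (fun z => (x i ^+ m i - y i ^+ m i)^-1 * (mono (wdeg i 1) z - y i ^+ m i)).
  split=> [||_ _].
  - apply: inv_mul; first exact: inv_const.
    by apply: inv_sub; [apply: inv_wdeg | apply: inv_const].
  - by rewrite mono_wdeg expr1z mulVf.
  by rewrite mono_wdeg expr1z subrr mulr0.
exists (fun z => \prod_(y <- s) F y z) => _; split=> [||y ys yx].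
- by apply: inv_prod => y; case: (FP y).
- by apply: big1 => y _; case: (FP y).
have [_ _ Fy0] := FP y.
by rewrite (big_rem y) //= Fy0 ?mul0r.
Qed.

(** With P_x the bump functions of the points x of s and S the sum of the P_x^2,
    the identity 1 = (1 - S)^2 + S (2 - S) localizes the problem: 1 - S vanishes
    on s, and P_x^2 turns the ideal of x into that of s. *)
Lemma second_order_on (s : seq (torus k n)) P : uniq s ->
  (forall x y, x \in s -> y \in s -> x != y -> forall e, gamma_torus xi e x <> y) ->
  inv_fun P -> (forall x, x \in s -> P x = 0 /\ forall i, dlog i P x = 0) ->
  second_order (fun x => x \in s) P.
Proof.
move=> us sep Pi P0; have [b bP] := bump_functions sep.
pose b' x := if x \in s then b x else (fun=> 0).
have b'i x : inv_fun (b' x).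
  by rewrite /b'; case: ifP => [/bP[]//|_]; apply: inv_const.
pose S z : k^o := \sum_(x <- s) b' x z * b' x z.
have Si : inv_fun S by apply: inv_sum => x; apply: inv_mul.
have S1 z : z \in s -> 1 - S z = 0.
  move=> zs; rewrite /S (bigD1_seq z) //= /b' zs big1_seq => [|y /andP[yz ys]].
    by have [_ -> _] := bP z zs; rewrite mulr1 addr0 subrr.
  by rewrite ys; have [_ _ ->] := bP y ys; rewrite ?mul0r // eq_sym.
have iS : inv_fun (fun z => 1 - S z) by apply: inv_sub => //; apply: inv_const.
have far : second_order (fun x => x \in s) (fun z => (1 - S z) * ((1 - S z) * P z)).
  apply: SecondOrderM => //; first exact: inv_mul.
  by move=> z /S1 ->; rewrite mul0r.
have near x : second_order (fun x => x \in s)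
    (fun z => (b' x z * b' x z) * ((2 - S z) * P z)).
  have [xs|xs] := boolP (x \in s); last first.
    apply: second_order_ext (second_order0 _) => z.
    by rewrite /b' (negPf xs) !mul0r.
  have [_ bx0] : b x x = 1 /\ forall y, y \in s -> y != x -> b x y = 0 by case: (bP x xs).
  have [Px dPx] := P0 x xs.
  have := second_order_at Pi Px dPx; elim=> [Q R Qi Ri Q0 R0|Q R _ IQ _ IR].
    have van F : (forall z, x = z -> F z = 0) -> forall z, z \in s -> b' x z * F z = 0.
      move=> F0 z zs; have [->|zx] := eqVneq z x; first by rewrite F0 ?mulr0.
      by rewrite /b' xs bx0 ?mul0r.
    apply: (second_order_ext (P := fun z => (b' x z * Q z) * ((2 - S z) * (b' x z * R z)))) => [z|].
      by ring.
    apply: SecondOrderM; [exact: inv_mul| |exact: van|].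
      by apply: inv_mul; [apply: inv_sub => //; apply: inv_const | apply: inv_mul].
    by move=> z zs; rewrite van ?mulr0.
  by apply: second_order_ext (SecondOrderD IQ IR) => z; ring.
have sumD (r : seq (torus k n)) : second_order (fun x => x \in s)
    (fun z => \sum_(x <- r) (b' x z * b' x z) * ((2 - S z) * P z)).
  elim: r => [|x r IH].
    by apply: second_order_ext (second_order0 _) => z; rewrite big_nil.
  by apply: second_order_ext (SecondOrderD (near x) IH) => z; rewrite big_cons.
apply: second_order_ext (SecondOrderD far (sumD s)) => z.
by rewrite -mulr_suml -/(S z); ring.
Qed.

End Invariants.

(** * Multiloop algebras as modules over the invariant functions *)

Lemma finite_order_diagonalizable (F : fieldType) n (A : 'M[F]_n) m (z : F) :
  m.-primitive_root z -> A ^+ m = 1 -> diagonalizable A.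
Proof.
case: n A => [|n] A zp Am.
  by exists 1%:M; [apply: unitmx1 | apply/is_diag_mxP => -[]].
apply/diagonalizableP; exists [seq z ^+ i | i <- index_iota 0 m].
  rewrite map_inj_in_uniq ?iota_uniq // => i j.
  rewrite !mem_index_iota /= => im jm /eqP.
  by rewrite (eq_prim_root_expr zp) !modn_small // => /eqP.
rewrite big_map (factor_Xn_sub_1 zp); apply: mxminpoly_min.
by rewrite rmorphB rmorphXn rmorph1 /= horner_mx_X Am subrr.
Qed.

Section Multiloop.
Variables (k : closedFieldType) (n : nat) (m : 'I_n -> nat) (g : fdLieAlgType k).
Variables (sigma : 'I_n -> lie_aut g) (xi : torus k n).
Hypothesis k0 : [pchar k] =i pred0.
Hypothesis m_gt0 : forall i, (0 < m i)%N.
Hypothesis gss : semisimple g.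
Hypothesis sigma_comm : forall (i j : 'I_n) (a : g),
  sigma i (sigma j a) = sigma j (sigma i a).
Hypothesis sigma_order : forall (i : 'I_n) (a : g), iter (m i) (sigma i) a = a.
Hypothesis xi_prim : forall i, (m i).-primitive_root (xi i).
Local Notation degree := {ffun 'I_n -> int}.
Local Notation M := (multiloop m sigma xi).
Local Notation inv_fun := (@inv_fun k n m xi).
Implicit Types (e : Gamma m) (x y z : torus k n) (f h : M) (v w : g).

(** The sigma_i commute and are diagonalizable, as their orders are invertible in
    k; their eigenvalues are powers of the xi_i. *)
Lemma eigenbasis : exists (b : 'I_(dim g) -> g) (c : 'I_(dim g) -> 'Hom(g, k^o))
    (d : 'I_(dim g) -> degree),
  [/\ forall v, v = \sum_j c j v *: b j, forall i j, c i (b j) = (i == j)%:R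
    & forall i j, sigma i (b j) = xi i ^ d j i *: b j].
Proof.
pose A i := f2mx (lie_aut_fun (sigma i)).
have AE i v : v2r (sigma i v) = v2r v *m A i by apply: v2r_lfun.
have [|P Pu PA] := (codiagonalizableP [seq A i | i <- enum 'I_n]).1.
- split=> [_ _ /mapP[i _ ->] /mapP[j _ ->]|_ /mapP[i _ ->]].
    by apply: v2r_mx_inj => v; rewrite !mulmxA -!AE sigma_comm.
  apply: (finite_order_diagonalizable (xi_prim i)).
  apply: v2r_mx_inj => v; rewrite mulmx1 -[in RHS](sigma_order i v).
  elim: (m i) => [|l IH]; first by rewrite expr0 mulmx1.
  by rewrite exprSr mulmxA IH /= AE.
have eig i j : exists e : nat, row j P *m A i = xi i ^+ e *: row j P.
  have /allP/(_ (A i)) := PA; rewrite map_f ?mem_enum // => /(_ isT).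
  move=> /diagonalizable_forPex[D /simmxPp]; rewrite stablemx_unit // => /(_ isT) PAD.
  have rE : row j P *m A i = D 0 j *: row j P.
    by rewrite -row_mul PAD row_mul row_diag_mx -scalemxAl -rowE.
  have rn0 : row j P != 0.
    apply/eqP => r0; have := row_free_unit P; rewrite Pu => /row_freeP[Q /(congr1 (row j))].
    rewrite row_mul r0 mul0mx row1 => /rowP/(_ j); rewrite !mxE !eqxx /= => /esym/eqP.
    by rewrite oner_eq0.
  have : D 0 j ^+ m i = 1.
    have rp l : row j P *m A i ^+ l = D 0 j ^+ l *: row j P.
      elim: l => [|l IH]; first by rewrite !expr0 mulmx1 scale1r.
      by rewrite exprSr mulmxA IH -scalemxAl rE scalerA exprSr.
    have : row j P *m A i ^+ m i = row j P.
      rewrite -[row j P]r2vK; move: (r2v _) => v; rewrite -[in RHS](sigma_order i v).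
      elim: (m i) => [|l IH]; first by rewrite expr0 mulmx1.
      by rewrite exprSr mulmxA IH /= AE.
    rewrite rp => /eqP; rewrite -subr_eq0 -[X in _ - X]scale1r -scalerBl scaler_eq0.
    by rewrite (negPf rn0) orbF subr_eq0 => /eqP.
  by move=> /(prim_rootP (xi_prim i))[e De]; exists e; rewrite rE De.
have /choice[e eP] j : exists e : degree, forall i, row j P *m A i = xi i ^ e i *: row j P.
  have /choice[e eE] := eig ^~ j; exists [ffun i => (e i)%:Z] => i.
  by rewrite eE ffunE.
pose c j v : k^o := (v2r v *m invmx P) 0 j.
have c_lin j : linear (c j).
  by move=> t u v; rewrite /c linearP /= mulmxDl -scalemxAl !mxE.
pose C j := sval (mk_lfun (c_lin j)); have CE j : C j =1 c j := svalP (mk_lfun (c_lin j)).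
clearbody C.
exists (fun j => r2v (row j P)), C, e; split=> [v|i j|i j].
- apply: v2r_inj; rewrite linear_sum -[v2r v](mulmxKV Pu) mulmx_sum_row.
  by apply: eq_bigr => j _; rewrite linearZ /= r2vK CE.
- by rewrite CE /c r2vK -row_mul mulmxV // rowE mulmx1 !mxE eqxx eq_sym.
by apply: v2r_inj; rewrite AE linearZ /= r2vK.
Qed.

Lemma multiloop_regular f : regular_map f.
Proof. by have /asboolP[] := multiloopP f. Qed.

Lemma multiloop_equiv f (e : Gamma m) z : f (gamma_torus xi e z) = gamma_alg sigma e (f z).
Proof. by have /asboolP[_] := multiloopP f; apply. Qed.

Lemma multiloop_ext f h : (forall z, f z = h z) -> f = h.
Proof. by move=> fh; apply/val_inj/funext. Qed.

Definition ev z f : g := f z.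
HB.instance Definition _ z := GRing.isLinear.Build k M g *:%R (ev z)
  (fun a f h => erefl).

Definition dev i z f : g := dlog i (f : torus k n -> g) z.

Fact dev_linear i z : linear (dev i z).
Proof. by move=> a f h; apply: dlog_lin; [exact: k0 | |]; apply: multiloop_regular. Qed.
HB.instance Definition _ i z := GRing.isLinear.Build k M g *:%R (dev i z)
  (dev_linear i z).

Lemma dev_lie i z f h : dev i z (lie f h) = lie (dev i z f) (h z) + lie (f z) (dev i z h).
Proof.
apply: (dlog_bilinear k0) (multiloop_regular f) (multiloop_regular h) _ _.
  exact: lie_linearl.
exact: lie_linearr.
Qed.

Fact mlmul_subproof P f : inv_fun P -> (fun z => P z *: f z) \in multiloop_pred m sigma xi.
Proof.
move=> [Pr Pi]; apply/asboolP; split=> [|e z].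
  apply: (@regular_bilinear _ _ k^o g g) Pr (multiloop_regular f).
    by move=> w a u v; rewrite scalerDl scalerA.
  by move=> w a u v; rewrite scalerDr !scalerA mulrC.
rewrite Pi multiloop_equiv.
have := gamma_alg_linear sigma e (P z) (f z) 0; rewrite !addr0 => ->.
have /= := gamma_alg_linear sigma e (-1) 0 0.
by rewrite !scaleN1r oppr0 addr0 addNr => ->; rewrite addr0.
Qed.

Definition mlmul P (Pi : inv_fun P) f : M := Multiloop (mlmul_subproof f Pi).

Lemma mlmulE P (Pi : inv_fun P) f z : mlmul Pi f z = P z *: f z.
Proof. by []. Qed.

Fact mlmul_linear P (Pi : inv_fun P) : linear (mlmul Pi).
Proof.
move=> a f h; apply: multiloop_ext => z; rewrite mlmulE.
rewrite -[LHS]/(P z *: (a *: f z + h z)) -[RHS]/(a *: (P z *: f z) + P z *: h z).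
by rewrite scalerDr !scalerA mulrC.
Qed.
HB.instance Definition _ P (Pi : inv_fun P) := GRing.isLinear.Build k M M *:%R
  (mlmul Pi) (mlmul_linear Pi).

Lemma dev_mlmul i z P (Pi : inv_fun P) f :
  dev i z (mlmul Pi f) = dlog i P z *: f z + P z *: dev i z f.
Proof.
have [Pr _] := Pi.
apply: (@dlog_bilinear _ _ k0 k^o g g (fun u v => u *: v)) Pr (multiloop_regular f) _ _.
  by move=> w a u v; rewrite scalerDl scalerA.
by move=> w a u v; rewrite scalerDr !scalerA mulrC.
Qed.

Section Eigenbasis.
Variables (b : 'I_(dim g) -> g) (c : 'I_(dim g) -> 'Hom(g, k^o)) (d : 'I_(dim g) -> degree).
Hypothesis bE : forall v, v = \sum_j c j v *: b j.
Hypothesis cb : forall i j, c i (b j) = (i == j)%:R.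
Hypothesis sigma_b : forall i j, sigma i (b j) = xi i ^ d j i *: b j.
Implicit Types (j l r t : 'I_(dim g)).

Lemma gamma_alg_b e j : gamma_alg sigma e (b j) = gamma_char xi e (d j) *: b j.
Proof.
rewrite /gamma_alg /gamma_char; elim: (index_enum _) => [|i s IH].
  by rewrite !big_nil scale1r.
rewrite !big_cons /= IH.
have itE (q : nat) u : iter q (sigma i) (u *: b j) = ((xi i ^+ q) ^ d j i * u) *: b j.
  elim: q => [|q IHl]; first by rewrite expr0 exp1rz mul1r.
  by rewrite iterS IHl linearZ /= sigma_b scalerA exprSr expfzMl; congr (_ *: _); ring.
by rewrite itE.
Qed.

Lemma c_gamma e j v : c j (gamma_alg sigma e v) = gamma_char xi e (d j) * c j v.
Proof.
pose G : {linear g -> g} := HB.pack (gamma_alg sigma e)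
  (GRing.isLinear.Build k g g *:%R _ (gamma_alg_linear sigma e)).
have GE l u : G (u *: b l) = (u * gamma_char xi e (d l)) *: b l.
  by rewrite linearZ /= gamma_alg_b scalerA.
rewrite {1}(bE v) -[gamma_alg _ _ _]/(G _) linear_sum linear_sum (bigD1 j) //=.
rewrite big1 => [|l lj]; rewrite -[gamma_alg _ _ _]/(G _) GE linearZ /= cb.
  by rewrite eqxx addr0 -[LHS]/(_ * 1) mulr1 mulrC.
by rewrite eq_sym (negPf lj) scaler0.
Qed.

Fact basis_map_subproof j : (fun z => mono (d j) z *: b j) \in multiloop_pred m sigma xi.
Proof.
apply/asboolP; split=> [|e z]; first by exists [:: (d j, b j)] => z; rewrite big_seq1.
pose G : {linear g -> g} := HB.pack (gamma_alg sigma e)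
  (GRing.isLinear.Build k g g *:%R _ (gamma_alg_linear sigma e)).
by rewrite -[RHS]/(G _) linearZ /= gamma_alg_b mono_gamma scalerA mulrC.
Qed.
(** The z^(d_j) b_j form a basis of the multiloop algebra over the invariant
    functions; coef_fun gives the coordinates. *)
Definition basis_map j : M := Multiloop (basis_map_subproof j).

Definition coef_fun j f z : k^o := c j (f z) * mono (- d j) z.

Lemma coef_funE f z : f z = \sum_j coef_fun j f z *: basis_map j z.
Proof.
rewrite {1}(bE (f z)); apply: eq_bigr => j _.
by rewrite scalerA -mulrA [mono _ _ * _]mulrC monoNK mulr1.
Qed.

Lemma regular_mono (p : degree) : @regular_map k n k^o (mono p).
Proof. by exists [:: (p, 1)] => z; rewrite big_seq1 -[_ *: _]/(_ * 1) mulr1. Qed.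

Let mull (w : k^o) : linear ((fun u v : k^o => (u * v : k^o))^~ w).
Proof. by move=> a u v; rewrite mulrDl -scalerAl. Qed.
Let mulr (w : k^o) : linear ((fun u v : k^o => (u * v : k^o)) w).
Proof. by move=> a u v; rewrite mulrDr -scalerAr. Qed.

Lemma inv_coef_fun j f : inv_fun (coef_fun j f).
Proof.
split=> [|e z].
  apply: (@regular_bilinear _ _ k^o k^o k^o (fun u u' => u * u') mull mulr
    (fun z => c j (f z)) (mono (- d j))).
    exact: regular_lfun (multiloop_regular f).
  exact: regular_mono.
rewrite /coef_fun multiloop_equiv c_gamma mono_gamma.
have : gamma_char xi e (d j) * gamma_char xi e (- d j) = 1.
  rewrite /gamma_char -big_split big1 // => i _ /=.
  by rewrite ffunE -expfzDr ?subrr ?expr0z // expf_neq0 // torus_neq0.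
by move=> E; rewrite mulrACA E mul1r.
Qed.

Lemma dlog_coef_fun i j f z : f z = 0 -> dev i z f = 0 -> dlog i (coef_fun j f) z = 0.
Proof.
move=> f0 df0; rewrite (@dlog_bilinear _ _ k0 k^o k^o k^o (fun u u' => u * u') mull mulr
  (fun z => c j (f z)) (mono (- d j))); last 2 first.
- exact: regular_lfun (multiloop_regular f).
- exact: regular_mono.
rewrite dlog_lfun //; last exact: multiloop_regular.
by rewrite -[dlog i f z]/(dev i z f) df0 f0 !linear0 !mul0r addr0.
Qed.

(** A bracket of eigenvectors only has components in the eigenspace of the product
    of their characters, so the terms of another character can be dropped from
    any expansion of b_j into brackets; one exists as g is perfect. *)
Lemma graded_bracket_expansion j : exists C : 'I_(dim g) -> 'I_(dim g) -> k,
  (forall l r, C l r != 0 -> forall i, xi i ^ (d j - d l - d r) i = 1) /\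
  b j = \sum_l \sum_r C l r *: lie (b l) (b r).
Proof.
have [C CE] : exists C : 'I_(dim g) -> 'I_(dim g) -> k,
    b j = \sum_l \sum_r C l r *: lie (b l) (b r).
  move: (b j); apply: (semisimple_perfect k0 gss) => [|u v].
    split=> [|t u v [C ->] [D ->]].
      by exists (fun _ _ => 0); rewrite big1 // => l _; rewrite big1 // => r _; rewrite scale0r.
    exists (fun l r => t * C l r + D l r); rewrite scaler_sumr -big_split.
    apply: eq_bigr => l _ /=; rewrite scaler_sumr -big_split; apply: eq_bigr => r _ /=.
    by rewrite scalerDl scalerA.
  exists (fun l r => c l u * c r v).
  pose L w : {linear g -> g} := HB.pack (lie^~ w)
    (GRing.isLinear.Build k g g *:%R (lie^~ w) (lie_linearl w)).
  rewrite {1}(bE u) {1}(bE v) -[LHS]/(L _ _) linear_sum; apply: eq_bigr => l _.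
  rewrite linearZ /= linear_sum scaler_sumr; apply: eq_bigr => r _.
  by rewrite linearZ /= scalerA.
pose good l r := [forall i, xi i ^ (d j - d l - d r) i == 1].
exists (fun l r => if good l r then C l r else 0); split=> [l r|].
  by rewrite /good; case: ifP => [/forallP gd _ i|]; [apply/eqP | rewrite eqxx].
have cl t l r : c t (lie (b l) (b r)) != 0 ->
    forall i, xi i ^ (d l i + d r i) = xi i ^ d t i.
  move=> ct i; apply: (mulIf ct).
  have cs v : c t (sigma i v) = xi i ^ d t i * c t v.
    rewrite {1}(bE v) !linear_sum (bigD1 t) //= big1 => [|q qt].
      by rewrite addr0 !linearZ /= sigma_b linearZ /= cb eqxx -[LHS]/(_ * (_ * 1)) mulr1 mulrC.
    by rewrite !linearZ /= sigma_b linearZ /= cb eq_sym (negPf qt) -![_ *: _]/(_ * _) !mulr0.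
  rewrite -cs lie_aut_lie !sigma_b lieZl [lie _ (_ *: _)]linearZ /= scalerA linearZ.
  by rewrite expfzDr ?torus_neq0.
have goodE l r t : c t (lie (b l) (b r)) != 0 ->
    good l r = [forall i, xi i ^ d j i == xi i ^ d t i].
  move=> ct; apply: eq_forallb => i; have := cl t l r ct i.
  rewrite !ffunE -addrA -opprD [xi i ^ (d j i - _)]expfzDr ?torus_neq0 // -invr_expz => ->.
  by rewrite -[X in _ == X](divff (expfz_neq0 (d t i) (torus_neq0 xi i))) (inj_eq (divIf _)) ?expfz_neq0 ?torus_neq0.
have coefE v w : (forall t, c t v = c t w) -> v = w.
  by move=> vw; rewrite (bE v) (bE w); apply: eq_bigr => t _; rewrite vw.
apply: coefE => t.
have sumE (D : 'I_(dim g) -> 'I_(dim g) -> k) :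
    c t (\sum_l \sum_r D l r *: lie (b l) (b r)) =
    \sum_l \sum_r D l r * c t (lie (b l) (b r)).
  rewrite linear_sum; apply: eq_bigr => l _; rewrite linear_sum; apply: eq_bigr => r _.
  by rewrite linearZ.
rewrite sumE; have [/forallP same|/forallPn[i diff]] :=
    boolP [forall i, xi i ^ d j i == xi i ^ d t i].
  rewrite CE sumE; apply: eq_bigr => l _; apply: eq_bigr => r _.
  have [->|ct] := eqVneq (c t (lie (b l) (b r))) 0; first by rewrite !mulr0.
  by rewrite (goodE l r t ct) (introT forallP same).
have -> : c t (b j) = 0.
  by rewrite cb; have [tj|//] := eqVneq t j; move: diff; rewrite tj eqxx.
rewrite big1 // => l _; rewrite big1 // => r _.
have [->|ct] := eqVneq (c t (lie (b l) (b r))) 0; first by rewrite mulr0.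
rewrite (goodE l r t ct); case: forallP => [/(_ i)|_]; last by rewrite mul0r.
by rewrite (negPf diff).
Qed.

(** The two factors of P R are shared between the two entries of the brackets:
    P R z^(d_j) b_j is a combination of the brackets of
    P z^(d_j - d_l - d_r) z^(d_l) b_l and R z^(d_r) b_r. *)
Lemma second_order_killed_basis (U : lmodType k) (C : {linear M -> U})
    (Z : torus k n -> Prop) j Q :
  (forall f h, (forall x, Z x -> f x = 0) -> (forall x, Z x -> h x = 0) ->
     C (lie f h) = 0) ->
  second_order m xi Z Q ->
  forall h, (forall z, h z = Q z *: basis_map j z) -> C h = 0.
Proof.
move=> C0; elim=> [P R Pi Ri P0 R0|P R Ps IP Rs IR] h hE; last first.
  have Pi := second_order_inv Ps.
  have Ri := second_order_inv Rs.
  have -> : h = mlmul Pi (basis_map j) + mlmul Ri (basis_map j).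
    by apply: multiloop_ext => z; rewrite hE scalerDl.
  by rewrite linearD /= (IP _ (mlmulE _ _)) (IR _ (mlmulE _ _)) addr0.
have [D [D1 DE]] := graded_bracket_expansion j.
pose mu l r z : k^o := if D l r != 0 then mono (d j - d l - d r) z else 0.
have mui l r : inv_fun (mu l r).
  rewrite /mu; case: eqP => [_|/eqP /D1]; first exact: inv_const.
  exact: inv_mono.
have -> : h = \sum_l \sum_r D l r *:
    lie (mlmul (inv_mul Pi (mui l r)) (basis_map l)) (mlmul Ri (basis_map r)).
  apply: multiloop_ext => z; rewrite hE -[RHS]/(ev z _) linear_sum.
  rewrite /basis_map /= DE scalerA !scaler_sumr; apply: eq_bigr => l _.
  rewrite [RHS]linear_sum [LHS]scaler_sumr; apply: eq_bigr => r _; rewrite [RHS]linearZ /=.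
  rewrite -[X in _ = _ *: X]/(lie ((P z * mu l r z) *: (mono (d l) z *: b l))
                         (R z *: (mono (d r) z *: b r))).
  rewrite !scalerA lieZl [lie _ (_ *: _)]linearZ /= !scalerA /mu; have [->|_] := eqVneq (D l r) 0.
    by rewrite !(mulr0, mul0r).
  have -> : mono (d j) z = mono (d j - d l - d r) z * mono (d l) z * mono (d r) z.
    by rewrite -!monoD addrAC !subrK.
  by congr (_ *: _); rewrite /=; ring.
rewrite linear_sum big1 // => l _; rewrite linear_sum big1 // => r _.
rewrite linearZ /= C0 ?scaler0 // => x Zx; first by rewrite mlmulE P0 // mul0r scale0r.
by rewrite mlmulE R0 // scale0r.
Qed.

Definition value_lift x v : M := \sum_j (c j v * mono (- d j) x) *: basis_map j.

Fact value_lift_linear x : linear (value_lift x).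
Proof.
move=> u v w; rewrite /value_lift scaler_sumr -big_split; apply: eq_bigr => j _ /=.
by rewrite linearP scalerA -scalerDl mulrDl -mulrA.
Qed.
HB.instance Definition _ x := GRing.isLinear.Build k g M *:%R (value_lift x) (value_lift_linear x).

Lemma value_lift_ev x v : value_lift x v x = v.
Proof.
rewrite -[LHS]/(ev x _) linear_sum [RHS]bE; apply: eq_bigr => j _; rewrite linearZ /=.
rewrite -[X in _ *: X = _]/(mono (d j) x *: b j) scalerA -mulrA [mono _ _ * _]mulrC monoNK.
by rewrite mulr1.
Qed.

End Eigenbasis.

Variable s : seq (torus k n).
Hypothesis us : uniq s.
Hypothesis sep : forall x y, x \in s -> y \in s -> x != y ->
  forall e : Gamma m, gamma_torus xi e x <> y.

(** The coefficients of f in the basis of the z^(d_j) b_j are invariant functions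
    vanishing to second order on s, so lie in the square of the ideal of s; hence
    f is a sum of brackets of maps vanishing on s. *)
Lemma second_order_killed (U : lmodType k) (C : {linear M -> U}) :
  (forall f h, (forall x, x \in s -> f x = 0) -> (forall x, x \in s -> h x = 0) ->
     C (lie f h) = 0) ->
  forall f, (forall x, x \in s -> f x = 0 /\ forall i, dev i x f = 0) -> C f = 0.
Proof.
move=> C0 f f0; have [b [c [d [bE cb sb]]]] := eigenbasis.
have -> : f = \sum_j mlmul (inv_coef_fun bE cb sb j f) (basis_map sb j).
  apply: multiloop_ext => z; rewrite -[RHS]/(ev z _) linear_sum.
  exact: coef_funE.
rewrite linear_sum big1 // => j _.
apply: (@second_order_killed_basis b c d bE cb sb U C (fun x => x \in s) j
  (coef_fun c d j f)) => //.
apply: second_order_on => // [|x /f0[fx df]]; first exact: inv_coef_fun.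
split=> [|i]; first by rewrite /coef_fun fx linear0 mul0r.
exact: dlog_coef_fun.
Qed.

(** A bump function times a map with value v at x gives pt x v. For tg x i v it is
    squared, so that the first derivatives at the other points vanish too, and
    multiplied by the i-th uniformizer at x. *)
Lemma multiloop_lifts :
  exists (pt : torus k n -> {linear g -> M}) (tg : torus k n -> 'I_n -> {linear g -> M}),
  [/\ forall x y v, x \in s -> y \in s -> pt x v y = if x == y then v else 0,
      forall x i y v, x \in s -> y \in s -> tg x i v y = 0
    & forall x i y j v, x \in s -> y \in s ->
        dev j y (tg x i v) = if (x == y) && (i == j) then v else 0].
Proof.
have [b [c [d [bE cb sb]]]] := eigenbasis.
have [bm bmP] := bump_functions xi_prim sep.
pose bp x := if x \in s then bm x else (fun=> 0).
have bpi x : inv_fun (bp x).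
  by rewrite /bp; case: ifP => [/bmP[]//|_]; apply: inv_const.
have bp1 x : x \in s -> bp x x = 1 by rewrite /bp => xs; rewrite xs; case: (bmP x xs).
have bp0 x y : x \in s -> y \in s -> x != y -> bp x y = 0.
  by move=> xs ys xy; rewrite /bp xs; case: (bmP x xs) => _ _ -> //; rewrite eq_sym.
have bbi x : inv_fun (fun z => bp x z * bp x z) by apply: inv_mul.
(* The i-th logarithmic derivative of the i-th uniformizer at x is m_i. *)
pose tf x i z : k^o := (m i)%:R^-1 * ((bp x z * bp x z) * uniformizer m x i z).
have tfi x i : inv_fun (tf x i).
  apply: inv_mul; first exact: inv_const.
  by apply: inv_mul => //; apply: inv_uniformizer.
exists (fun x => [the {linear g -> M} of mlmul (bpi x) \o value_lift c sb x]).
exists (fun x i => [the {linear g -> M} of mlmul (tfi x i) \o value_lift c sb x]).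
have tf0 x i y : x \in s -> y \in s -> tf x i y = 0.
  move=> xs ys; rewrite /tf; have [<-|xy] := eqVneq x y.
    by rewrite uniformizer_x !mulr0.
  by rewrite bp0 // !mul0r mulr0.
split=> [x y v xs ys|x i y v xs ys|x i y j v xs ys] /=.
- have [<-|xy] := eqVneq x y; last by rewrite bp0 // scale0r.
  by rewrite bp1 // scale1r value_lift_ev.
- by rewrite tf0 // scale0r.
rewrite dev_mlmul tf0 // scale0r addr0.
have -> : tf x i = fun z => (m i)%:R^-1 * ((bp x z * bp x z) * uniformizer m x i z) + 0.
  by apply/funext => z; rewrite addr0.
have ui := inv_uniformizer xi_prim x i.
rewrite (@dlog_inv_lin _ _ m xi k0); [|exact: inv_mul|exact: inv_const].
rewrite !(@dlog_mul _ _ m xi k0) // (dlog_const k0) addr0.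
have [<-|xy] /= := eqVneq x y; last by rewrite bp0 // !(mul0r, mulr0, addr0) scale0r.
rewrite uniformizer_x mulr0 add0r bp1 // !mul1r (dlog_uniformizer k0 xi_prim) (value_lift_ev bE).
rewrite eq_sym; case: eqP => _; last by rewrite mul0r mulr0 scale0r.
by rewrite mul1r mulVf ?scale1r // natr0 // -lt0n.
Qed.

End Multiloop.

(** * Extensions and cocycles *)

Section HomRep.
Variables (k : fieldType) (L : lieAlgType k) (V V' : fdrep L).
Implicit Types (a b : L) (u w : 'Hom(V, V')).

Definition hom_act a u : 'Hom(V, V') := (rep_act V' a \o u)%VF - (u \o rep_act V a)%VF.

Lemma hom_actE a u v : hom_act a u v = rep_act V' a (u v) - u (rep_act V a v).
Proof. by rewrite add_lfunE opp_lfunE !comp_lfunE. Qed.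

Fact hom_linr a : linear (hom_act a).
Proof.
move=> c u w; apply/lfunP => v; rewrite [RHS]add_lfunE [X in _ = X + _]scale_lfunE !hom_actE.
by rewrite !(add_lfunE, scale_lfunE) linearP scalerBr opprD addrACA.
Qed.
HB.instance Definition _ a := GRing.isLinear.Build k 'Hom(V, V') 'Hom(V, V') *:%R
  (hom_act a) (hom_linr a).
Fact hom_linl u : linear (hom_act^~ u).
Proof.
move=> c a b; apply/lfunP => v; rewrite [RHS]add_lfunE [X in _ = X + _]scale_lfunE !hom_actE.
by rewrite !rep_actDl !rep_actZl linearP scalerBr opprD addrACA.
Qed.
Fact hom_lie a b u :
  hom_act (lie a b) u = hom_act a (hom_act b u) - hom_act b (hom_act a u).
Proof.
apply/lfunP => v; rewrite [RHS]add_lfunE opp_lfunE !hom_actE !rep_lie !linearB /=.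
rewrite !opprK.
have aux (Z : zmodType) (p q r s t1 t2 : Z) :
    p - q + (- r + s) = p - t1 + (- t2 + s) + (- q + t2 + (t1 - r)).
  by rewrite !addrA [RHS](ACl (1*5*8*4*(2*7)*(3*6))) /= !addNr !addr0.
exact: aux.
Qed.
Definition hom_rep : fdrep L := mk_rep hom_linr hom_linl hom_lie.

Lemma hom_repE a u : rep_act hom_rep a u = hom_act a u.
Proof. exact: mk_repE. Qed.

(** The cocycles of extensions of V by V' are the 1-cocycles with values in the
    module Hom(V, V'). *)
Lemma is_cocycleP (c : L -> 'Hom(V, V')) : is_cocycle c <->
  linear c /\ forall a b, c (lie a b) = hom_act a (c b) - hom_act b (c a).
Proof.
have E a b v : (hom_act a (c b) - hom_act b (c a)) v =
    (rep_act V' a (c b v) + c a (rep_act V b v))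
    - (rep_act V' b (c a v) + c b (rep_act V a v)).
  rewrite add_lfunE opp_lfunE !hom_actE !opprB !opprD !addrA.
  by rewrite [LHS](ACl (1*3*4*2)).
split=> -[cl ch]; split=> //; first by move=> a b; apply/lfunP => v; rewrite E ch.
by move=> a b v; rewrite ch E.
Qed.

End HomRep.

Section Ext.
Variables (k : fieldType) (L : lieAlgType k) (V V' : fdrep L).
Implicit Types (e : Ext1 V V') (c : L -> 'Hom(V, V')) (u : 'Hom(V, V')).

Lemma ext1_of_cocycle c : is_cocycle c -> exists e, ext1_cocycle e c.
Proof.
move=> /has_cocycle_exists[E Ec]; exists (ext1_class E).
exact/ext1_class_cocycle.
Qed.

(** The difference of two sections takes its values in V'. *)
Lemma has_cocycle_coboundary (E : extension V V') c c' :
  has_cocycle E c -> has_cocycle E c' ->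
  exists u, forall a, c a - c' a = hom_act a u.
Proof.
move=> [s [sK sa]] [s' [sK' sa']].
have [r rK] := lfun_retract (@ext_in_inj _ _ _ _ E).
have uE v : ext_in E ((r \o (s - s'))%VF v) = s v - s' v.
  rewrite comp_lfunE add_lfunE opp_lfunE.
  have [|x <-] := (ext_exact (s v - s' v)).1; last by rewrite rK.
  by rewrite linearB /= sK sK' subrr.
exists (r \o (s - s'))%VF => a; apply/lfunP => v.
apply: (@ext_in_inj _ _ _ _ E); rewrite add_lfunE opp_lfunE hom_actE !linearB /=.
rewrite ext_in_hom !uE linearB /= sa sa' !opprD !opprK.
have aux (Z : zmodType) (x y p q : Z) : p - q = x + p + (- y - q) + (- x + y).
  by rewrite !addrA [RHS](ACl (2*4*(1*5)*(3*6))) /= subrr addNr !addr0.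
exact: aux.
Qed.

Lemma has_cocycle_add_coboundary (E : extension V V') c c' u : has_cocycle E c ->
  (forall a, c' a = c a + hom_act a u) -> has_cocycle E c'.
Proof.
move=> [s [sK sa]] cE; exists (s + (ext_in E \o u))%VF; split=> [v|a v].
  by rewrite add_lfunE comp_lfunE linearD /= sK ext_out_in addr0.
rewrite !add_lfunE !comp_lfunE linearD /= sa -ext_in_hom cE add_lfunE hom_actE.
by rewrite -!addrA -!linearD /= addrCA [u _ + _]addrC subrK.
Qed.

(** A family of cocycles, linear in its parameter, that contains exactly one
    cocycle of each cohomology class identifies Ext^1 with the parameter space. *)
Lemma ext1_param (E : lmodType k) (F : E -> L -> 'Hom(V, V')) :
  (forall p, is_cocycle (F p)) ->
  (forall z p q a, F (z *: p + q) a = z *: F p a + F q a) ->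
  (forall p u, (forall a, F p a = hom_act a u) -> p = 0) ->
  (forall c, is_cocycle c -> exists p u, forall a, c a = F p a + hom_act a u) ->
  lin_iso (Ext1 V V') E.
Proof.
move=> Fc Fl Finj Fsurj.
have FB p q a : F (p - q) a = F p a - F q a.
  by rewrite addrC -scaleN1r Fl scaleN1r addrC.
have uniq_param e p q : ext1_cocycle e (F p) -> ext1_cocycle e (F q) -> p = q.
  move=> ep eq; have [u uE] := has_cocycle_coboundary ep eq.
  apply/eqP; rewrite -subr_eq0; apply/eqP; apply: (Finj _ u) => a.
  by rewrite FB uE.
have /choice[G GE] e : exists p, ext1_cocycle e (F p).
  have [c /Fsurj[p [u cE]] ec] := ext1_cocycleP e; exists p.
  apply: (has_cocycle_add_coboundary (u := - u) ec) => a.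
  by rewrite cE linearN addrK.
have G_lin : linear G.
  move=> z e e'; apply: (uniq_param (z *: e + e')); first exact: GE.
  have -> : F (z *: G e + G e') = fun a => z *: F (G e) a + F (G e') a.
    by apply/funext => a; rewrite Fl.
  exact: ext1_cocycleD (ext1_cocycleZ z (GE e)) (GE e').
pose GL : {linear Ext1 V V' -> E} :=
  HB.pack G (GRing.isLinear.Build k (Ext1 V V') E *:%R G G_lin).
exists GL.
have /choice[H HE] p := ext1_of_cocycle (Fc p).
exists H => [e|p] /=; last by apply: (uniq_param (H p)); rewrite ?HE.
by apply: (ext1_cocycle_eq (HE (G e))); apply: GE.
Qed.

End Ext.

(** The direct sum is an iterated product; C reads its components as elements of
    the common space Y, so that they can be summed over s. *)
Lemma big_dsum_families (k : fieldType) (n : nat) (T : eqType) (Y : vectType k)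
    (K : T -> {vspace Y}) (s : seq T) : uniq s ->
  exists C : big_dsum s (fun x => {ffun 'I_n -> subvs_of (K x)}) -> T -> 'I_n -> Y,
  [/\ forall z p q x i, C (z *: p + q) x i = z *: C p x i + C q x i,
      forall p x i, x \in s -> C p x i \in K x,
      forall p, (forall x i, x \in s -> C p x i = 0) -> p = 0
    & forall D : T -> 'I_n -> Y, (forall x i, x \in s -> D x i \in K x) ->
        exists p, forall x i, x \in s -> C p x i = D x i].
Proof.
elim: s => [|y s IH] /=.
  move=> _; exists (fun _ _ _ => 0); split=> //.
  - by move=> z _ _ _ _; rewrite scaler0 addr0.
  - by move=> p _; apply/rowP => -[].
  by move=> D _; exists 0.
move=> /andP[ys /IH[C [Cl CK Cinj Csurj]]].
pose fam : vectType k := {ffun 'I_n -> subvs_of (K y)}.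
exists (fun (p : (fam * big_dsum s (fun x => {ffun 'I_n -> subvs_of (K x)}))%type) x i =>
  if x == y then vsval ((p.1 : {ffun 'I_n -> subvs_of (K y)}) i) else C p.2 x i).
split=> [z p q x i|p x i|p p0|D DK].
- case: eqP => _; last exact: Cl.
  by rewrite -[(_ + _).1]/(z *: p.1 + q.1) !ffunE.
- by rewrite inE; case: eqP => [->|_] //= xs; [apply: subvsP | apply: CK].
- have p1 : p.1 = 0.
    apply/ffunP => i; apply: subvs_inj; have := p0 y i (mem_head _ _).
    by rewrite eqxx ffunE.
  have p2 : p.2 = 0.
    apply: Cinj => x i xs; have := p0 x i; rewrite inE xs orbT => /(_ isT).
    by case: eqP => // xy; rewrite -xy xs in ys.
  by case: p p1 p2 {p0} => p1 p2 /= -> ->.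
have [|q qE] := Csurj D; first by move=> x i xs; apply: DK; rewrite inE xs orbT.
exists ([ffun i => vsproj (K y) (D y i)], q) => x i; rewrite inE.
case: eqP => [-> _|_ /= xs] /=; last exact: qE.
by rewrite ffunE vsprojK // DK ?mem_head.
Qed.

(** * First cohomology of multiloop algebras *)

Section Cohomology.
Variables (k : closedFieldType) (n : nat) (m : 'I_n -> nat) (g : fdLieAlgType k).
Variables (sigma : 'I_n -> lie_aut g) (xi : torus k n).
Hypothesis k0 : [pchar k] =i pred0.
Hypothesis m_gt0 : forall i, (0 < m i)%N.
Hypothesis gss : semisimple g.
Hypothesis sigma_comm : forall (i j : 'I_n) (a : g),
  sigma i (sigma j a) = sigma j (sigma i a).
Hypothesis sigma_order : forall (i : 'I_n) (a : g), iter (m i) (sigma i) a = a.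
Hypothesis xi_prim : forall i, (m i).-primitive_root (xi i).
Local Notation M := (multiloop m sigma xi).
Variable s : seq (torus k n).
Hypothesis us : uniq s.
Hypothesis sep : forall x y, x \in s -> y \in s -> x != y ->
  forall e : Gamma m, gamma_torus xi e x <> y.
Implicit Types (x y z : torus k n) (f h : M).

Definition vanishes f := forall x, x \in s -> f x = 0.

Variable U : fdrep M.
Hypothesis U0 : forall f, vanishes f -> forall u, rep_act U f u = 0.

Definition cocycle (c : M -> U) := linear c /\
  forall f h, c (lie f h) = rep_act U f (c h) - rep_act U h (c f).

Lemma cocycle_coboundary u : cocycle (fun f => rep_act U f u).
Proof.
by split=> [a f h|f h]; rewrite ?rep_lie // rep_actDl rep_actZl.
Qed.

Lemma cocycle_sub c c' : cocycle c -> cocycle c' -> cocycle (fun f => c f - c' f).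
Proof.
move=> [cl ch] [cl' ch']; split=> [a f h|f h].
  by rewrite cl cl' scalerBr opprD addrACA.
rewrite ch ch' ![rep_act U _ (_ - _)]linearB /=.
by rewrite !opprB !addrA [LHS](ACl (1*4*3*2)).
Qed.

Section Lifts.
Variable pt : torus k n -> {linear g -> M}.
Hypothesis ptE : forall x y v, x \in s -> y \in s -> pt x v y = if x == y then v else 0.

Lemma rep_act_vanish f h u : vanishes (f - h) -> rep_act U f u = rep_act U h u.
Proof.
move=> /U0/(_ u) fh; rewrite -[f](subrK h) rep_actDl fh.
by rewrite add0r.
Qed.

Lemma pt_lie x v w : x \in s -> vanishes (pt x (lie v w) - lie (pt x v) (pt x w)).
Proof.
move=> xs y ys; rewrite -[LHS]/(pt x (lie v w) y - lie (pt x v y) (pt x w y)) !ptE //.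
by case: eqP => _; rewrite ?lie0l subrr.
Qed.

Section AtPoint.
Variable x : torus k n.
Hypothesis xs : x \in s.

(** The action of the copy of g at x in the quotient by the maps vanishing on s. *)
Definition pt_act v u : U := rep_act U (pt x v) u.
Fact pt_linr v : linear (pt_act v).
Proof. exact: linearP. Qed.
Fact pt_linl u : linear (pt_act^~ u).
Proof. by move=> a v w; rewrite /pt_act linearP rep_actDl rep_actZl. Qed.
Fact pt_act_lie v w u :
  pt_act (lie v w) u = pt_act v (pt_act w u) - pt_act w (pt_act v u).
Proof. by rewrite /pt_act (rep_act_vanish u (pt_lie v w xs)) rep_lie. Qed.
Definition pt_rep : fdrep g := mk_rep pt_linr pt_linl pt_act_lie.

Lemma pt_repE v u : rep_act pt_rep v u = rep_act U (pt x v) u.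
Proof. exact: mk_repE. Qed.

End AtPoint.

(** The quotient of the multiloop algebra by the maps vanishing on s is a product of
    copies of g, treated one factor at a time: after subtracting a coboundary, c
    vanishes on the factors already treated, hence takes its values on the next
    one in their invariants, to which Whitehead's lemma applies. *)
Lemma vanishing_cocycle_trivial c : cocycle c -> (forall f, vanishes f -> c f = 0) ->
  exists u, forall f, c f = rep_act U f u.
Proof.
move=> cc c0.
have ceq c' f h : cocycle c' -> (forall f, vanishes f -> c' f = 0) ->
    vanishes (f - h) -> c' f = c' h.
  move=> [cl _] z0 /z0; rewrite addrC -scaleN1r cl scaleN1r addrC => /eqP.
  by rewrite subr_eq0 => /eqP.
suff [u uE] : exists u, forall x v, x \in s -> c (pt x v) = rep_act U (pt x v) u.
  exists u => f; pose f' := \sum_(x <- s) pt x (f x).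
  have ff' : vanishes (f - f').
    move=> y ys; rewrite -[LHS]/(f y - ev y f') linear_sum (bigD1_seq y) //=.
    rewrite -[ev y _]/(pt y (f y) y) ptE // eqxx big1_seq ?addr0 ?subrr //.
    by move=> x /andP[xy xs]; rewrite -[ev y _]/(pt x (f x) y) ptE // (negPf xy).
  rewrite (ceq c f f') // (rep_act_vanish u ff').
  pose cL : {linear M -> U} := HB.pack c (GRing.isLinear.Build k _ _ *:%R _ cc.1).
  rewrite -[c f']/(cL f') /f' !linear_sum sum_lfunE !big_seq; apply: eq_bigr => x xs.
  exact: uE.
suff: forall r, uniq r -> {subset r <= s} ->
    exists u, forall x v, x \in r -> c (pt x v) = rep_act U (pt x v) u.
  by apply.
elim=> [|x r IH] /=; first by exists 0.
move=> /andP[xr ur] rs; have xs : x \in s by apply: rs; rewrite mem_head.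
have rs' y : y \in r -> y \in s by move=> yr; apply: rs; rewrite inE yr orbT.
have [u uE] := IH ur rs'.
pose c2 f := c f - rep_act U f u.
have cc2 : cocycle c2 by apply: cocycle_sub cc (cocycle_coboundary u).
have c20 f : vanishes f -> c2 f = 0.
  by move=> f0; rewrite /c2 c0 // U0 // subrr.
have xy0 y v w : y \in r -> vanishes (lie (pt y w) (pt x v)).
  move=> yr z zs; have ys := rs' y yr.
  rewrite -[LHS]/(lie (pt y w z) (pt x v z)) !ptE //.
  case: eqP => [<-|_]; last by rewrite lie0l.
  by case: eqP => [xy|_]; [rewrite xy yr in xr | rewrite linear0].
have [A AP] : exists A : {vspace U}, forall u, u \in A <->
    forall y w, y \in r -> rep_act U (pt y w) u = 0.
  apply: vspace_of; split=> [y w _|a u1 u2 u10 u20 y w yr]; first exact: linear0.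
  by rewrite linearP /= u10 // u20 // scaler0 addr0.
have [||v|w wA wE] := @whitehead_sub k g k0 gss (pt_rep xs) A (fun v => c2 (pt x v)).
- move=> v w /AP wA; apply/AP => y w' yr; rewrite pt_repE.
  have := U0 (xy0 y v w' yr) w; rewrite rep_lie (wA y w') // linear0 subr0.
  exact.
- split=> [a v w|v w]; first by rewrite linearP cc2.1.
  rewrite !pt_repE -cc2.2; apply: ceq => //; exact: pt_lie.
- apply/AP => y w yr; have := c20 _ (xy0 y v w yr).
  rewrite cc2.2 => /eqP; rewrite subr_eq0 => /eqP ->.
  by rewrite /c2 uE // subrr linear0.
exists (u + w) => y v; rewrite inE linearD /= => /orP[/eqP->|yr].
  by have := wE v; rewrite pt_repE /c2 => <-; rewrite addrC subrK.
by rewrite uE // ((AP w).1 wA) // addr0.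
Qed.

End Lifts.

End Cohomology.

Section Ext1Multiloop.
Variables (k : closedFieldType) (n : nat) (m : 'I_n -> nat) (g : fdLieAlgType k).
Variables (sigma : 'I_n -> lie_aut g) (xi : torus k n).
Hypothesis k0 : [pchar k] =i pred0.
Hypothesis m_gt0 : forall i, (0 < m i)%N.
Hypothesis gss : semisimple g.
Hypothesis sigma_comm : forall (i j : 'I_n) (a : g),
  sigma i (sigma j a) = sigma j (sigma i a).
Hypothesis sigma_order : forall (i : 'I_n) (a : g), iter (m i) (sigma i) a = a.
Hypothesis xi_prim : forall i, (m i).-primitive_root (xi i).
Local Notation M := (multiloop m sigma xi).
Variable s : seq (torus k n).
Hypothesis us : uniq s.
Hypothesis sep : forall x y, x \in s -> y \in s -> x != y ->
  forall e : Gamma m, gamma_torus xi e x <> y.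
Variables V V' : fdrep M.
Implicit Types (x y z : torus k n) (f h : M) (u : 'Hom(V, V')).

(** The condition for f |-> phi (D_i f (x)) to be a cocycle, by the Leibniz rule. *)
Definition point_hom x (phi : 'Hom(g, 'Hom(V, V'))) :=
  forall f a, phi (lie (f x) a) = hom_act f (phi a).

Lemma point_hom_closed x : lin_closed (point_hom x).
Proof.
split=> [f a|z p q ph qh f a]; first by rewrite !zero_lfunE linear0.
by rewrite !(add_lfunE, scale_lfunE) ph qh linearP.
Qed.

Hypothesis V0 : forall f, vanishes s f -> forall v, rep_act V f v = 0.
Hypothesis V'0 : forall f, vanishes s f -> forall v, rep_act V' f v = 0.

Lemma hom_act_vanish f u : vanishes s f -> hom_act f u = 0.
Proof.
by move=> f0; apply/lfunP => v; rewrite hom_actE V0 // V'0 // linear0 subrr zero_lfunE.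
Qed.

(** Up to coboundaries, cocycles are the maps f |-> sum phi_(x,i) (D_i f (x)) with
    phi_(x,i) equivariant: the restriction of a cocycle to the maps vanishing on
    s kills their brackets, so only depends on the first derivatives at s; and
    a cocycle vanishing on these maps is a coboundary. A coboundary kills the maps
    vanishing on s, on which the phi_(x,i) can be read off, so they are unique. *)
Theorem ext1_multiloop (H : torus k n -> {vspace 'Hom(g, 'Hom(V, V'))}) :
  (forall x phi, phi \in H x <-> point_hom x phi) ->
  lin_iso (Ext1 V V') (big_dsum s (fun x => {ffun 'I_n -> subvs_of (H x)})).
Proof.
move=> HP; have [C [Cl CK Cinj Csurj]] := big_dsum_families n H us.
have [pt [tg [ptE tgE dtgE]]] :=
  multiloop_lifts k0 m_gt0 sigma_comm sigma_order xi_prim sep.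
pose F p f := \sum_(x <- s) \sum_i C p x i (dev i x f).
have F_lin p : linear (F p).
  move=> a f h; rewrite scaler_sumr -big_split; apply: eq_bigr => x _ /=.
  rewrite scaler_sumr -big_split; apply: eq_bigr => i _ /=.
  by rewrite !linearP.
have F_lie p f h : F p (lie f h) = hom_act f (F p h) - hom_act h (F p f).
  rewrite /F !linear_sum -big_split !big_seq; apply: eq_bigr => x xs /=.
  rewrite !linear_sum -big_split; apply: eq_bigr => i _ /=.
  have /HP Ch := CK p x i xs; rewrite (dev_lie k0) linearD /= Ch.
  by rewrite [lie (dev _ _ _) _]lieC linearN /= Ch addrC.
have Fc p : is_cocycle (F p) by apply/is_cocycleP.
apply: (ext1_param Fc).
- move=> a p q f; rewrite scaler_sumr -big_split; apply: eq_bigr => x _ /=.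
  rewrite scaler_sumr -big_split; apply: eq_bigr => i _ /=.
  by rewrite Cl add_lfunE scale_lfunE.
- move=> p u Fu; apply: Cinj => x i xs; apply/lfunP => a; rewrite zero_lfunE.
  have v0 : vanishes s (tg x i a) by move=> y ys; rewrite tgE.
  rewrite -[RHS](hom_act_vanish u v0) -Fu /F (bigD1_seq x) //= (bigD1 i) //=.
  rewrite dtgE // !eqxx big1 ?addr0 => [|j ji]; last first.
    by rewrite dtgE // eqxx eq_sym (negPf ji) linear0.
  rewrite big1_seq ?addr0 // => y /andP[yx ys]; rewrite big1 // => j _.
  by rewrite dtgE // eq_sym (negPf yx) linear0.
move=> c /is_cocycleP[c_lin c_lie].
pose cL : {linear M -> 'Hom(V, V')} := HB.pack c
  (GRing.isLinear.Build k M 'Hom(V, V') *:%R _ c_lin).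
have killed f : (forall x, x \in s -> f x = 0 /\ forall i, dev i x f = 0) -> c f = 0.
  apply: (second_order_killed k0 m_gt0 gss sigma_comm sigma_order xi_prim us sep (C := cL)).
  by move=> h h' h0 h'0; rewrite /= c_lie !hom_act_vanish // subrr.
pose D x i : 'Hom(g, 'Hom(V, V')) := linfun (cL \o tg x i).
have DE x i a : D x i a = c (tg x i a) by rewrite lfunE.
have tg_sub_killed f h : (forall x, x \in s -> f x = h x) ->
    (forall x i, x \in s -> dev i x f = dev i x h) -> c f = c h.
  move=> fh dfh; apply/eqP; rewrite -subr_eq0 -[_ - _](linearB cL); apply/eqP.
  apply: killed => x xs; split=> [|i]; last by rewrite linearB /= dfh // subrr.
  by rewrite -[LHS]/(f x - h x) fh // subrr.
have DK x i : x \in s -> D x i \in H x.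
  move=> xs; apply/HP => f a; rewrite !DE.
  have v0 : vanishes s (tg x i a) by move=> y ys; rewrite tgE.
  have -> : hom_act f (c (tg x i a)) = c (lie f (tg x i a)).
    by rewrite c_lie [hom_act (tg _ _ _) _]hom_act_vanish ?subr0.
  apply: tg_sub_killed => [y ys|y j ys].
    by rewrite tgE // -[RHS]/(lie (f y) (tg x i a y)) tgE // linear0.
  rewrite dtgE // (dev_lie k0) tgE // linear0 add0r dtgE //.
  by case: eqP => [->|_] /=; [case: eqP => _ | ]; rewrite ?linear0.
have [p pE] := Csurj D DK; exists p.
have cc1 : cocycle (U := hom_rep V V') (fun f => c f - F p f).
  apply: cocycle_sub.
    by split=> // f h; rewrite c_lie !hom_repE.
  by split=> // f h; rewrite F_lie !hom_repE.
have [u uE] : exists u, forall f, c f - F p f = rep_act (hom_rep V V') f u.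
  apply: (vanishing_cocycle_trivial k0 gss us _ ptE cc1).
    by move=> f f0 u; rewrite hom_repE hom_act_vanish.
  move=> f f0; apply/eqP; rewrite subr_eq0; apply/eqP.
  rewrite /F (eq_big_seq (fun x => \sum_i c (tg x i (dev i x f)))); last first.
    by move=> x xs; apply: eq_bigr => i _; rewrite pE // DE.
  transitivity (cL (\sum_(x <- s) \sum_i tg x i (dev i x f))); last first.
    by rewrite linear_sum; apply: eq_bigr => x _; rewrite linear_sum.
  apply: tg_sub_killed => [y ys|y j ys].
    rewrite f0 // -[RHS]/(ev y _) linear_sum big1_seq // => x /andP[_ xs].
    by rewrite linear_sum big1 // => i _; apply: tgE.
  rewrite linear_sum (bigD1_seq y) //= linear_sum (bigD1 j) //= dtgE // !eqxx.
  rewrite big1 => [|i ij]; last by rewrite dtgE // eqxx (negPf ij).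
  rewrite big1_seq ?addr0 // => x /andP[xy xs]; rewrite linear_sum big1 // => i _.
  by rewrite /= dtgE // (negPf xy).
by exists u => f; rewrite -hom_repE -uE addrC subrK.
Qed.

End Ext1Multiloop.

(** * Equivariant maps between tensor products *)

Section TensorSlices.
Variables (k : fieldType) (A A' T T' : vectType k).
Implicit Types (a : A) (t : T) (f : 'Hom(A, A')) (h : 'Hom(T, T')).

Lemma tensor_lfunPl z f f' h :
  tensor_lfun (z *: f + f') h = z *: tensor_lfun f h + tensor_lfun f' h.
Proof.
apply: tensor_lfun_ext => a t; rewrite add_lfunE scale_lfunE !tensor_lfunE.
by rewrite add_lfunE scale_lfunE tensorvDl tensorvZl.
Qed.

Lemma tensor_lfunPr z f h h' :
  tensor_lfun f (z *: h + h') = z *: tensor_lfun f h + tensor_lfun f h'.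
Proof.
apply: tensor_lfun_ext => a t; rewrite add_lfunE scale_lfunE !tensor_lfunE.
by rewrite add_lfunE scale_lfunE tensorvDr tensorvZr.
Qed.

Lemma tensor_lfun0l h : tensor_lfun (0 : 'Hom(A, A')) h = 0.
Proof. by have := tensor_lfunPl (-1) 0 0 h; rewrite !scaleN1r !addNr. Qed.

Lemma tensor_lfun0r f : tensor_lfun f (0 : 'Hom(T, T')) = 0.
Proof. by have := tensor_lfunPr (-1) f 0 0; rewrite !scaleN1r !addNr. Qed.

Lemma tensorv_eq0 (v : A') (w : T') : tensorv v w = 0 -> v = 0 \/ w = 0.
Proof.
move=> vw; have [|v0] := eqVneq v 0; first by left.
right; apply: v2r_inj; rewrite linear0; apply/rowP => j; rewrite mxE.
have : v2r v != 0 by rewrite -(linear0 (@v2r k A')) (inj_eq (@v2r_inj _ A')).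
case/rV0Pn => i vi; have /matrixP/(_ i j) := vw; rewrite !mxE big_ord1 mxE => /eqP.
by rewrite mulf_eq0 (negPf vi) => /eqP.
Qed.

Lemma tensor_lfun_eq0 f h : tensor_lfun f h = 0 -> f = 0 \/ h = 0.
Proof.
move=> fh; have [|/eqP/lfunPn[a fa]] := pselect (f = 0); first by left.
right; apply/lfunP => t; have : tensor_lfun f h (tensorv a t) = 0.
  by rewrite fh zero_lfunE.
rewrite zero_lfunE in fa; rewrite tensor_lfunE zero_lfunE => /tensorv_eq0[fa0|//].
by rewrite fa0 eqxx in fa.
Qed.

Definition contr_right (q : 'I_(dim T')) (u : tensor A' T') : A' := r2v (col q u)^T.

Fact contr_right_linear q : linear (contr_right q).
Proof. by move=> z u v; rewrite /contr_right !linearP. Qed.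
HB.instance Definition _ q := GRing.isLinear.Build k (tensor A' T') A' *:%R
  (contr_right q) (contr_right_linear q).

Lemma contr_rightE q (v : A') (w : T') : contr_right q (tensorv v w) = v2r w 0 q *: v.
Proof.
apply: v2r_inj; rewrite r2vK linearZ /=; apply/rowP => i.
by rewrite !mxE big_ord1 mxE mulrC.
Qed.

Lemma contr_right_sum (u : tensor A' T') :
  u = \sum_q tensorv (contr_right q u) (r2v (delta_mx 0 q)).
Proof.
apply/matrixP => i j; rewrite summxE (bigD1 j) //= big1 => [|q qj].
  by rewrite addr0 /tensorv !r2vK !mxE big_ord1 !mxE !eqxx mulr1.
by rewrite /tensorv !r2vK !mxE big_ord1 !mxE (eq_sym j) (negPf qj) andbF mulr0.
Qed.

Variable F : 'Hom(tensor A T, tensor A' T').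

(** The coordinates of F along T and T' commute with the given operators, so are
    multiples of f; the scalars are the matrix entries of the right factor. *)
Lemma tensor_slice_left (I : Type) (al : I -> 'End(A)) (al' : I -> 'End(A')) f :
  (forall i, F \o tensor_lfun (al i) \1 = tensor_lfun (al' i) \1 \o F)%VF ->
  (forall h : 'Hom(A, A'), (forall i, h \o al i = al' i \o h)%VF ->
     exists c, h = c *: f) ->
  exists h, F = tensor_lfun f h.
Proof.
move=> Fal line.
pose e (p : 'I_(dim T)) : T := r2v (delta_mx 0 p).
pose e' (q : 'I_(dim T')) : T' := r2v (delta_mx 0 q).
have hs p q : exists h : 'Hom(A, A'), forall a, h a = contr_right q (F (tensorv a (e p))).
  have [|h hE] := @mk_lfun k A A' (fun a => contr_right q (F (tensorv a (e p)))).
    by move=> z a b; rewrite tensorvDl tensorvZl !linearP.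
  by exists h.
have /choice[C CE] p : exists c : 'I_(dim T') -> k,
    forall q a, contr_right q (F (tensorv a (e p))) = c q *: f a.
  suff /choice[c cE] q : exists c, forall a, contr_right q (F (tensorv a (e p))) = c *: f a.
    by exists c.
  have [h hE] := hs p q; have [i|c cE] := line h.
    apply/lfunP => a; rewrite !comp_lfunE !hE.
    have /(congr1 (fun u : 'Hom(_, _) => u (tensorv a (e p)))) := Fal i.
    rewrite !comp_lfunE tensor_lfunE id_lfunE => ->.
    rewrite {1}(contr_right_sum (F (tensorv a (e p)))) !linear_sum (bigD1 q) //= big1.
      by rewrite addr0 tensor_lfunE id_lfunE contr_rightE r2vK mxE !eqxx scale1r.
    by move=> q' q'q; rewrite tensor_lfunE id_lfunE contr_rightE r2vK mxE (eq_sym q) (negPf q'q) andbF scale0r.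
  by exists c => a; rewrite -hE cE scale_lfunE.
exists (Hom (\matrix_(p, q) C p q)); apply: tensor_lfun_ext => a t.
rewrite tensor_lfunE (contr_right_sum (F _)).
have -> : t = \sum_p v2r t 0 p *: e p.
  rewrite -[LHS]v2rK {1}[v2r t]row_sum_delta linear_sum.
  by apply: eq_bigr => i _; rewrite linearZ.
pose ta : {linear T -> tensor A T} := HB.pack (tensorv a)
  (GRing.isLinear.Build k T (tensor A T) *:%R (tensorv a)
   (fun z u v => etrans (tensorvDr a (z *: u) v) (congr1 (+%R^~ _) (tensorvZr z a u)))).
pose tf : {linear T' -> tensor A' T'} := HB.pack (tensorv (f a))
  (GRing.isLinear.Build k T' (tensor A' T') *:%R (tensorv (f a))
   (fun z u v => etrans (tensorvDr (f a) (z *: u) v) (congr1 (+%R^~ _) (tensorvZr z (f a) u)))).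
set h := Hom _.
have hE p : h (e p) = \sum_q C p q *: e' q.
  apply: v2r_inj; rewrite v2r_lfun r2vK -rowE linear_sum [LHS]row_sum_delta.
  by apply: eq_bigr => q _; rewrite linearZ /= r2vK !mxE.
rewrite -(contr_right_sum (F _)) -[tensorv a _]/(ta _) -[RHS]/(tf _) !linear_sum.
apply: eq_bigr => p _; rewrite !linearZ /= hE; congr (_ *: _).
rewrite [LHS]contr_right_sum -[RHS]/(tf _) linear_sum; apply: eq_bigr => q _.
by rewrite linearZ /= CE tensorvZl.
Qed.

End TensorSlices.

Section TensorSwap.
Variable k : fieldType.

Definition tensor_swap (A T : vectType k) : 'Hom(tensor A T, tensor T A) :=
  linfun (fun u : tensor A T => u^T : tensor T A).

Lemma tensor_swapE (A T : vectType k) (a : A) (t : T) : tensor_swap A T (tensorv a t) = tensorv t a.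
Proof. by rewrite lfunE /tensorv /= trmx_mul trmxK. Qed.

(** tensor_slice_left after exchanging the two factors. *)
Lemma tensor_slice_right (A A' T T' : vectType k) (F : 'Hom(tensor A T, tensor A' T'))
    (I : Type) (tau : I -> 'End(T)) (tau' : I -> 'End(T')) (h : 'Hom(T, T')) :
  (forall i, F \o tensor_lfun \1 (tau i) = tensor_lfun \1 (tau' i) \o F)%VF ->
  (forall h' : 'Hom(T, T'), (forall i, h' \o tau i = tau' i \o h')%VF ->
     exists c, h' = c *: h) ->
  exists f, F = tensor_lfun f h.
Proof.
move=> Ftau line.
have [|f fE] := @tensor_slice_left k T T' A A'
    (tensor_swap A' T' \o F \o tensor_swap T A)%VF I tau tau' h _ line.
  move=> i; apply: tensor_lfun_ext => t a.
  rewrite !comp_lfunE tensor_lfunE !tensor_swapE id_lfunE.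
  have /(congr1 (fun u : 'Hom(_, _) => u (tensorv a t))) := Ftau i.
  rewrite !comp_lfunE tensor_lfunE id_lfunE => ->.
  move: (F _) => u; rewrite -!comp_lfunE; congr (fun_of_lfun _ u).
  apply: tensor_lfun_ext => a' t'.
  by rewrite !comp_lfunE !tensor_lfunE !tensor_swapE tensor_lfunE !id_lfunE.
exists f; apply: tensor_lfun_ext => a t; rewrite tensor_lfunE -[RHS]tensor_swapE.
have /(congr1 (fun u : 'Hom(_, _) => u (tensorv t a))) := fE.
rewrite tensor_lfunE => <-; rewrite !comp_lfunE tensor_swapE -comp_lfunE.
move: (F _) => u; rewrite -[LHS]id_lfunE; congr (fun_of_lfun _ u).
by apply: tensor_lfun_ext => a' t'; rewrite id_lfunE comp_lfunE !tensor_swapE.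
Qed.

End TensorSwap.

Section TensRep.
Variables (k : fieldType) (L : lieAlgType k) (A A' T T' : fdrep L).

Lemma tens_rep_act a :
  rep_act (tens_rep A T) a =
  tensor_lfun (rep_act A a) \1 + tensor_lfun \1 (rep_act T a).
Proof.
apply: tensor_lfun_ext => v w.
by rewrite tens_repE add_lfunE !tensor_lfunE !id_lfunE.
Qed.

Lemma hom_act_tensor a (f : 'Hom(A, A')) (h : 'Hom(T, T')) :
  hom_act (V := tens_rep A T) (V' := tens_rep A' T') a (tensor_lfun f h) =
  tensor_lfun (hom_act a f) h + tensor_lfun f (hom_act a h).
Proof.
apply: tensor_lfun_ext => v w; rewrite [RHS]add_lfunE !tensor_lfunE !hom_actE.
rewrite [LHS](@hom_actE _ _ (tens_rep A T) (tens_rep A' T')).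
transitivity (rep_act (tens_rep A' T') a (tensorv (f v) (h w)) -
    tensor_lfun f h (tensorv (rep_act A a v) w + tensorv v (rep_act T a w))).
  by rewrite -(tensor_lfunE f h) -tens_repE.
rewrite tens_repE linearD /= !tensor_lfunE.
have BL (x y : A') (z : T') : tensorv (x - y) z = tensorv x z - tensorv y z.
  by rewrite tensorvDl -scaleN1r tensorvZl scaleN1r.
have BR (x : A') (y z : T') : tensorv x (y - z) = tensorv x y - tensorv x z.
  by rewrite tensorvDr -scaleN1r tensorvZr scaleN1r.
by rewrite BL BR opprD addrACA.
Qed.

Lemma hom_act_eq0 (V V' : fdrep L) a (u : 'Hom(V, V')) :
  hom_act a u = 0 <-> (u \o rep_act V a = rep_act V' a \o u)%VF.
Proof.
rewrite /hom_act; split=> [h|->]; last exact: subrr.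
by apply/esym/eqP; rewrite -subr_eq0 h.
Qed.

End TensRep.

Section BigTensor.
Variables (k : closedFieldType) (n : nat) (m : 'I_n -> nat) (g : fdLieAlgType k).
Variables (sigma : 'I_n -> lie_aut g) (xi : torus k n).
Local Notation M := (multiloop m sigma xi).
Variable s : seq (torus k n).
Variable pt : torus k n -> g -> M.
Hypothesis ptE : forall x y v, x \in s -> y \in s -> pt x v y = if x == y then v else 0.
Variables W W' : torus k n -> fdrep g.
Implicit Types (x y z : torus k n) (f : M) (v w : g) (l : seq (torus k n)).
Local Notation evW x := (ev_rep m sigma xi x (W x)).
Local Notation evW' x := (ev_rep m sigma xi x (W' x)).
Local Notation TW l := (big_tens_rep l (fun x => evW x)).
Local Notation TW' l := (big_tens_rep l (fun x => evW' x)).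

Lemma ev_repE x (U : fdrep g) f :
  rep_act (ev_rep m sigma xi x U) f = rep_act U (f x).
Proof. by apply/lfunP => u; rewrite mk_repE. Qed.

Lemma ev_hom_act x f (u : 'Hom(W x, W' x)) :
  hom_act (V := evW x) (V' := evW' x) f u = hom_act (V := W x) (V' := W' x) (f x) u.
Proof. by rewrite /hom_act !ev_repE. Qed.

Lemma big_tens_vanish l (U : torus k n -> fdrep g) f : vanishes l f ->
  rep_act (big_tens_rep l (fun x => ev_rep m sigma xi x (U x))) f = 0.
Proof.
elim: l => [|x l IH] f0.
  by apply/lfunP => t; rewrite [RHS]zero_lfunE; apply: mk_repE.
rewrite tens_rep_act ev_repE f0 ?mem_head // IH; last first.
  by move=> y yl; rewrite f0 // inE yl orbT.
by rewrite !linear0 tensor_lfun0l tensor_lfun0r addr0.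
Qed.

Lemma pt_vanish x v l : {subset l <= s} -> x \in s -> x \notin l -> vanishes l (pt x v).
Proof.
move=> ls xs xl y yl; rewrite (ptE v xs (ls y yl)).
by case: eqP => // xy; rewrite xy yl in xl.
Qed.

Section Cons.
Variables (y : torus k n) (l : seq (torus k n)).
Hypotheses (ls : {subset y :: l <= s}) (yl : y \notin l).

Let ys : y \in s. Proof. by apply: ls; rewrite mem_head. Qed.
Let ls' : {subset l <= s}. Proof. by move=> z zl; apply: ls; rewrite inE zl orbT. Qed.

Lemma pt_head_act v (U : torus k n -> fdrep g) :
  rep_act (big_tens_rep (y :: l) (fun x => ev_rep m sigma xi x (U x))) (pt y v) =
  tensor_lfun (rep_act (U y) v) \1.
Proof.
rewrite tens_rep_act big_tens_vanish; last exact: pt_vanish.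
by rewrite tensor_lfun0r addr0 ev_repE (ptE v ys ys) eqxx.
Qed.

Lemma pt_tail_act z v (U : torus k n -> fdrep g) : z \in l ->
  rep_act (big_tens_rep (y :: l) (fun x => ev_rep m sigma xi x (U x))) (pt z v) =
  tensor_lfun \1 (rep_act (big_tens_rep l (fun x => ev_rep m sigma xi x (U x))) (pt z v)).
Proof.
move=> zl; rewrite tens_rep_act ev_repE (ptE v (ls' zl) ys); case: eqP => [zy|_].
  by case/negP: yl; rewrite -zy.
by rewrite linear0 tensor_lfun0l add0r.
Qed.

Lemma head_slice (F : 'Hom(TW (y :: l), TW' (y :: l))) (t : 'Hom(W y, W' y)) :
  (forall v, hom_act (pt y v) F = 0) ->
  (forall h : 'Hom(W y, W' y), is_rep_hom h -> exists c, h = c *: t) ->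
  exists h : 'Hom(TW l, TW' l), F = tensor_lfun t h.
Proof.
move=> F0 line; apply: (@tensor_slice_left k (W y) (W' y) (TW l) (TW' l) F g
    (rep_act (W y)) (rep_act (W' y))) => [v|h hh].
  by have /hom_act_eq0 := F0 v; rewrite !pt_head_act.
apply: line => v w; have /(congr1 (fun u : 'Hom(_, _) => u w)) := hh v.
by rewrite !comp_lfunE.
Qed.

(** The predicate r selects the points at which equivariance is known: one point
    for a vanishing result, all points but one for the description of a slice. *)
Lemma tail_slice (r : pred (torus k n)) (F : 'Hom(TW (y :: l), TW' (y :: l)))
    (h : 'Hom(TW l, TW' l)) :
  (forall z v, z \in l -> r z -> hom_act (pt z v) F = 0) ->
  (forall h' : 'Hom(TW l, TW' l),
     (forall z v, z \in l -> r z -> hom_act (pt z v) h' = 0) -> exists c, h' = c *: h) ->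
  exists t : 'Hom(W y, W' y), F = tensor_lfun t h.
Proof.
move=> F0 line.
pose I := {p : torus k n * g | p.1 \in l /\ r p.1}.
apply: (@tensor_slice_right k (W y) (W' y) (TW l) (TW' l) F I
   (fun p => rep_act (TW l) (pt (sval p).1 (sval p).2))
   (fun p => rep_act (TW' l) (pt (sval p).1 (sval p).2))) => [[[z v] /= [zl rz]]|h' hh].
  by have /hom_act_eq0 := F0 z v zl rz; rewrite !pt_tail_act.
apply: line => z v zl rz; apply/hom_act_eq0.
exact: hh (exist _ (z, v) (conj zl rz)).
Qed.

End Cons.

(** The slices of F along the factor at x are equivariant maps from W x to W' x. *)
Lemma big_tens_zero l x : uniq l -> {subset l <= s} -> x \in l ->
  (forall h : 'Hom(W x, W' x), is_rep_hom h -> h = 0) ->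
  forall F : 'Hom(TW l, TW' l), (forall v, hom_act (pt x v) F = 0) -> F = 0.
Proof.
elim: l => // y l IH /= /andP[yl ul] ls xl Wx0 F F0.
have ls' : {subset l <= s} by move=> z zl; apply: ls; rewrite inE zl orbT.
move: xl; rewrite inE; have [xy _|xy /= xl] := eqVneq x y.
  rewrite -xy in yl ls F F0 *.
  have [h|h ->] := head_slice ls yl (t := 0) F0.
    by move=> /Wx0 ->; exists 0; rewrite scaler0.
  exact: tensor_lfun0l.
have [z v _ /eqP ->|h' h0|t ->] := @tail_slice y l ls yl (pred1 x) F 0.
- exact: F0.
- exists 0; rewrite scaler0; apply: (IH ul ls' xl Wx0) => v.
  by apply: h0 => /=.
exact: tensor_lfun0r.
Qed.

Section Isomorphic.
Hypothesis W_irr : forall x, x \in s -> irreducible (W x).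

Lemma irr_neq0 x : x \in s -> exists w : W x, w <> 0.
Proof.
move=> /W_irr[W0 _]; apply: contrapT => nex; apply: W0; apply/eqP.
rewrite -subv0; apply/subvP => w _; rewrite memv0; apply/eqP; apply: contrapT => w0.
by apply: nex; exists w.
Qed.

Lemma iso_line x : x \in s -> rep_iso (W x) (W' x) -> exists t : 'Hom(W x, W' x),
  [/\ t <> 0, is_rep_hom t
    & forall h : 'Hom(W x, W' x), is_rep_hom h -> exists c, h = c *: t].
Proof.
move=> xs [t [bt th]]; exists t; split=> // [t0|h hh].
  have [w w0] := irr_neq0 xs; apply: w0; apply: (bij_inj bt).
  by rewrite t0 !zero_lfunE.
exact: (schur_scalar (W_irr xs) bt th hh).
Qed.

Lemma rep_hom_act x (t : 'Hom(W x, W' x)) f : is_rep_hom t ->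
  hom_act (V := evW x) (V' := evW' x) f t = 0.
Proof.
move=> th; apply/hom_act_eq0; rewrite !ev_repE; apply/lfunP => w.
by rewrite !comp_lfunE th.
Qed.

(** Schur's lemma, applied at one point after the other: the points being distinct,
    each copy of g acts on its own tensor factor only. *)
Lemma big_tens_line l : uniq l -> {subset l <= s} ->
  (forall x, x \in l -> rep_iso (W x) (W' x)) ->
  exists t : 'Hom(TW l, TW' l), [/\ t <> 0, forall f, hom_act f t = 0
    & forall h : 'Hom(TW l, TW' l),
        (forall z v, z \in l -> hom_act (pt z v) h = 0) -> exists c, h = c *: t].
Proof.
elim: l => [|y l IH] /=.
  move=> _ _ _; exists (\1 : 'End(k^o))%VF; split=> [e|f|h _].
  - have /(congr1 (fun u : 'Hom(_, _) => u (1 : k^o))) := e.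
    by rewrite id_lfunE zero_lfunE => /eqP; rewrite oner_eq0.
  - have t0 t : rep_act (triv_rep M) f t = 0 by apply: mk_repE.
    apply/lfunP => t; rewrite [RHS]zero_lfunE.
    by apply: etrans (@hom_actE _ _ (triv_rep M) (triv_rep M) _ _ _) _; rewrite !t0 linear0 subrr.
  exists (h (1 : k^o)); apply/lfunP => t; rewrite scale_lfunE id_lfunE.
  by rewrite -{1}[t]mulr1 -[t * 1]/(t *: (1 : k^o)) linearZ -[LHS]/(t * _) mulrC.
move=> /andP[yl ul] ls iso.
have ls' : {subset l <= s} by move=> z zl; apply: ls; rewrite inE zl orbT.
have iso' x : x \in l -> rep_iso (W x) (W' x) by move=> xl; apply: iso; rewrite inE xl orbT.
have ys : y \in s by apply: ls; rewrite mem_head.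
have [t [t0 th tline]] := IH ul ls' iso'.
have [q [q0 qh qline]] := iso_line ys (iso y (mem_head _ _)).
exists (tensor_lfun q t); split=> [/tensor_lfun_eq0[]//|f|h h0].
  by rewrite hom_act_tensor rep_hom_act // th tensor_lfun0l tensor_lfun0r addr0.
have [v|h' hE] := head_slice ls yl (F := h) _ qline; first by apply: h0; rewrite mem_head.
have [z v zl|c cE] := tline h'.
  have := h0 z v; rewrite inE zl orbT => /(_ isT).
  rewrite hE hom_act_tensor rep_hom_act // tensor_lfun0l add0r.
  by move=> /tensor_lfun_eq0[].
exists c; rewrite hE cE; have := tensor_lfunPr c q t 0.
by rewrite addr0 tensor_lfun0r addr0.
Qed.

(** J tensors a map at x with fixed isomorphisms at the other points; Schur's lemma
    at these points leaves no other choice. *)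
Lemma big_tens_slice l x : uniq l -> {subset l <= s} -> x \in l ->
  (forall y, y \in l -> y != x -> rep_iso (W y) (W' y)) ->
  exists J : {linear 'Hom(W x, W' x) -> 'Hom(TW l, TW' l)},
  [/\ injective J,
      forall f h, hom_act f (J h) = J (hom_act (V := W x) (V' := W' x) (f x) h)
    & forall F : 'Hom(TW l, TW' l),
        (forall z v, z \in l -> z != x -> hom_act (pt z v) F = 0) -> exists h, F = J h].
Proof.
elim: l => // y l IH /= /andP[yl ul] ls xl iso.
have ls' : {subset l <= s} by move=> z zl; apply: ls; rewrite inE zl orbT.
have inj_of (J : {linear 'Hom(W x, W' x) -> 'Hom(TW (y :: l), TW' (y :: l))}) :
    (forall h, J h = 0 -> h = 0) -> injective J.
  move=> J0 h h' /eqP; rewrite -subr_eq0 -linearB => /eqP/J0/eqP.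
  by rewrite subr_eq0 => /eqP.
move: xl; rewrite inE; have [xy _|xy /= xl] := eqVneq x y.
  move: inj_of; rewrite -xy in yl ls iso * => inj_of.
  have iso' z : z \in l -> rep_iso (W z) (W' z).
    by move=> zl; apply: iso; rewrite ?inE ?zl ?orbT //; apply: contra yl => /eqP <-.
  have [t [t0 th tline]] := big_tens_line ul ls' iso'.
  pose J (h : 'Hom(W x, W' x)) : 'Hom(TW (x :: l), TW' (x :: l)) := tensor_lfun h t.
  have J_lin : linear J by move=> c h h'; apply: tensor_lfunPl.
  pose JL : {linear 'Hom(W x, W' x) -> 'Hom(TW (x :: l), TW' (x :: l))} :=
    HB.pack J (GRing.isLinear.Build k _ _ *:%R J J_lin).
  exists JL; split=> /=.
  - by apply: (inj_of JL) => h /tensor_lfun_eq0[].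
  - by move=> f h; rewrite hom_act_tensor th tensor_lfun0r addr0 ev_hom_act.
  move=> F F0; have [z v zl zx|h' h0|q ->] := @tail_slice x l ls yl (predC1 x) F t.
  - by apply: F0; rewrite // inE zl orbT.
  - by apply: tline => z v zl; apply: h0 => //=; apply: contra yl => /eqP <-.
  by exists q.
have [|J [Jinj Jact Jsurj]] := IH ul ls' xl.
  by move=> z zl; apply: iso; rewrite inE zl orbT.
have ys : y \in s by apply: ls; rewrite mem_head.
have [|q [q0 qh qline]] := iso_line ys (iso y (mem_head _ _) _); first by rewrite eq_sym.
pose J1 h : 'Hom(TW (y :: l), TW' (y :: l)) := tensor_lfun q (J h).
have J1_lin : linear J1 by move=> c h h'; rewrite /J1 linearP tensor_lfunPr.
pose JL : {linear 'Hom(W x, W' x) -> 'Hom(TW (y :: l), TW' (y :: l))} :=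
  HB.pack J1 (GRing.isLinear.Build k _ _ *:%R J1 J1_lin).
exists JL; split=> /=.
- apply: (inj_of JL) => h /tensor_lfun_eq0[//|Jh]; apply: Jinj.
  by rewrite Jh linear0.
- by move=> f h; rewrite hom_act_tensor rep_hom_act // tensor_lfun0l add0r Jact.
move=> F F0; have [v|h' hE] := head_slice ls yl (F := F) _ qline.
  by apply: F0; rewrite ?mem_head // eq_sym.
have [z v zl zx|h hE'] := Jsurj h'; last by exists h; rewrite hE hE'.
have := F0 z v; rewrite inE zl orbT => /(_ isT zx).
rewrite hE hom_act_tensor rep_hom_act // tensor_lfun0l add0r.
by move=> /tensor_lfun_eq0[].
Qed.

End Isomorphic.

End BigTensor.

(** * Dimensions *)

Section Dimensions.
Variable k : fieldType.

Lemma lin_iso_trans (A B C : lmodType k) : lin_iso A B -> lin_iso B C -> lin_iso A C.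
Proof.
move=> [f fb] [h hb]; pose hf : {linear A -> C} := h \o f.
by exists hf; apply: bij_comp hb fb.
Qed.

Lemma lin_iso_dim (A B : vectType k) : dim A = dim B -> lin_iso A B.
Proof.
move=> AB; pose f (a : A) : B := r2v (castmx (erefl, AB) (v2r a)).
have castP p q (e : p = q) : linear (castmx (erefl 1, e) : 'rV[k]_p -> 'rV_q).
  by case: q / e => z u v; rewrite !castmx_id.
have f_lin : linear f by move=> z u v; rewrite /f linearP castP linearP.
pose F : {linear A -> B} := HB.pack f (GRing.isLinear.Build k A B *:%R f f_lin).
exists F; exists (fun b => r2v (castmx (esym erefl, esym AB) (v2r b))) => u.
  by rewrite -[F u]/(f u) /f r2vK castmxK v2rK.
by rewrite -[F _]/(f _) /f r2vK castmxKV v2rK.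
Qed.

Lemma dim_big_dsum (I : Type) (s : seq I) (F : I -> vectType k) :
  dim (big_dsum s F) = (\sum_(i <- s) dim (F i))%N.
Proof.
elim: s => [|i s IH]; first by rewrite big_nil dim_mx muln0.
by rewrite big_cons -IH.
Qed.

Lemma dim_family n (Y : vectType k) (K : {vspace Y}) :
  dim {ffun 'I_n -> subvs_of K} = (n * \dim K)%N.
Proof. by rewrite -[LHS]/(#|'I_n| * \dim K)%N card_ord. Qed.

Lemma dim_tensor_row n (Y : vectType k) (K : {vspace Y}) :
  dim (tensor (subvs_of K) 'rV[k]_n) = (n * \dim K)%N.
Proof. by rewrite dim_mx dim_mx mul1n mulnC. Qed.

End Dimensions.

Section HomTensor.
Variables (k : fieldType) (g : fdLieAlgType k) (A A' : fdrep g).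
Local Notation homs := (tens_rep (dual_rep A) A').

(** The map sending xi (x) w to v |-> xi(v) w is onto, between spaces of the same
    dimension. *)
Lemma hom_tensor_iso : exists kap : {linear homs -> 'Hom(A, A')},
  [/\ injective kap, forall h, exists t, kap t = h
    & forall a t, kap (rep_act homs a t) = hom_act a (kap t)].
Proof.
have b_lin (xi : 'Hom(A, k^o)) (w : A') : linear (fun v => xi v *: w).
  by move=> z u v; rewrite linearP scalerDl scalerA.
pose b xi w : 'Hom(A, A') := sval (mk_lfun (b_lin xi w)).
have bE xi w v : b xi w v = xi v *: w by rewrite /b; case: mk_lfun.
have bl w : linear (b^~ w).
  move=> z u v; apply/lfunP => x; rewrite add_lfunE scale_lfunE !bE add_lfunE scale_lfunE.
  by rewrite scalerDl scalerA.
have br xi : linear (b xi).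
  move=> z u v; apply/lfunP => x; rewrite add_lfunE scale_lfunE !bE.
  by rewrite scalerDr !scalerA mulrC.
have [kap kapE _] := tensorv_universal bl br.
have surj h : exists t, kap t = h.
  have cE i : linear (fun v : A => v2r v 0 i : k^o) by move=> z u v; rewrite linearP !mxE.
  pose c i : 'Hom(A, k^o) := sval (mk_lfun (cE i)).
  exists (\sum_i tensorv (c i) (h (r2v (delta_mx 0 i)))).
  apply/lfunP => v; rewrite linear_sum sum_lfunE -[in RHS](v2rK v).
  rewrite [in RHS](row_sum_delta (v2r v)) !linear_sum; apply: eq_bigr => i _.
  by rewrite kapE bE /c; case: mk_lfun => f /= ->; rewrite !linearZ.
exists kap; split=> //.
  have im1 : limg (linfun kap) = fullv.
    apply/eqP; rewrite eqEsubv subvf; apply/subvP => h _.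
    by have [t <-] := surj h; rewrite -lfunE memv_img ?memvf.
  have ker0 : lker (linfun kap) = 0%VS.
    apply/eqP; rewrite -dimv_eq0; have := limg_ker_dim (linfun kap) fullv.
    rewrite capfv im1 !dimvf => /eqP.
    have -> : dim homs = dim 'Hom(A, A').
      by rewrite dim_mx -[dim 'Hom(A, k^o)]/(dim A * 1)%N muln1.
    by rewrite -[X in _ == X]add0n eqn_add2r.
  have inj : injective (linfun kap) by apply/lker0P; rewrite ker0.
  by move=> t t' tt; apply: inj; rewrite !lfunE.
move=> a; pose l1 : {linear homs -> 'Hom(A, A')} := kap \o rep_act homs a.
pose l2 : {linear homs -> 'Hom(A, A')} := hom_act a \o kap.
apply: (@tensorv_ext k _ _ _ l1 l2) => xi w.
rewrite -[l1 _]/(kap (rep_act homs a (tensorv xi w))) -[l2 _]/(hom_act a (kap (tensorv xi w))).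
rewrite tens_repE linearD /= !kapE mk_repE.
apply/lfunP => v; rewrite hom_actE add_lfunE !bE opp_lfunE comp_lfunE linearZ /=.
by rewrite scaleNr addrC.
Qed.

End HomTensor.

Lemma rep_iso_transport (k : fieldType) (L : lieAlgType k) (V V' T T' : fdrep L) :
  rep_iso V T -> rep_iso V' T' ->
  exists F : {linear 'Hom(T, T') -> 'Hom(V, V')},
  [/\ injective F, forall u, exists t, F t = u
    & forall a t, hom_act a (F t) = F (hom_act a t)].
Proof.
move=> [al [[al' alK alK'] alh]] [be [[be' beK beK'] beh]].
have invE (X Y : vectType k) (f : 'Hom(X, Y)) f' : cancel f f' -> cancel f' f ->
    forall y, (f^-1)%VF y = f' y.
  move=> fK fK' y; apply: (can_inj fK); rewrite fK' limg_lfunVK //.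
  by rewrite -[y]fK' memv_img ?memvf.
have al'E := invE _ _ _ _ alK alK'; have be'E := invE _ _ _ _ beK beK'.
pose F t : 'Hom(V, V') := (be^-1 \o t \o al)%VF.
have F_lin : linear F.
  move=> z u v; apply/lfunP => x; rewrite !(comp_lfunE, add_lfunE, scale_lfunE).
  by rewrite linearP.
pose FL : {linear 'Hom(T, T') -> 'Hom(V, V')} :=
  HB.pack F (GRing.isLinear.Build k _ _ *:%R F F_lin).
exists FL; split=> [t t' tt|u|a t].
- apply/lfunP => y; have /(congr1 (fun h : 'Hom(_, _) => be (h (al' y)))) := tt.
  by rewrite /= !comp_lfunE !be'E !beK' alK'.
- exists (be \o u \o al^-1)%VF; apply/lfunP => v.
  by rewrite /= !comp_lfunE be'E beK al'E alK.
apply/lfunP => v; rewrite hom_actE /= !comp_lfunE hom_actE !be'E alh.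
by apply: (can_inj beK); rewrite linearB /= beh !beK'.
Qed.

(** * Extensions between tensor products of evaluation modules *)

Section PointHoms.
Variables (k : closedFieldType) (n : nat) (m : 'I_n -> nat) (g : fdLieAlgType k).
Variables (sigma : 'I_n -> lie_aut g) (xi : torus k n).
Local Notation M := (multiloop m sigma xi).
Variable s : seq (torus k n).
Hypothesis us : uniq s.
Variable pt : torus k n -> g -> M.
Hypothesis ptE : forall x y v, x \in s -> y \in s -> pt x v y = if x == y then v else 0.
Variables W W' : torus k n -> fdrep g.
Hypothesis W_irr : forall x, x \in s -> irreducible (W x).
Hypothesis W'_irr : forall x, x \in s -> irreducible (W' x).
Local Notation evW x := (ev_rep m sigma xi x (W x)).
Local Notation evW' x := (ev_rep m sigma xi x (W' x)).
Variables V V' : fdrep M.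
Hypothesis V_tensor : rep_iso V (big_tens_rep s (fun x => evW x)).
Hypothesis V'_tensor : rep_iso V' (big_tens_rep s (fun x => evW' x)).
Implicit Types (x y z : torus k n) (f : M) (v w : g).

Lemma ev_rep_iso x : x \in s -> rep_iso (evW x) (evW' x) -> rep_iso (W x) (W' x).
Proof.
move=> xs [t [tb th]]; exists t; split=> // v w.
have := th (pt x v) w; rewrite !ev_repE (ptE v xs xs) eqxx; exact.
Qed.

Lemma rep_iso_vanish (T : fdrep M) f : rep_iso V T -> rep_act T f = 0 ->
  forall u : V, rep_act V f u = 0.
Proof.
move=> [al [ab alh]] T0 u; apply: (bij_inj ab).
by rewrite alh T0 zero_lfunE linear0.
Qed.

(** The copy of g at x brackets trivially with the source of phi, the copy of g at
    z, so the values of phi are equivariant at x, and big_tens_zero applies. *)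
Lemma point_hom_eq0 x z (phi : 'Hom(g, 'Hom(V, V'))) :
  x \in s -> z \in s -> x != z -> ~ rep_iso (W x) (W' x) ->
  point_hom z phi -> phi = 0.
Proof.
move=> xs zs xz nW ph; have [F [Finj Fsurj Fact]] := rep_iso_transport V_tensor V'_tensor.
apply/lfunP => a; rewrite zero_lfunE; have [t tE] := Fsurj (phi a).
rewrite -tE (@big_tens_zero _ _ _ _ _ _ _ _ ptE W W' s x us _ xs _ t) ?linear0 //.
  by move=> h; apply: (schur_zero (W_irr xs) (W'_irr xs) nW).
move=> v; apply: Finj; rewrite -Fact tE linear0 -ph (ptE v xs zs) (negPf xz).
by rewrite lie0l linear0.
Qed.

(** The copies of g at the other points bracket trivially with the source of phi, so
    the values of phi lie in the image of big_tens_slice, a copy of the module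
    of maps from W x to W' x. *)
Lemma dim_point_hom x (H : {vspace 'Hom(g, 'Hom(V, V'))}) : x \in s ->
  (forall y, y \in s -> y != x -> rep_iso (W y) (W' y)) ->
  (forall phi, phi \in H <-> point_hom x phi) ->
  \dim H = \dim (rep_homs (adj_rep g) (tens_rep (dual_rep (W x)) (W' x))).
Proof.
move=> xs iso HP; have [F [Finj Fsurj Fact]] := rep_iso_transport V_tensor V'_tensor.
have [J [Jinj Jact Jsurj]] := big_tens_slice ptE W_irr us (fun _ h => h) xs iso.
have [kap [kinj ksurj kact]] := hom_tensor_iso (W x) (W' x).
set homs := tens_rep _ _ in kap kinj ksurj kact *.
pose L : {linear homs -> 'Hom(V, V')} := F \o (J \o kap).
have Linj : injective L by move=> t t' /Finj/Jinj/kinj.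
have Lact f t : hom_act f (L t) = L (rep_act homs (f x) t).
  by rewrite /L /= kact Fact Jact.
have Lsurj u : (forall z v, z \in s -> z != x -> hom_act (pt z v) u = 0) ->
    exists t, u = L t.
  move=> u0; have [t tE] := Fsurj u; have [z v zs zx|h hE] := Jsurj t.
    by apply: Finj; rewrite -Fact tE linear0; apply: u0.
  by have [q qE] := ksurj h; exists q; rewrite /L /= qE -hE tE.
have comp_lin : linear (fun psi : 'Hom(g, homs) => (linfun L \o psi)%VF).
  by move=> c p q; rewrite comp_lfunDr -comp_lfunZr.
pose Lam : {linear 'Hom(g, homs) -> 'Hom(g, 'Hom(V, V'))} :=
  HB.pack (fun psi : 'Hom(g, homs) => (linfun L \o psi)%VF)
    (GRing.isLinear.Build k _ _ *:%R _ comp_lin).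
have LamE psi a : Lam psi a = L (psi a) by rewrite /= comp_lfunE lfunE.
have adjE v w : rep_act (adj_rep g) v w = lie v w by apply: mk_repE.
have -> : H = (linfun Lam @: rep_homs (adj_rep g) homs)%VS.
  apply/vspaceP => phi; apply/idP/idP => [/HP ph|/memv_imgP[psi psiR ->]]; last first.
    have hpsi := elimT (@rep_homsP _ _ (adj_rep g) homs psi) psiR.
    apply/HP => f a; rewrite lfunE !LamE Lact; congr (L _).
    by have := hpsi (f x) a; rewrite adjE.
  have /choice[psi psiE] a : exists t, phi a = L t.
    apply: Lsurj => z v zs zx.
    by rewrite -ph (ptE v zs xs) (negPf zx) lie0l linear0.
  have psi_lin : linear psi.
    by move=> c a b; apply: Linj; rewrite -psiE linearP [RHS]linearP /= !psiE.
  have [P PE] := mk_lfun psi_lin.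
  have -> : phi = linfun Lam P.
    by apply/lfunP => a; rewrite lfunE LamE PE -psiE.
  apply: memv_img; apply: (introT (@rep_homsP _ _ (adj_rep g) homs P)) => v w; rewrite !PE adjE; apply: Linj.
  have := ph (pt x v) w; rewrite !psiE Lact (ptE v xs xs) eqxx; exact.
apply: limg_dim_eq; apply/eqP; rewrite -subv0; apply/subvP => psi.
rewrite memv_cap memv_ker lfunE memv0 => /andP[_ /eqP psi0].
apply/eqP/lfunP => a; apply: Linj; rewrite -LamE psi0 !zero_lfunE linear0 //.
Qed.

End PointHoms.

Theorem corollary6p4 (k : closedFieldType) (n : nat) (m : 'I_n -> nat)
  (g : fdLieAlgType k) (sigma : 'I_n -> lie_aut g) (xi : torus k n)
  (k_char0 : [pchar k] =i pred0)
  (n_gt0 : (0 < n)%N)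
  (m_gt0 : forall i, (0 < m i)%N)
  (g_semisimple : semisimple g)
  (sigma_comm : forall (i j : 'I_n) (a : g), sigma i (sigma j a) = sigma j (sigma i a))
  (sigma_order : forall (i : 'I_n) (a : g), iter (m i) (sigma i) a = a)
  (xi_primitive : forall i, (m i).-primitive_root (xi i))
  (V V' : fdrep (multiloop m sigma xi))
  (V_irr : irreducible V) (V'_irr : irreducible V')
  (s : {fset torus k n}) (s_orbits : distinct_orbits m xi s)
  (W W' : torus k n -> fdrep g)
  (W_irr : forall x, x \in s -> irreducible (W x))
  (W'_irr : forall x, x \in s -> irreducible (W' x))
  (V_tensor : rep_iso V
     (big_tens_rep (enum_fset s) (fun x => ev_rep m sigma xi x (W x))))
  (V'_tensor : rep_iso V'
     (big_tens_rep (enum_fset s) (fun x => ev_rep m sigma xi x (W' x)))) :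
  [/\ (exists x y, [/\ x \in s, y \in s, x != y,
           ~ rep_iso (ev_rep m sigma xi x (W x)) (ev_rep m sigma xi x (W' x))
         & ~ rep_iso (ev_rep m sigma xi y (W y)) (ev_rep m sigma xi y (W' y))]) ->
       forall e : Ext1 V V', e = 0,
      forall x0, x0 \in s ->
       ~ rep_iso (ev_rep m sigma xi x0 (W x0)) (ev_rep m sigma xi x0 (W' x0)) ->
       (forall x, x \in s -> x != x0 ->
          rep_iso (ev_rep m sigma xi x (W x)) (ev_rep m sigma xi x (W' x))) ->
       lin_iso (Ext1 V V')
         (tensor (subvs_of (rep_homs (adj_rep g)
                    (tens_rep (dual_rep (W x0)) (W' x0)))) 'rV[k]_n)
    & rep_iso V V' ->
       lin_iso (Ext1 V V)
         (big_dsum (enum_fset s) (fun x =>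
            tensor (subvs_of (rep_homs (adj_rep g)
                    (tens_rep (dual_rep (W x)) (W x)))) 'rV[k]_n))].
Proof.
have us : uniq (enum_fset s) by apply: fset_uniq.
have [pt [_ [ptE _ _]]] :=
  multiloop_lifts k_char0 m_gt0 sigma_comm sigma_order xi_primitive s_orbits.
have vanish (U : torus k n -> fdrep g) (f : multiloop m sigma xi) : vanishes (enum_fset s) f ->
    rep_act (big_tens_rep (enum_fset s) (fun x => ev_rep m sigma xi x (U x))) f = 0.
  exact: big_tens_vanish.
have ext_iso (X X' : fdrep (multiloop m sigma xi)) (U U' : torus k n -> fdrep g) (H : torus k n -> {vspace 'Hom(g, 'Hom(X, X'))}) :
    rep_iso X (big_tens_rep (enum_fset s) (fun x => ev_rep m sigma xi x (U x))) ->
    rep_iso X' (big_tens_rep (enum_fset s) (fun x => ev_rep m sigma xi x (U' x))) ->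
    (forall x phi, phi \in H x <-> point_hom x phi) ->
    lin_iso (Ext1 X X')
      (big_dsum (enum_fset s) (fun x => {ffun 'I_n -> subvs_of (H x)})).
  move=> isoX isoX'.
  by apply: ext1_multiloop => // f /vanish f0; apply: rep_iso_vanish; eauto.
have point_homs (X X' : fdrep (multiloop m sigma xi)) : exists H : torus k n -> {vspace 'Hom(g, 'Hom(X, X'))},
    forall x phi, phi \in H x <-> point_hom x phi.
  by have /choice[H HP] x := vspace_of (@point_hom_closed k n m g sigma xi X X' x); exists H.
have ev_iso x (U : fdrep g) (U' : fdrep g) : rep_iso U U' ->
    rep_iso (ev_rep m sigma xi x U) (ev_rep m sigma xi x U').
  move=> [t [tb th]]; exists t; split=> // f u.
  by rewrite !ev_repE; apply: th.
split.
(* Each point z differs from x or from y, so no phi at z survives. *)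
- move=> [x [y [xs ys xy nx ny]]] e; have [H HP] := point_homs V V'.
  have H0 z : z \in s -> H z = 0%VS.
    move=> zs; apply/eqP; rewrite -subv0; apply/subvP => phi /HP ph.
    rewrite memv0; apply/eqP; have [xz|xz] := eqVneq x z.
      apply: (point_hom_eq0 us ptE W_irr W'_irr V_tensor V'_tensor ys zs _ _ ph).
        by rewrite -xz eq_sym.
      by move=> /ev_iso.
    apply: (point_hom_eq0 us ptE W_irr W'_irr V_tensor V'_tensor xs zs xz _ ph).
    by move=> /ev_iso.
  have [f fb] := ext_iso V V' W W' H V_tensor V'_tensor HP.
  apply: (bij_inj fb); rewrite linear0; apply: v2r_inj.
  suff d0 : dim (big_dsum (enum_fset s) (fun x => {ffun 'I_n -> subvs_of (H x)})) = 0%N.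
    by move: (v2r _) (v2r _); rewrite d0 => u v; rewrite !thinmx0.
  rewrite dim_big_dsum big1_seq // => z /andP[_ zs].
  by rewrite dim_family H0 // dimv0 muln0.
- move=> x0 xs nx iso; have [H HP] := point_homs V V'.
  apply: lin_iso_trans (ext_iso V V' W W' H V_tensor V'_tensor HP) _.
  apply: lin_iso_dim; rewrite dim_big_dsum dim_tensor_row (bigD1_seq x0) //=.
  rewrite big1_seq => [|z /andP[zx zs]].
    rewrite addn0 dim_family; congr (_ * _)%N.
    apply: (dim_point_hom us ptE W_irr V_tensor V'_tensor xs _ (HP x0)) => y ys yx.
    by apply: (ev_rep_iso ptE) => //; apply: iso.
  rewrite dim_family; suff -> : H z = 0%VS by rewrite dimv0 muln0.
  apply/eqP; rewrite -subv0; apply/subvP => phi /HP ph; rewrite memv0; apply/eqP.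
  apply: (point_hom_eq0 us ptE W_irr W'_irr V_tensor V'_tensor xs zs _ _ ph).
    by rewrite eq_sym.
  by move=> /ev_iso.
move=> _; have [H HP] := point_homs V V.
apply: lin_iso_trans (ext_iso V V W W H V_tensor V_tensor HP) _.
apply: lin_iso_dim; rewrite !dim_big_dsum !big_seq; apply: eq_bigr => x xs.
rewrite dim_family dim_tensor_row; congr (_ * _)%N.
apply: (dim_point_hom us ptE W_irr V_tensor V_tensor xs _ (HP x)) => y ys yx.
exists \1%VF; split; last by move=> a v; rewrite !id_lfunE.
by exists id => v; rewrite id_lfunE.
Qed.
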